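(* For $0<y<1$ let $f_y^*$ denote the function that minimizes $I(f)$ over all $f\in\mathcal{F}_y$. Define $$\begin{aligned}Z(x,y)=\frac{2}{\pi}\biggl[&(x-\tfrac12)\arctan\biggl(\frac{\sqrt{\frac14-(x-\frac12)^2-(y-\frac12)^2}}{\frac12-y}\biggr)+\frac12\arctan\biggl(\frac{2(x-\frac12)(\frac12-y)}{\sqrt{\frac14-(x-\frac12)^2-(y-\frac12)^2}}\biggr)\\&-(\tfrac12-y)\arctan\biggl(\frac{x-\frac12}{\sqrt{\frac14-(x-\frac12)^2-(y-\frac12)^2}}\biggr)\biggr].\end{aligned}$$ For $0<y<1/2$, the minimizer is given by $$f_y^*(x)=\begin{cases}0,&0\le x\le\frac{1-2\sqrt{y(1-y)}}{2},\\ \frac y2+\frac12Z(x,y),&\frac{1-2\sqrt{y(1-y)}}{2}<x<\frac{1+2\sqrt{y(1-y)}}{2},\\ y,&\frac{1+2\sqrt{y(1-y)}}{2}\le x\le1.\end{cases}$$ For $y=1/2$ it is given by $f_{1/2}^*(x)=x/2$. For $1/2<y<1$ it is given in terms of the minimizer for $1-y$ by $f_y^*(x)=x-f_{1-y}^*(x)$. Moreover, for all $0<y<1$, $$I(f_y^* )=-\theta(y).$$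
   Context: For $0<y<1$, $\mathcal{F}_y$ is the set of functions $f:[0,1]\to[0,1]$ that are monotone nondecreasing, $1$-Lipschitz, and satisfy $f(0)=0$, $f(1)=y$. For such $f$ (differentiable almost everywhere), $$I(f)=-\int_0^1\int_0^1\log|s-t|\,f'(s)\bigl(f'(t)-1\bigr)\,ds\,dt.$$ The function $\theta$ is $$\theta(y)=\tfrac12y^2\log y+\tfrac12(1-y)^2\log(1-y)+\frac{2\log 2+3}{2}\,y(1-y).$$ *)

(* Defs.v *)
From HB Require Import structures.
From mathcomp Require Import all_boot all_order all_algebra.
From mathcomp Require Import all_classical all_reals all_analysis.

Set Implicit Arguments.
Unset Strict Implicit.
Unset Printing Implicit Defensive.

Import Order.TTheory GRing.Theory Num.Theory.
Import numFieldNormedType.Exports.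

Local Open Scope classical_set_scope.
Local Open Scope ring_scope.

(* A function on [0, 1] is represented by a total f : R -> R constrained, and
   compared with others, on [0, 1] only. *)
Definition calF {R : realType} (y : R) : set (R -> R) :=
  [set f : R -> R | [/\ f @` `[0, 1] `<=` `[0, 1],
               {in `[0, 1] &, {homo f : s t / s <= t}},
               1.-lipschitz_`[0, 1] f,
               f 0 = 0
             & f 1 = y]].

(* For f in calF y, derive1 f is the true derivative at almost every point of
   ]0, 1[. The remaining points (where derive1 f is a default value, and the
   endpoints, where it sees f outside [0, 1]) form a null set, as does each
   slice s = t of the diagonal, where ln 0 = 0. *)
Definition energy {R : realType} (f : R -> R) : \bar R :=
  let mu := @lebesgue_measure R in
  (- \int[mu]_(t in `[0%R, 1%R]) \int[mu]_(s in `[0%R, 1%R])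
       (ln `|(s : R) - (t : R)| * derive1 f s * (derive1 f t - 1))%:E)%E.

Definition minimizes_energy {R : realType} (y : R) (f : R -> R) : Prop :=
  calF y f /\ forall g : R -> R, calF y g -> (energy f <= energy g)%E.

Definition theta {R : realType} (y : R) : R :=
  1 / 2 * y ^+ 2 * ln y + 1 / 2 * (1 - y) ^+ 2 * ln (1 - y)
  + (2 * ln 2 + 3) / 2 * (y * (1 - y)).

Definition Zfun {R : realType} (x y : R) : R :=
  let r := Num.sqrt (1 / 4 - (x - 1 / 2) ^+ 2 - (y - 1 / 2) ^+ 2) in
  2 / pi * ((x - 1 / 2) * atan (r / (1 / 2 - y))
            + 1 / 2 * atan (2 * (x - 1 / 2) * (1 / 2 - y) / r)
            - (1 / 2 - y) * atan ((x - 1 / 2) / r)).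

Definition limit_profile {R : realType} (y x : R) : R :=
  if x <= (1 - 2 * Num.sqrt (y * (1 - y))) / 2 then 0
  else if x < (1 + 2 * Num.sqrt (y * (1 - y))) / 2 then y / 2 + 1 / 2 * Zfun x y
  else y.

(* Main.v *)
Require Import Defs.
From HB Require Import structures.
From mathcomp Require Import all_boot all_order all_algebra.
From mathcomp Require Import all_classical all_reals all_analysis.
From mathcomp Require Import measurable_realfun ring lra zify.

Set Implicit Arguments.
Unset Strict Implicit.
Unset Printing Implicit Defensive.

Import Order.TTheory GRing.Theory Num.Theory.
Import numFieldNormedType.Exports.

Local Open Scope classical_set_scope.
Local Open Scope ring_scope.

(** Write [v = 1/2 - f'] and let [B] be the logarithmic energy form on the unit interval,
    with kernel [- log |s - t|] ([logform]). As the kernel has mean [3/2], one gets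
    [I(f) = B(v, v) - 3/8] ([energy_logform]). For [y <= 1/2], the problem becomes:
    minimise a quadratic form over the densities [v <= 1/2] with mean [c = 1/2 - y] (the
    bound [v >= -1/2] will hold by itself). The case [y > 1/2] reduces to it by
    [f(x) -> x - f(x)], which changes the sign of [v] ([energy_reflect]).

    The form [B] is positive definite. In the variables [a = cos s], [b = cos t], the kernel
    expands in products of Chebyshev polynomials with positive coefficients, so that
    [B(u, u)] bounds every squared Chebyshev moment of [u] ([logform_ge]); if
    [B(u, u) = 0], then all the moments vanish, and with them the integrals of [u] over
    intervals ([logform0_step]).

    Hence [g] is the unique optimum as soon as its potential is a constant [L] where
    [g < 1/2] and at most [L] where [g = 1/2]: expanding around [g],
    [B(w, w) >= B(g, g) + 2 L (mean w - mean g) + B(w - g, w - g)] for every [w <= 1/2]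
    ([optimal_exists]).

    Such a [g] is a superposition of arcsine laws. The arcsine law of radius [rho] has the
    constant potential [log (2 / rho)] on its support and a smaller one elsewhere in the
    unit interval ([arcpot_in], [arcpot_le]). Mix the arcsine laws of radius
    [R_k = sqrt (1/4 - k^2)] around [1/2], over [0 <= k <= c]. All the supports contain the
    band of radius [R_c], so the potential of the mixture is constant there and smaller
    outside ([optimal_density]). Integrating the arcsine distribution functions over
    [k] gives a combination of arctangents ([integral_arccdf]), which is [x/2 - f(x)] for
    the profile [f] of the statement ([limit_profile_cprof]); it is constantly
    saturated, [f' = 0], outside the band.

    Finally, let [V(c)] be the minimal value of [B]. The variational inequality for two
    parameters says that [V(c') - V(c) >= 2 L(c) (c' - c)], where
    [L(c)] is the integral of [log (2 / R_k)] over [0 <= k <= c]. Since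
    [3/8 - theta (1/2 - c)] satisfies the same inequality and both vanish at [c = 0], they
    coincide ([optimal_value]). *)

(** * Null sets and densities of Lipschitz functions *)

Section measure_toolbox.
Context d (T : measurableType d) (R : realType) (mu : {measure set T -> \bar R}).
Import HBNNSimple.

(** The integral of a nonnegative function is a supremum over simple functions below
    it; killing such a simple function on the null set keeps its integral and puts it
    below the other function. *)
Lemma ge0_integral_null_congr_le (N : set T) (f g : T -> \bar R) :
  measurable N -> mu N = 0%E -> (forall x, 0 <= f x)%E -> (forall x, 0 <= g x)%E ->
  (forall x, ~ N x -> f x = g x) -> (\int[mu]_x f x <= \int[mu]_x g x)%E.
Proof.
move=> mN N0 f0 g0 fg; rewrite !ge0_integralTE//.
apply: ge_ereal_sup => _ [h /= hf <-].
have mNc : measurable (~` N) by exact: measurableC.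
apply: le_ereal_sup_tmp; exists (sintegral mu (proj_nnsfun h mNc)).
  exists (proj_nnsfun h mNc) => // x /=.
  rewrite mindicE; have [xN|xN] := boolP (x \in ~` N).
    by rewrite mulr1 -fg ?hf//; move: xN; rewrite inE.
  by rewrite mulr0.
rewrite -!integralT_nnsfun.
rewrite le_eqVlt; apply/orP; left; apply/eqP.
apply: ge0_ae_eq_integral => //.
- exact/measurable_EFinP.
- exact/measurable_EFinP.
- by move=> x _; rewrite lee_fin.
- by move=> x _; rewrite lee_fin.
exists N; split => // x /= /not_implyP [_ hx].
apply: contrapT => Nx; apply: hx; congr EFin.
by rewrite /= mindicE mem_set ?mulr1.
Qed.

Lemma ge0_integral_null_congr (N : set T) (f g : T -> \bar R) :
  measurable N -> mu N = 0%E -> (forall x, 0 <= f x)%E -> (forall x, 0 <= g x)%E ->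
  (forall x, ~ N x -> f x = g x) -> (\int[mu]_x f x = \int[mu]_x g x)%E.
Proof.
move=> mN N0 f0 g0 fg; apply/eqP; rewrite eq_le.
by rewrite !(ge0_integral_null_congr_le mN N0)// => x /fg.
Qed.

(** Stated for arbitrary functions: it serves to replace [derive1 f], about whose
    measurability nothing is assumed, by a density. *)
Lemma integral_null_congr (D N : set T) (f g : T -> \bar R) :
  measurable N -> mu N = 0%E ->
  (forall x, D x -> ~ N x -> f x = g x) ->
  (\int[mu]_(x in D) f x = \int[mu]_(x in D) g x)%E.
Proof.
move=> mN N0 fg; rewrite integral_mkcond [RHS]integral_mkcond.
have fg' x : ~ N x -> (f \_ D) x = (g \_ D) x.
  by move=> Nx; rewrite /patch; case: ifPn => // /[1!inE] Dx; exact: fg.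
rewrite integralE [RHS]integralE; congr (_ - _)%E.
- by apply: (ge0_integral_null_congr mN N0) => // x Nx; rewrite !funeposE fg'.
- by apply: (ge0_integral_null_congr mN N0) => // x Nx; rewrite !funenegE fg'.
Qed.
End measure_toolbox.

Section ae_lebesgue.
Context {R : realType}.
Local Notation mu := (@lebesgue_measure R).

Lemma ae_imp (P Q : R -> Prop) : (forall x, P x -> Q x) ->
  {ae mu, forall x, P x} -> {ae mu, forall x, Q x}.
Proof.
by move=> PQ; apply: filterS; [exact: (ae_filter_ringOfSetsType mu)|exact: PQ].
Qed.

Lemma ae_imp2 (P Q S : R -> Prop) : (forall x, P x -> Q x -> S x) ->
  {ae mu, forall x, P x} -> {ae mu, forall x, Q x} -> {ae mu, forall x, S x}.
Proof.
by move=> PQ; apply: filterS2; [exact: (ae_filter_ringOfSetsType mu)|exact: PQ].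
Qed.
End ae_lebesgue.

Section density.
Context {R : realType}.
Local Notation mu := (@lebesgue_measure R).
Implicit Types F g : R -> R.

Definition sub1lip F := forall x y : R, x <= y -> 0 <= F y - F x <= y - x.

Lemma sub1lip_continuous F : sub1lip F -> continuous F.
Proof.
move=> FL x; apply/cvgrPdist_le => e e0; near=> t.
apply: (@le_trans _ _ `|x - t|); last first.
  by near: t; apply: cvgr_dist_le.
have [xt|tx] := leP x t.
  have /andP[h1 h2] := FL _ _ xt.
  by rewrite distrC ger0_norm// [leRHS]distrC [leRHS]ger0_norm// subr_ge0.
have /andP[h1 h2] := FL _ _ (ltW tx).
by rewrite ger0_norm// [leRHS]ger0_norm// subr_ge0 ltW.
Unshelve. all: by end_near. Qed.

Let sub1lip_nd F : sub1lip F -> nondecreasing F.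
Proof. by move=> FL x y /FL/andP[]; rewrite subr_ge0. Qed.

Let sub1lip_rc F : sub1lip F -> right_continuous F.
Proof. by move=> FL; apply/right_continuousW; exact: sub1lip_continuous. Qed.

Let cumul F (FL : sub1lip F) : cumulative R R :=
  HB.pack F (isCumulative.Build R _ R F (sub1lip_nd FL) (sub1lip_rc FL)).

Let sub1lip_comp F : sub1lip F -> sub1lip (fun x => x - F x).
Proof.
move=> FL x y xy; have /andP[h1 h2] := FL _ _ xy.
by apply/andP; split; lra.
Qed.

Lemma LS_itv (F : cumulative R R) (a b : R) : a <= b ->
  lebesgue_stieltjes_measure F `]a, b]%classic = (F b - F a)%:E.
Proof.
move=> ab; rewrite /lebesgue_stieltjes_measure/= /measure_extension measurable_mu_extE/=.
  by rewrite wlength_itv_bnd.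
exact: is_ocitv.
Qed.

(** The measure with distribution function [x - F x] and [nu] add up to Lebesgue
    measure, because the two sides agree on half-open intervals. *)
Lemma sub1lip_measure_le (nu : {measure set (measurableTypeR R) -> \bar R}) F :
  sub1lip F ->
  (forall a b : R, a <= b -> nu `]a, b]%classic = (F b - F a)%:E) ->
  forall A, measurable A -> (nu A <= mu A)%E.
Proof.
move=> FL nuE A mA.
pose G := cumul (sub1lip_comp FL).
pose m := measure_add nu (lebesgue_stieltjes_measure G).
have mE X : ocitv X -> mu X = m X.
  move=> [[a b] _ <-] /=; rewrite /m measure_addE.
  have [ab|ba] := leP a b.
    rewrite nuE// [X in (_ + X)%E](_ : _ = (G b - G a)%:E); last exact: LS_itv.
    rewrite lebesgue_measure_itv/= lte_fin; case: ltgtP ab => // [ab _|-> _].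
      by rewrite -EFinB -EFinD/=; congr EFin; lra.
    by rewrite -EFinD/=; congr EFin; lra.
  rewrite set_itv_ge; last by rewrite bnd_simp -leNgt ltW.
  by rewrite measure0 measure0 measure0 adde0.
rewrite (lebesgue_measure_unique mE)//.
rewrite [leRHS](measure_addE nu (lebesgue_stieltjes_measure G) A).
by rewrite leeDl.
Qed.

Lemma cst_increment_derive (F G : R -> R) (x l : R) :
  (forall a b : R, a <= b -> F b - F a = G b - G a) ->
  is_derive x 1 G l -> is_derive x 1 F l.
Proof.
move=> FG dG.
have -> : F = (fun z => G z + (F 0 - G 0)).
  apply/funext => z; have [z0|/ltW z0] := leP 0 z; have := FG _ _ z0; lra.
by rewrite -[l]addr0; apply: is_deriveD.
Qed.

Lemma sub1lip_derive_bounds F (x l : R) : sub1lip F -> is_derive x 1 F l -> 0 <= l <= 1.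
Proof.
move=> FL [dF lE].
have cv : h^-1 *: (F (h *: 1 + x) - F x) @[h --> (0:R)^'+] --> l.
  by apply: cvg_dnbhs_at_right; rewrite -lE; exact: dF.
have bd : \forall h \near (0:R)^'+, 0 <= h^-1 *: (F (h *: 1 + x) - F x) <= 1.
  near=> h; have h0 : 0 < h by near: h; exact: nbhs_right_gt.
  have xh : x <= h *: 1 + x by rewrite scaler1 lerDr ltW.
  have /andP[u1 u2] := FL _ _ xh; rewrite /GRing.scale/= mulr1 in u1 u2 *.
  rewrite mulr_ge0 ?invr_ge0 ?(ltW h0)//= mulrC ler_pdivrMr// mul1r.
  by apply: (le_trans u2); rewrite addrK.
apply/andP; split.
  by apply: (cvgr_to_ge cv); apply: filterS bd => h /andP[].
by apply: (cvgr_to_le cv); apply: filterS bd => h /andP[].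
Unshelve. all: by end_near. Qed.

(** Domination by Lebesgue measure gives a Radon-Nikodym derivative, and Lebesgue's
    differentiation theorem identifies it almost everywhere with the derivative of [F]. *)
Lemma sub1lip_density (nu0 : {measure set (measurableTypeR R) -> \bar R}) F :
  sub1lip F -> (nu0 setT < +oo)%E ->
  (forall a b : R, a <= b -> nu0 `]a, b]%classic = (F b - F a)%:E) ->
  exists g : R -> R, [/\ measurable_fun setT g, forall x, 0 <= g x <= 1,
    forall a b : R, a <= b -> (\int[mu]_(x in `]a, b]) (g x)%:E = (F b - F a)%:E)%E,
    {ae mu, forall x, is_derive (x : R) (1 : R) F (g x)} &
    forall k : R -> \bar R, measurable_fun setT k -> (forall x, 0 <= k x)%E ->
      (\int[nu0]_x k x = \int[mu]_x (k x * (g x)%:E))%E].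
Proof.
move=> FL nuoo nuE.
pose nu : {finite_measure set (measurableTypeR R) -> \bar R} := mfrestr measurableT nuoo.
have nu_nu0 A : nu A = nu0 A by rewrite /nu/= /mfrestr /mrestr setIT.
have nuac : nu `<< mu.
  apply/null_content_dominatesP => A mA muA0.
  apply/eqP; rewrite eq_le measure_ge0 andbT -muA0.
  by rewrite nu_nu0 (sub1lip_measure_le FL).
pose p := Radon_Nikodym_SigmaFinite.f nu mu.
pose g0 x := fine (p x).
have pE x : p x = (g0 x)%:E by rewrite fineK// Radon_Nikodym_SigmaFinite.f_fin_num.
have pI : mu.-integrable setT (EFin \o g0).
  have -> : EFin \o g0 = p by apply/funext => x /=; rewrite pE.
  exact: Radon_Nikodym_SigmaFinite.f_integrable.
have mg0 : measurable_fun setT g0.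
  by move/integrableP : pI => [/measurable_EFinP].
have g0ab a b : a <= b -> (\int[mu]_(x in `]a, b]) (g0 x)%:E = (F b - F a)%:E)%E.
  move=> ab; rewrite -nuE// -nu_nu0 (Radon_Nikodym_SigmaFinite.f_integral nuac)//.
  by apply: eq_integral => x _; rewrite -pE.
have pIS A : measurable A -> mu.-integrable A (EFin \o g0).
  by move=> mA; exact: integrableS pI.
pose F1 (x : R) := (\int[mu]_(t in `]-oo, x]) g0 t)%R.
have F1E a b : a <= b -> F b - F a = F1 b - F1 a.
  move=> ab; rewrite /F1 Rintegral_itvB ?bnd_simp//; last exact: pIS.
  by rewrite /Rintegral g0ab.
have dF : {ae mu, forall x, is_derive (x : R) (1 : R) F (g0 x)}.
  have : {ae mu, forall x, derivable F1 x 1 /\ F1^`()%classic x = g0 x}.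
    apply: FTC1Ny => [y|]; first exact: pIS.
    by apply: open_integrable_locally => //; exact: openT.
  apply: ae_imp => x [d1 d2]; apply: (cst_increment_derive F1E).
  by apply: DeriveDef; [exact: d1|rewrite -derive1E; exact: d2].
(* [g0] takes its values in [0, 1] almost everywhere; clipping makes this hold everywhere. *)
pose g x := Num.max 0 (Num.min 1 (g0 x)).
have mg : measurable_fun setT g.
  by apply: measurable_maxr => //; exact: measurable_minr.
have gE : {ae mu, forall x, g0 x = g x}.
  apply: ae_imp dF => x /(sub1lip_derive_bounds FL) /andP[h0 h1].
  by rewrite /g (min_r h1) (max_r h0).
exists g; split => //.
- move=> x; rewrite /g le_max lexx/= ge_max ler01/=.
  by rewrite ge_min lexx.
- move=> a b ab; rewrite -g0ab//; apply: ae_eq_integral => //.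
  + by apply/measurable_EFinP; exact: measurable_funTS.
  + by apply/measurable_EFinP; exact: measurable_funTS.
  + by apply: ae_imp gE => x -> _.
- by apply: ae_imp2 dF gE => x h <-.
- move=> k mk k0.
  have -> : (\int[nu0]_x k x = \int[nu]_x k x)%E by apply: eq_measure_integral => A _ _; exact/esym/nu_nu0.
  rewrite -(Radon_Nikodym_SigmaFinite.change_of_variables nuac)//.
  apply: ae_eq_integral => //.
  + by apply: emeasurable_funM => //; apply: measurable_int (Radon_Nikodym_SigmaFinite.f_integrable nuac).
  + by apply: emeasurable_funM => //; exact/measurable_EFinP.
  + by apply: ae_imp gE => x gx _; rewrite -gx -pE.
Qed.
End density.

(** * The logarithmic kernel in Chebyshev polynomials *)

Section log_kernel.
Context {R : realType}.
Implicit Types (r a b t u : R) (n k : nat).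

(** The squared distance between [1] and [r * exp (i * t)]. *)
Definition circ r t : R := 1 - 2 * r * cos t + r ^+ 2.

Lemma circ_ge r t : 0 <= r -> (1 - r) ^+ 2 <= circ r t.
Proof.
move=> r0; rewrite /circ; have := cos_le1 t => c1.
have : 0 <= r * (1 - cos t) by rewrite mulr_ge0// subr_ge0.
lra.
Qed.

Lemma circ_gt0 r t : 0 <= r < 1 -> 0 < circ r t.
Proof.
move=> /andP[r0 r1]; apply: lt_le_trans (circ_ge t r0).
by rewrite exprn_gt0// subr_gt0.
Qed.

Lemma circ_le4 r t : 0 <= r <= 1 -> circ r t <= 4.
Proof.
move=> /andP[r0 r1]; rewrite /circ; have c1 := cos_geN1 t.
have : 0 <= r * (1 + cos t) by rewrite mulr_ge0//; lra.
have : r ^+ 2 <= 1 by rewrite expr_le1.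
lra.
Qed.

(** The real part of [- log (1 - r * exp (i * t))]; its Taylor expansion in [r] is
    [cosseries]. *)
Definition logcirc r t : R := - (1 / 2) * ln (circ r t).

Definition cosseries n r t : R :=
  \sum_(k < n) r ^+ k.+1 / k.+1%:R * cos (k.+1%:R * t).

(** The sum telescopes: [circ r t] is, up to the reversal of its coefficients, the
    characteristic polynomial of the three-term recurrence of the cosines. *)
Lemma circ_cossum n r t :
  circ r t * (\sum_(k < n) r ^+ k * cos (k.+1%:R * t)) =
  cos t - r - r ^+ n * cos (n.+1%:R * t) + r ^+ n.+1 * cos (n%:R * t).
Proof.
elim: n => [|n IH]; first by rewrite big_ord0 mulr0 mul0r cos0 [1%:R * t]mul1r; ring.
rewrite big_ord_recr/= mulrDr IH /circ.
have E1 : cos (n.+2%:R * t) = cos (n.+1%:R * t) * cos t - sin (n.+1%:R * t) * sin t.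
  by rewrite -cosD; congr cos; rewrite -[n.+2%:R]natr1; ring.
have E2 : cos (n%:R * t) = cos (n.+1%:R * t) * cos t + sin (n.+1%:R * t) * sin t.
  by rewrite -cosB; congr cos; rewrite -[n.+1%:R]natr1; ring.
rewrite E1 E2 !exprS; ring.
Qed.

Lemma is_derive_logcirc r t : 0 <= r < 1 ->
  is_derive r 1 (logcirc ^~ t) ((cos t - r) / circ r t).
Proof.
move=> r01; have c0 := circ_gt0 t r01.
have dl := is_derive1_ln c0.
have dc : is_derive r 1 (circ ^~ t) (- 2 * cos t + 2 * r).
  rewrite /circ; apply: is_derive_eq.
  by rewrite /GRing.scale/=; ring.
have dlc : is_derive r 1 (@ln R \o (circ ^~ t)) ((circ r t)^-1 * (- 2 * cos t + 2 * r)).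
  by apply: is_derive1_comp.
have -> : logcirc ^~ t = (- (1 / 2)) *: (@ln R \o (circ ^~ t)) by [].
apply: is_derive_eq.
rewrite /GRing.scale/=; field.
by rewrite gt_eqF.
Qed.

Lemma is_derive_cosseries n r t :
  is_derive r 1 (fun x => cosseries n x t) (\sum_(k < n) r ^+ k * cos (k.+1%:R * t)).
Proof.
have -> : (fun x => cosseries n x t) =
  \sum_(k < n) (fun x => x ^+ k.+1 / k.+1%:R * cos (k.+1%:R * t)).
  by apply/funext => x; rewrite fct_sumE.
apply: is_derive_sum => k.
have k0 : (k.+1%:R : R) != 0 by rewrite pnatr_eq0.
have dX : is_derive r 1 (fun x : R => x ^+ k.+1) (k.+1%:R * r ^+ k).
  apply: DeriveDef; first exact: exprn_derivable.
  by rewrite exp_derive /GRing.scale/= mulr1.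
have -> : (fun x => x ^+ k.+1 / k.+1%:R * cos (k.+1%:R * t)) =
  (cos (k.+1%:R * t) / k.+1%:R) *: (fun x : R => x ^+ k.+1).
  by apply/funext => x; rewrite scalrfctE/= /GRing.scale/=; ring.
apply: is_derive_eq.
by rewrite /GRing.scale/=; move: (k.+1%:R : R) k0 => c c0; field.
Qed.

(** Both sides vanish at [r = 0], and the derivatives in [r] differ by the tail of
    a geometric series. *)
Lemma logcirc_cosseries n r t : 0 <= r < 1 ->
  `|logcirc r t - cosseries n r t| <= 2 * r ^+ n.+1 / (1 - r) ^+ 2.
Proof.
move=> /andP[r0 r1].
pose f x := logcirc x t - cosseries n x t.
pose df x := (cos t - x) / circ x t - \sum_(k < n) x ^+ k * cos (k.+1%:R * t).
have dfE (x : R) : 0 <= x < 1 -> is_derive x 1 f (df x).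
  move=> x01; have h1 := is_derive_logcirc t x01; have h2 := is_derive_cosseries n x t.
  exact: (is_deriveB h1 h2).
have f0 : f 0 = 0.
  rewrite /f /logcirc /circ mulr0 mul0r subr0 expr0n/= addr0 ln1 mulr0.
  by rewrite /cosseries big1 ?subr0// => k _; rewrite expr0n/= mul0r mul0r.
have [||c] := @MVT_segment _ f df 0 r r0.
- by move=> x /[!in_itv]/= /andP[x0 xr]; apply: dfE; rewrite (ltW x0) (lt_trans xr).
- apply: continuous_in_subspaceT => x /[!inE]/= /[!in_itv]/= /andP[x0 xr].
  have [dx _] := dfE x (introT andP (conj x0 (le_lt_trans xr r1))).
  exact/differentiable_continuous/derivable1_diffP.
rewrite in_itv/= => /andP[c0 cr]; rewrite f0 !subr0 => fE.
have c01 : 0 <= c < 1 by rewrite c0 (le_lt_trans cr).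
have q0 := circ_gt0 t c01.
have dcE : df c = (c ^+ n * cos (n.+1%:R * t) - c ^+ n.+1 * cos (n%:R * t)) / circ c t.
  have := circ_cossum n c t; rewrite /df.
  set s := \sum_(k < n) _ => sE.
  have -> : s = (cos t - c - c ^+ n * cos (n.+1%:R * t) + c ^+ n.+1 * cos (n%:R * t)) / circ c t.
    by rewrite -sE mulrAC divff ?mul1r// gt_eqF.
  by field; rewrite gt_eqF.
rewrite -/(f r) fE dcE normrM normrM (ger0_norm r0) normfV (gtr0_norm q0).
have cn : c ^+ n <= r ^+ n by rewrite lerXn2r ?nnegrE.
have num : `|c ^+ n * cos (n.+1%:R * t) - c ^+ n.+1 * cos (n%:R * t)| <= 2 * r ^+ n.
  apply: (le_trans (ler_normB _ _)); rewrite !normrM !(ger0_norm (exprn_ge0 _ c0)).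
  have h1 : c ^+ n * `|cos (n.+1%:R * t)| <= r ^+ n.
    by rewrite -[leRHS]mulr1 ler_pM ?exprn_ge0// cos_max.
  have h2 : c ^+ n.+1 * `|cos (n%:R * t)| <= r ^+ n.
    rewrite -[leRHS]mulr1 ler_pM ?exprn_ge0 ?cos_max//.
    apply: le_trans cn; rewrite exprS ler_piMl ?exprn_ge0//.
    by rewrite ltW// (le_lt_trans cr).
  by lra.
have -> : 2 * r ^+ n.+1 / (1 - r) ^+ 2 = 2 * r ^+ n / (1 - r) ^+ 2 * r.
  by rewrite exprSr; ring.
rewrite ler_wpM2r//.
apply: ler_pM => //.
  by rewrite invr_ge0 ltW.
rewrite lef_pV2 ?posrE//; last by rewrite exprn_gt0// subr_gt0.
apply: le_trans (circ_ge t c0).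
by rewrite lerXn2r ?nnegrE ?subr_ge0 ?(ltW r1) ?(le_trans cr (ltW r1))// lerB.
Qed.

(** The symmetrised kernel [logcirc r (phi + psi) + logcirc r (phi - psi)] written in
    the variables [a = cos phi] and [b = cos psi]. *)
Definition chebq r a b : R :=
  (1 - r ^+ 2) ^+ 2 + 4 * r ^+ 2 * (a - b) ^+ 2 - 4 * r * (1 - r) ^+ 2 * (a * b).

Definition cheblog r a b : R := - (1 / 2) * ln (chebq r a b).

Fixpoint chebT k a : R :=
  match k with
  | 0 => 1
  | k'.+1 => match k' with 0 => a | k''.+1 => 2 * a * chebT k' a - chebT k'' a end
  end.

Definition chebsum n r a b : R :=
  \sum_(k < n) (2 * r ^+ k.+1 / k.+1%:R) * (chebT k.+1 a * chebT k.+1 b).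

(** With [a = cos s] and [b = cos t], the Chebyshev expansion in two variables follows
    from the cosine expansion at [s + t] and [s - t]. *)
Lemma chebq_cos r s t : chebq r (cos s) (cos t) = circ r (s + t) * circ r (s - t).
Proof.
rewrite /chebq /circ cosD cosB.
transitivity ((1 + r ^+ 2 - 2 * r * (cos s * cos t)) ^+ 2 -
  4 * r ^+ 2 * (sin s ^+ 2 * sin t ^+ 2)); last by ring.
by rewrite !sin2cos2; ring.
Qed.

Lemma cheblog_cos r s t : 0 <= r < 1 ->
  cheblog r (cos s) (cos t) = logcirc r (s + t) + logcirc r (s - t).
Proof.
move=> r01; rewrite /cheblog chebq_cos lnM ?posrE ?circ_gt0// /logcirc; ring.
Qed.

Lemma cosM2 (x y : R) : cos (x + y) + cos (x - y) = 2 * (cos x * cos y).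
Proof. by rewrite cosD cosB; ring. Qed.

Lemma chebTSS k a : chebT k.+2 a = 2 * a * chebT k.+1 a - chebT k a.
Proof. by []. Qed.

Lemma chebT_cos k t : chebT k (cos t) = cos (k%:R * t).
Proof.
suff : chebT k (cos t) = cos (k%:R * t) /\ chebT k.+1 (cos t) = cos (k.+1%:R * t) by case.
elim: k => [|k [IH1 IH2]]; first by rewrite /= mul0r cos0 mul1r.
split=> //; rewrite chebTSS IH1 IH2.
have -> : k.+2%:R * t = k.+1%:R * t + t by rewrite -[k.+2%:R]natr1; ring.
have -> : k%:R * t = k.+1%:R * t - t by rewrite -[k.+1%:R]natr1; ring.
by rewrite cosB cosD; ring.
Qed.

Lemma chebsum_cos n r s t :
  chebsum n r (cos s) (cos t) = cosseries n r (s + t) + cosseries n r (s - t).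
Proof.
rewrite /chebsum /cosseries -big_split; apply: eq_bigr => k _.
by rewrite [RHS]/= !chebT_cos -mulrDr [_ * (s + t)]mulrDr [_ * (s - t)]mulrBr cosM2; ring.
Qed.

Lemma cos_param a : -1 <= a <= 1 -> exists2 t : R, 0 <= t <= pi & a = cos t.
Proof.
move=> a1; exists (acos a); first by rewrite acos_ge0// acos_lepi.
by rewrite acosK// in_itv.
Qed.

(** The regularised kernel [cheblog r] is, up to a geometrically small error, a finite
    combination with positive coefficients of products [chebT k a * chebT k b]: the
    source of the positivity of the energy. *)
Lemma cheblog_chebsum n r a b : 0 <= r < 1 -> -1 <= a <= 1 -> -1 <= b <= 1 ->
  `|cheblog r a b - chebsum n r a b| <= 4 * r ^+ n.+1 / (1 - r) ^+ 2.
Proof.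
move=> r01 /cos_param[s s0 ->] /cos_param[t t0 ->].
rewrite cheblog_cos// chebsum_cos opprD addrACA.
apply: (le_trans (ler_normD _ _)).
have := logcirc_cosseries n (s + t) r01; have := logcirc_cosseries n (s - t) r01.
lra.
Qed.

Lemma chebq_ge r a b : 0 <= r < 1 -> -1 <= a <= 1 -> -1 <= b <= 1 ->
  (1 - r) ^+ 4 + 4 * r ^+ 2 * (a - b) ^+ 2 <= chebq r a b.
Proof.
move=> /andP[r0 r1] /andP[a1 a2] /andP[b1 b2].
have ab : 0 <= 1 - a * b by nra.
have : 0 <= 4 * (r * (1 - r) ^+ 2 * (1 - a * b)).
  by rewrite !mulr_ge0// subr_ge0 ltW.
rewrite /chebq => h; rewrite -subr_ge0; apply: (le_trans h).
by rewrite le_eqVlt; apply/orP; left; apply/eqP; ring.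
Qed.

Lemma chebq_gt0 r a b : 0 <= r < 1 -> -1 <= a <= 1 -> -1 <= b <= 1 -> 0 < chebq r a b.
Proof.
move=> r01 a1 b1; apply: lt_le_trans (chebq_ge r01 a1 b1).
have /andP[r0 r1] := r01.
apply: ltr_wpDr; last by rewrite exprn_gt0// subr_gt0.
by rewrite mulr_ge0 ?sqr_ge0// mulr_ge0// exprn_ge0.
Qed.

Lemma cheblog_ge r a b : 0 <= r < 1 -> -1 <= a <= 1 -> -1 <= b <= 1 ->
  - ln 4 <= cheblog r a b.
Proof.
move=> r01 a1 b1; have q0 := chebq_gt0 r01 a1 b1.
have q16 : chebq r a b <= 4 ^+ 2.
  have /andP[r0 r1] := r01.
  move: a1 b1 {q0} => /cos_param[s s0 ->] /cos_param[t t0 ->]; rewrite chebq_cos expr2.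
  by rewrite ler_pM ?circ_le4 ?r0 ?ltW ?circ_gt0.
have : ln (chebq r a b) <= ln (4 ^+ 2) by rewrite ler_ln ?posrE.
by rewrite lnXn// mulr2n /cheblog; lra.
Qed.

(** At [r = 1] the kernel is [- ln (2 * |a - b|)]; below [1] it exceeds this
    by at most [- ln r], which dominates the passage to the limit. *)
Lemma cheblog_le r a b : 0 < r < 1 -> -1 <= a <= 1 -> -1 <= b <= 1 -> a != b ->
  cheblog r a b <= - ln (2 * `|a - b|) - ln r.
Proof.
move=> /andP[r0 r1] a1 b1 ab; have r01 : 0 <= r < 1 by rewrite ltW.
have p0 : 0 < `|a - b| by rewrite normr_gt0 subr_eq0.
have h : (2 * `|a - b| * r) ^+ 2 <= chebq r a b.
  apply: le_trans (chebq_ge r01 a1 b1); rewrite !exprMn real_normK ?num_real//.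
  have : 0 <= (1 - r) ^+ 4 by rewrite exprn_ge0// subr_ge0 ltW.
  lra.
have : ln ((2 * `|a - b| * r) ^+ 2) <= ln (chebq r a b).
  by rewrite ler_ln ?posrE ?chebq_gt0// exprn_gt0// !mulr_gt0.
rewrite lnXn ?mulr_gt0// [X in X *+ 2]lnM ?posrE ?mulr_gt0// mulr2n /cheblog.
lra.
Qed.

(** Abel summation: the kernels are studied at [r < 1], along a sequence tending to [1]. *)
Definition abelr n : R := n.+1%:R / n.+2%:R.

Lemma abelr01 n : 0 < abelr n < 1.
Proof.
by rewrite /abelr divr_gt0//= ltr_pdivrMr// mul1r ltr_nat.
Qed.

Lemma abelr_cvg : abelr n @[n --> \oo] --> (1 : R).
Proof.
have -> : abelr = (fun n => 1 - harmonic n.+1).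
  apply/funext => n; rewrite /abelr /harmonic/=; rewrite -[n.+2%:R]natr1.
  have c0 : (n.+1%:R : R) + 1 != 0 by rewrite natr1 pnatr_eq0.
  by move: (n.+1%:R : R) c0 => c c0; field.
rewrite -[X in _ --> X]subr0; apply: cvgB; first exact: cvg_cst.
by rewrite (cvg_shiftS (@harmonic R)); exact: cvg_harmonic.
Qed.

Lemma cheblog_cvg a b : -1 <= a <= 1 -> -1 <= b <= 1 -> a != b ->
  cheblog (abelr n) a b @[n --> \oo] --> - ln (2 * `|a - b|).
Proof.
move=> a1 b1 ab.
have p0 : 0 < `|a - b| by rewrite normr_gt0 subr_eq0.
have -> : - ln (2 * `|a - b|) = cheblog 1 a b.
  rewrite /cheblog /chebq subrr.
  have -> : (1 - 1 ^+ 2) ^+ 2 + 4 * 1 ^+ 2 * (a - b) ^+ 2 - 4 * 1 * 0 ^+ 2 * (a * b) =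
    (2 * `|a - b|) ^+ 2.
    by rewrite exprMn real_normK ?num_real//; ring.
  by rewrite lnXn ?mulr_gt0// -[ln _ *+ 2]mulr_natr; field.
have cq : chebq (abelr n) a b @[n --> \oo] --> chebq 1 a b.
  have cont : {for 1, continuous (fun r => chebq r a b)}.
    rewrite /chebq.
    have : derivable (fun r : R => (1 - r ^+ 2) ^+ 2 + 4 * r ^+ 2 * (a - b) ^+ 2 - 4 * r * (1 - r) ^+ 2 * (a * b)) 1 1 by apply: ex_derive.
    by move=> /derivable1_diffP/differentiable_continuous.
  exact: (cvg_comp _ _ abelr_cvg cont).
apply: cvgM; first exact: cvg_cst.
apply: (cvg_comp _ _ cq); apply: continuous_ln.
rewrite /chebq subrr.
have : 0 < (a - b) ^+ 2 by rewrite exprn_even_gt0//= subr_eq0.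
by rewrite expr1n expr0n/=; lra.
Qed.

End log_kernel.

(** * Bounded measurable functions on a probability space *)

Section bounded_integrals.
Context d (T : measurableType d) (R : realType) (P : probability T R).
Implicit Types f g : T -> R.

Definition bmeas f := measurable_fun setT f /\ exists M, forall x, `|f x| <= M.

Lemma bmeas_integrable f : bmeas f -> P.-integrable setT (EFin \o f).
Proof.
move=> [mf [M fM]]; apply: measurable_bounded_integrable => //.
  by rewrite [ltLHS](probability_setT P) ltry.
by exists M; split; [exact: num_real|move=> y My x _; rewrite /= (le_trans (fM x)) ?ltW].
Qed.

Lemma bmeas_cst (c : R) : bmeas (fun=> c).
Proof. by split; [exact: measurable_cst|exists `|c|]. Qed.

Lemma bmeasD f g : bmeas f -> bmeas g -> bmeas (fun x => f x + g x).
Proof.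
move=> [mf [M fM]] [mg [N gN]]; split; first exact: measurable_funD.
by exists (M + N) => x; apply: (le_trans (ler_normD _ _)); exact: lerD.
Qed.

Lemma bmeasN f : bmeas f -> bmeas (fun x => - f x).
Proof.
move=> [mf [M fM]]; split; first exact: measurableT_comp.
by exists M => x; rewrite normrN.
Qed.

Lemma bmeasB f g : bmeas f -> bmeas g -> bmeas (fun x => f x - g x).
Proof. by move=> ? /bmeasN; exact: bmeasD. Qed.

Lemma bmeasM f g : bmeas f -> bmeas g -> bmeas (fun x => f x * g x).
Proof.
move=> [mf [M fM]] [mg [N gN]]; split; first exact: measurable_funM.
by exists (M * N) => x; rewrite normrM ler_pM.
Qed.

Lemma bmeasZ (c : R) f : bmeas f -> bmeas (fun x => c * f x).
Proof. by move=> bf; exact: (bmeasM (bmeas_cst c)). Qed.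

Lemma bmeas_sum n (f : nat -> T -> R) : (forall k, bmeas (f k)) ->
  bmeas (fun x => \sum_(k < n) f k x).
Proof.
move=> bf; elim: n => [|n IH].
  have -> : (fun x => \sum_(k < 0) f k x) = (fun=> 0 : R).
    by apply/funext => x; rewrite big_ord0.
  exact: bmeas_cst.
have -> : (fun x => \sum_(k < n.+1) f k x) = (fun x => \sum_(k < n) f k x + f n x).
  by apply/funext => x; rewrite big_ord_recr.
exact: bmeasD.
Qed.

Lemma RintegralT_cst (c : R) : \int[P]_x c = c.
Proof. by rewrite Rintegral_cst// [X in fine X](probability_setT P) mulr1. Qed.

Lemma Rintegral_sumord n (f : nat -> T -> R) : (forall k, bmeas (f k)) ->
  \int[P]_x (\sum_(k < n) f k x) = \sum_(k < n) \int[P]_x f k x.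
Proof.
move=> bf; elim: n => [|n IH].
  by under eq_Rintegral do rewrite big_ord0; rewrite RintegralT_cst big_ord0.
under eq_Rintegral do rewrite big_ord_recr/=.
rewrite big_ord_recr/= -IH RintegralD//; apply: bmeas_integrable => //.
exact: bmeas_sum.
Qed.

Lemma Rintegral_dist f g (e : R) : bmeas f -> bmeas g ->
  (forall x, `|f x - g x| <= e) -> `|\int[P]_x f x - \int[P]_x g x| <= e.
Proof.
move=> bf bg fge; rewrite -RintegralB//; [|exact: bmeas_integrable..].
apply: (le_trans (le_normr_Rintegral _ _)) => //.
  by have := bmeas_integrable (bmeasB bf bg).
rewrite -[leRHS]RintegralT_cst; apply: le_Rintegral => //.
- have [m [M h]] := bmeasB bf bg; have : bmeas (fun x => `|f x - g x|).
    by split; [exact: measurableT_comp|exists M => x; rewrite normr_id].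
  exact: bmeas_integrable.
- exact: bmeas_integrable (bmeas_cst e).
Qed.

Lemma Rintegral_EFin f : bmeas f -> (\int[P]_x (f x)%:E)%E = (\int[P]_x f x)%:E.
Proof.
by move=> bf; rewrite /Rintegral fineK//; apply: integrable_fin_num => //; exact: bmeas_integrable.
Qed.
End bounded_integrals.

(** * The logarithmic potential of arcsine laws *)

Definition halfcircle (R : realType) : probability (measurableTypeR R) R :=
  uniform_prob (@pi_gt0 R).

Lemma integral_halfcircle (R : realType) (f : R -> \bar R) :
  measurable_fun setT f -> (forall x, 0 <= f x)%E ->
  (\int[halfcircle R]_x f x = pi^-1%:E * \int[@lebesgue_measure R]_(x in `[0%R, pi]) f x)%E.
Proof. by move=> mf f0; rewrite integral_uniform// subr0. Qed.

Section uniform_on_half_circle.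
Context {R : realType}.
Local Notation mu := (@lebesgue_measure R).
Local Notation U := (halfcircle R).
Implicit Types (r a b s t : R) (n k : nat).

Lemma measurable_cos : measurable_fun setT (@cos R).
Proof. by apply: continuous_measurable_fun; exact: continuous_cos. Qed.

Lemma measurable_lncomp d (T : measurableType d) (f : T -> R) :
  measurable_fun setT f -> measurable_fun setT (fun x => ln (f x)).
Proof. by move=> mf; apply: measurableT_comp => //; exact: measurable_ln. Qed.

Lemma cos_itv t : -1 <= cos t <= 1.
Proof. by rewrite cos_geN1 cos_le1. Qed.

Lemma measurable_cheblog d (T : measurableType d) (f g : T -> R) r :
  measurable_fun setT f -> measurable_fun setT g ->
  measurable_fun setT (fun x => cheblog r (f x) (g x)).
Proof.
move=> mf mg; rewrite /cheblog /chebq.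
apply: measurable_funM => //; apply: measurable_lncomp.
apply: measurable_funB; last by apply: measurable_funM => //; exact: measurable_funM.
apply: measurable_funD => //; apply: measurable_funM => //.
by apply: measurable_funX; exact: measurable_funB.
Qed.

Lemma cheblog_le_bound r a b : 0 <= r < 1 -> -1 <= a <= 1 -> -1 <= b <= 1 ->
  cheblog r a b <= - (1 / 2) * ln ((1 - r) ^+ 4).
Proof.
move=> r01 a1 b1; have h := chebq_ge r01 a1 b1; have /andP[r0 r1] := r01.
have p : 0 < (1 - r) ^+ 4 by rewrite exprn_gt0// subr_gt0.
have : ln ((1 - r) ^+ 4) <= ln (chebq r a b).
  rewrite ler_ln ?posrE ?chebq_gt0//; apply: le_trans h; rewrite lerDl.
  by rewrite mulr_ge0 ?sqr_ge0// mulr_ge0// exprn_ge0.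
by rewrite /cheblog; lra.
Qed.

Lemma bmeas_cheblog d (T : measurableType d) (f g : T -> R) r : 0 <= r < 1 ->
  measurable_fun setT f -> measurable_fun setT g ->
  (forall x, -1 <= f x <= 1) -> (forall x, -1 <= g x <= 1) ->
  bmeas (fun x => cheblog r (f x) (g x)).
Proof.
move=> r01 mf mg f1 g1; split; first exact: measurable_cheblog.
exists (ln 4 + `|(1 / 2) * ln ((1 - r) ^+ 4)|) => x.
have h1 := cheblog_ge r01 (f1 x) (g1 x); have h2 := cheblog_le_bound r01 (f1 x) (g1 x).
have l4 : 0 <= ln (4 : R) by rewrite ln_ge0// ler1n.
have h3 := ler_norm (- ((1 / 2) * ln ((1 - r) ^+ 4))); rewrite normrN in h3.
have h4 := normr_ge0 ((1 / 2) * ln ((1 - r) ^+ 4)).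
rewrite ler_norml; apply/andP; split; lra.
Qed.

Lemma continuous_chebT k : continuous (chebT k : R -> R).
Proof.
suff : continuous (chebT k : R -> R) /\ continuous (chebT k.+1 : R -> R) by case.
elim: k => [|k [IH1 IH2]]; first by split => x; [exact: cvg_cst|exact: cvg_id].
split => // x.
have -> : chebT k.+2 = (fun a => 2 * a) * (chebT k.+1 : R -> R) - (chebT k : R -> R) by [].
apply: cvgB; last exact: IH1.
by apply: cvgM; [exact: mulrl_continuous|exact: IH2].
Qed.

Lemma measurable_chebT d (T : measurableType d) (f : T -> R) k :
  measurable_fun setT f -> measurable_fun setT (fun x => chebT k (f x)).
Proof.
move=> mf; apply: measurableT_comp => //.
by apply: continuous_measurable_fun; exact: continuous_chebT.
Qed.

Lemma chebT_le1 k a : -1 <= a <= 1 -> `|chebT k a| <= 1.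
Proof. by move=> /cos_param[t _ ->]; rewrite chebT_cos cos_max. Qed.

Lemma bmeas_chebT d (T : measurableType d) (f : T -> R) k : measurable_fun setT f ->
  (forall x, -1 <= f x <= 1) -> bmeas (fun x => chebT k (f x)).
Proof.
move=> mf f1; split; first exact: measurable_chebT.
by exists 1 => x; exact: chebT_le1.
Qed.

(** The fundamental theorem of calculus is applied to the nonnegative [1 + cos], for which
    the integral over the probability space unfolds to a Lebesgue integral. *)
Lemma Rintegral_cosk k : \int[U]_t cos (k.+1%:R * t) = 0.
Proof.
have k0 : (k.+1%:R : R) != 0 by rewrite pnatr_eq0.
have mc : measurable_fun setT (fun t : R => cos (k.+1%:R * t)).
  by apply: measurableT_comp; [exact: measurable_cos|exact: measurable_funM].
have bc : bmeas (fun t : measurableTypeR R => cos (k.+1%:R * t)).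
  by split => //; exists 1 => t; exact: cos_max.
have E : (\int[U]_t (1 + cos (k.+1%:R * t))%:E = 1)%E.
  rewrite integral_halfcircle; last 2 first.
  - by apply/measurable_EFinP; exact: measurable_funD.
  - by move=> t; rewrite lee_fin; have := cos_geN1 (k.+1%:R * t); lra.
  pose F t : R := t + (k.+1%:R)^-1 * sin (k.+1%:R * t).
  have dF (t : R) : is_derive t 1 F (1 + cos (k.+1%:R * t)).
    have dl : is_derive t (1:R) ( *%R (k.+1%:R : R)) (k.+1%:R).
      by apply: is_derive_eq; rewrite /GRing.scale/= mulr1.
    have dsin : is_derive t (1:R) (@sin R \o ( *%R (k.+1%:R : R))) (cos (k.+1%:R * t) * k.+1%:R).
      exact: is_derive1_comp.
    have -> : F = id + (k.+1%:R)^-1 *: (@sin R \o ( *%R (k.+1%:R : R))) by [].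
    have ds := is_deriveD (is_derive_id t (1:R)) (is_deriveZ (k.+1%:R : R)^-1 dsin).
    by apply: is_derive_eq ds _; rewrite /GRing.scale/= mulrC mulfK.
  have dvF (u : R) : derivable F u (1 : R) by have [] := dF u.
  have cF : continuous F.
    by move=> t; exact/differentiable_continuous/derivable1_diffP.
  rewrite (@continuous_FTC2 _ _ F) ?pi_gt0//.
  - rewrite /F mulr0 sin0 mulr0 addr0.
    have -> : sin (k.+1%:R * pi) = 0 :> R.
      elim: (k.+1) => [|m IH]; first by rewrite mul0r sin0.
      by rewrite -natr1 mulrDl mul1r sinDpi IH oppr0.
    by rewrite mulr0 addr0 sube0 -EFinM mulVf// gt_eqF// pi_gt0.
  - apply: continuous_subspaceT => t; apply: cvgD; first exact: cvg_cst.
    apply: (continuous_comp (f := *%R (k.+1%:R : R))); last exact: continuous_cos.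
    exact: mulrl_continuous.
  - split => //.
      by apply: cvg_at_right_filter; exact: cF.
    by apply: cvg_at_left_filter; exact: cF.
  - by move=> t _; rewrite derive1E; have [_ ->] := dF t.
have b1 := @bmeas_cst _ (measurableTypeR R) R 1.
move: E; rewrite Rintegral_EFin; last exact: bmeasD.
rewrite RintegralD//; [|exact: bmeas_integrable..].
by rewrite RintegralT_cst => -[]; lra.
Qed.

Lemma le_geom0 (x C r : R) : 0 <= r < 1 -> (forall n, x <= C * r ^+ n) -> x <= 0.
Proof.
move=> /andP[r0 r1] h.
have cv : C * r ^+ n @[n --> \oo] --> (0 : R).
  rewrite -[X in _ --> X](mulr0 C); apply: cvgM; first exact: cvg_cst.
  by apply: cvg_expr; rewrite ger0_norm.
by apply: (cvgr_to_ge cv); apply: nearW.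
Qed.

Lemma Rintegral_chebsum n r a : \int[U]_t chebsum n r a (cos t) = 0.
Proof.
rewrite /chebsum (@Rintegral_sumord _ _ _ U n (fun k t =>
  (2 * r ^+ k.+1 / k.+1%:R) * (chebT k.+1 a * chebT k.+1 (cos t)))).
  apply: big1 => k _.
  under eq_Rintegral => t _ do rewrite mulrA chebT_cos.
  rewrite RintegralZl// ?Rintegral_cosk ?mulr0//.
  apply: bmeas_integrable; split.
    by apply: measurableT_comp; [exact: measurable_cos|exact: measurable_funM].
  by exists 1 => t; exact: cos_max.
move=> k; apply: bmeasZ; apply: bmeasZ; apply: bmeas_chebT; first exact: measurable_cos.
by move=> t; exact: cos_itv.
Qed.

(** All terms of the Chebyshev expansion have degree at least [1], hence mean zero
    under the arcsine law. *)
Lemma Rintegral_cheblog r a : 0 <= r < 1 -> -1 <= a <= 1 ->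
  \int[U]_t cheblog r a (cos t) = 0.
Proof.
move=> r01 a1.
apply/eqP; rewrite -normr_eq0 eq_le normr_ge0 andbT.
apply: (@le_geom0 _ (4 * r / (1 - r) ^+ 2) r) => // n.
rewrite -[X in `|X|]subr0 -(Rintegral_chebsum n r a).
apply: Rintegral_dist.
- by apply: bmeas_cheblog => // [|t]; [exact: measurable_cos|exact: cos_itv].
- apply: (@bmeas_sum _ _ _ n (fun k t => (2 * r ^+ k.+1 / k.+1%:R) * (chebT k.+1 a * chebT k.+1 (cos t)))) => k.
  apply: bmeasZ; apply: bmeasZ; apply: bmeas_chebT.
    exact: measurable_cos.
  by move=> t; exact: cos_itv.
- move=> t; apply: (le_trans (cheblog_chebsum n r01 a1 (cos_itv t))).
  by rewrite exprS le_eqVlt; apply/orP; left; apply/eqP; ring.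
Qed.

(** The logarithmic kernel on the half circle, raised by [ln 4] to be nonnegative. *)
Definition coslog (a t : R) : R := ln 4 - ln (2 * `|a - cos t|).

Lemma coslog_ge0 a t : -1 <= a <= 1 -> 0 <= coslog a t.
Proof.
move=> /andP[a1 a2]; rewrite /coslog subr_ge0.
have /andP[c1 c2] := cos_itv t.
have [/eqP->|ne] := boolP (a == cos t).
  by rewrite subrr normr0 mulr0 ln0// ln_ge0// ler1n.
have p0 : 0 < `|a - cos t| by rewrite normr_gt0 subr_eq0.
rewrite ler_ln ?posrE ?mulr_gt0//.
have : `|a - cos t| <= 2 by rewrite ler_norml; apply/andP; split; lra.
lra.
Qed.

Lemma measurable_coslog a : measurable_fun setT (coslog a).
Proof.
apply: measurable_funB => //; apply: measurable_lncomp.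
apply: measurable_funM => //; apply: measurableT_comp => //.
by apply: measurable_funB => //; exact: measurable_cos.
Qed.

Lemma abelr01W n : 0 <= (abelr n : R) < 1.
Proof. by have /andP[/ltW -> ->] := @abelr01 R n. Qed.

Lemma limn_einf_ge (u : (\bar R)^nat) (l : \bar R) :
  (forall n, l <= u n)%E -> (l <= limn_einf u)%E.
Proof.
move=> lu; rewrite limn_einf_lim; apply: lime_ge; first exact: is_cvg_einfs.
by apply: nearW => m; apply: le_ereal_inf_tmp => _ [k _ <-]; exact: lu.
Qed.

Lemma cheblog_diag_ge0 r a : 0 <= r < 1 -> -1 <= a <= 1 -> 0 <= cheblog r a a.
Proof.
move=> r01 a1; have q0 := chebq_gt0 r01 a1 a1; have /andP[r0 r1] := r01.
have q1 : chebq r a a <= 1.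
  rewrite /chebq subrr expr0n/= mulr0 addr0.
  have h1 : (1 - r ^+ 2) ^+ 2 <= 1.
    have : r ^+ 2 <= 1 by rewrite expr_le1// ltW.
    have : 0 <= r ^+ 2 by rewrite exprn_ge0.
    by move=> u v; rewrite expr_le1//; lra.
  have : 0 <= 4 * r * (1 - r) ^+ 2 * (a * a).
    rewrite mulr_ge0//; last by rewrite -expr2 sqr_ge0.
    by rewrite mulr_ge0 ?sqr_ge0// mulr_ge0.
  lra.
by rewrite /cheblog; have := ln_le0 q1; lra.
Qed.

(** Logarithmic potential of the arcsine law on its own support. Letting [r] tend to [1]
    in [Rintegral_cheblog], Fatou's lemma gives the upper bound, and the comparison
    [cheblog_le] the lower bound. *)
Lemma integral_coslog a : -1 <= a <= 1 ->
  (\int[U]_t (coslog a t)%:E = (ln 4)%:E)%E.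
Proof.
move=> a1.
pose g n (t : R) := ln 4 + cheblog (abelr n) a (cos t).
have bc n : @bmeas _ (measurableTypeR R) R (fun t => cheblog (abelr n) a (cos t)).
  by apply: bmeas_cheblog => // [||t]; [exact: abelr01W|exact: measurable_cos|exact: cos_itv].
have bg n : @bmeas _ (measurableTypeR R) R (g n) by apply: bmeasD => //; exact: bmeas_cst.
have g0 n t : 0 <= g n t.
  by have := cheblog_ge (abelr01W n) a1 (cos_itv t); rewrite /g; lra.
have gI n : (\int[U]_t (g n t)%:E = (ln 4)%:E)%E.
  rewrite Rintegral_EFin// RintegralD//; last 2 first.
  - by apply: bmeas_integrable; exact: bmeas_cst.
  - by apply: bmeas_integrable; exact: bc.
  by rewrite RintegralT_cst Rintegral_cheblog ?addr0// abelr01W.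
have mq : measurable_fun setT (EFin \o coslog a).
  by apply/measurable_EFinP; exact: measurable_coslog.
have mg n : measurable_fun setT (EFin \o g n).
  by apply/measurable_EFinP; case: (bg n).
apply/eqP; rewrite eq_le; apply/andP; split.
- have := @fatou _ _ _ U setT measurableT (fun n t => (g n t)%:E).
  have -> : limn_einf (fun n => \int[U]_x (g n x)%:E)%E = (ln 4)%:E.
    under eq_fun do rewrite gI.
    rewrite is_cvg_limn_einfE; last by apply/cvg_ex; exists (ln 4)%:E; exact: cvg_cst.
    by apply: cvg_lim => //; exact: cvg_cst.
  move=> H; apply: le_trans (H _ _) => //; last by move=> n t _; rewrite lee_fin.
  apply: ge0_le_integral => //.
  + by move=> t _; rewrite lee_fin coslog_ge0.
  + apply: measurableT_comp => //; apply: measurable_fun_limn_esup => n.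
    by apply: measurableT_comp => //; exact: mg.
  (* On the diagonal [coslog] has the value [ln 4], because [ln 0 = 0]. *)
  move=> t _; have [/eqP ac|ne] := boolP (a == cos t).
    have -> : coslog a t = ln 4 by rewrite /coslog -ac subrr normr0 mulr0 [ln 0]ln0// subr0.
    apply: limn_einf_ge => n; rewrite lee_fin /g -ac lerDl.
    by apply: cheblog_diag_ge0 => //; exact: abelr01W.
  have cv : (g n t)%:E @[n --> \oo] --> (coslog a t)%:E.
    apply: cvg_EFin; first exact: nearW.
    by apply: cvgD; [exact: cvg_cst|apply: cheblog_cvg => //; exact: cos_itv].
  by rewrite is_cvg_limn_einfE ?(cvg_lim _ cv)//; apply/cvg_ex; exists (coslog a t)%:E.
- have [p p0 ap] := cos_param a1.
  have step n : ((ln 4 + ln (abelr n))%:E <= \int[U]_t (coslog a t)%:E)%E.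
    have lr0 : 0 <= - ln (abelr n) :> R.
      by rewrite oppr_ge0 ln_le0// ltW//; have /andP[_ ->] := @abelr01 R n.
    have : (\int[U]_t (g n t)%:E <= \int[U]_t ((coslog a t)%:E + (- ln (abelr n))%:E))%E.
      have mqr : measurable_fun setT (fun t => (coslog a t)%:E + (- ln (abelr n))%:E)%E.
        apply/measurable_EFinP/measurable_funD => //; exact: measurable_coslog.
      rewrite (@integral_halfcircle _ (EFin \o g n))//; last by move=> t; rewrite lee_fin.
      rewrite (integral_halfcircle mqr); last first.
        by move=> t; rewrite -EFinD lee_fin addr_ge0// coslog_ge0.
      rewrite lee_pmul2l//; last by rewrite lte_fin invr_gt0 pi_gt0.
      apply: ae_ge0_le_integral => //.
      - by move=> t _; rewrite lee_fin.
      - by apply: measurable_funTS; exact: mg.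
      - by move=> t _; rewrite -EFinD lee_fin addr_ge0// coslog_ge0.
      - by apply: measurable_funTS; exact: mqr.
      exists [set p]; split => //; first exact: lebesgue_measure_set1.
      move=> t /= /not_implyP[]; rewrite in_itv/= => t0.
      apply: contra_notP => /eqP tp; rewrite -EFinD lee_fin /g /coslog.
      have ne : a != cos t.
        by apply: contra tp => /eqP; rewrite ap => /cos_inj -> //; rewrite in_itv.
      by have := cheblog_le (@abelr01 R n) a1 (cos_itv t) ne; lra.
    rewrite gI ge0_integralD//; [|by move=> t _; rewrite lee_fin ?coslog_ge0..].
    rewrite integral_cst// [X in (_ + _ * X)%E](probability_setT U) mule1.
    by rewrite -leeBlDr// -EFinB opprK.
  have cv : (ln 4 + ln (abelr n))%:E @[n --> \oo] --> (ln 4 : R)%:E.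
    apply: cvg_EFin; first exact: nearW.
    rewrite -[X in _ --> X]addr0 -ln1; apply: cvgD; first exact: cvg_cst.
    by apply: (cvg_comp _ _ abelr_cvg); exact: continuous_ln.
  by rewrite -(cvg_lim _ cv)//; apply: lime_le; [apply/cvg_ex; exists (ln 4)%:E|exact: nearW].
Qed.

(** The logarithmic potential at [x] of the arcsine law of radius [rho]. *)
Definition arcpot (rho x : R) : \bar R := (\int[U]_t (- ln `|x - rho * cos t|)%:E)%E.

Lemma nln_ge0 (u : R) : u <= 1 -> 0 <= - ln u.
Proof. by move=> u1; rewrite oppr_ge0 ln_le0. Qed.

Lemma dist_cos_le1 (rho x t : R) : 0 <= rho <= 1 / 2 -> `|x| <= 1 / 2 ->
  `|x - rho * cos t| <= 1.
Proof.
move=> /andP[r0 r1]; rewrite !ler_norml => /andP[x1 x2].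
have /andP[c1 c2] := cos_itv t.
have h1 : rho * cos t <= 1 / 2 by nra.
have h2 : - (1 / 2) <= rho * cos t by nra.
by apply/andP; split; lra.
Qed.

Lemma measurable_dist_cos (rho x : R) :
  measurable_fun setT (fun t => (- ln `|x - rho * cos t|)%:E).
Proof.
apply/measurable_EFinP; apply: measurableT_comp => //; apply: measurable_lncomp.
apply: measurableT_comp => //; apply: measurable_funB => //.
by apply: measurable_funM => //; exact: measurable_cos.
Qed.

Lemma halfcircle_ae_le (f g : R -> \bar R) (p : R) :
  measurable_fun setT f -> measurable_fun setT g ->
  (forall t, 0 <= f t)%E -> (forall t, 0 <= g t)%E ->
  (forall t : R, 0 <= t <= pi -> t != p -> (f t <= g t)%E) ->
  (\int[U]_t f t <= \int[U]_t g t)%E.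
Proof.
move=> mf mg f0 g0 fg; rewrite !integral_halfcircle//.
rewrite lee_pmul2l//; last by rewrite lte_fin invr_gt0 pi_gt0.
apply: ae_ge0_le_integral => //.
- by apply: measurable_funTS; exact: mf.
- by apply: measurable_funTS; exact: mg.
exists [set p]; split => //; first exact: lebesgue_measure_set1.
move=> t /= /not_implyP[]; rewrite in_itv/= => t0.
by apply: contra_notP => /eqP tp; exact: fg.
Qed.

Lemma arcpot_in (rho x : R) : 0 < rho <= 1 / 2 -> `|x| <= rho ->
  arcpot rho x = (ln 2 - ln rho)%:E.
Proof.
move=> /andP[r0 r1] xr.
have a1 : -1 <= x / rho <= 1 by rewrite -ler_norml normrM normfV (gtr0_norm r0) ler_pdivrMr// mul1r.
have [p p0 ap] := cos_param a1.
have xE : x = rho * cos p by rewrite -ap mulrCA divff ?mulr1// gt_eqF.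
have cst0 : 0 <= - ln (2 * rho).
  by apply: nln_ge0; lra.
have x12 : `|x| <= 1 / 2 by exact: le_trans r1.
have mc : measurable_fun setT (fun t => (coslog (x / rho) t + - ln (2 * rho))%:E).
  by apply/measurable_EFinP/measurable_funD => //; exact: measurable_coslog.
have fE t : 0 <= t <= pi -> t != p ->
    (- ln `|x - rho * cos t|)%:E = (coslog (x / rho) t + - ln (2 * rho))%:E.
  move=> t0 tp; congr EFin.
  have ne : 0 < `|cos p - cos t|.
    rewrite normr_gt0 subr_eq0; apply: contra tp => /eqP /cos_inj -> //;
    by rewrite in_itv.
  rewrite xE -mulrBr normrM (gtr0_norm r0) /coslog [rho * _]mulrC mulfK ?gt_eqF//.
  rewrite !lnM ?posrE//.
  have -> : (4 : R) = 2 * 2 by ring.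
  by rewrite lnM ?posrE//; ring.
have E : arcpot rho x = (\int[U]_t (coslog (x / rho) t + - ln (2 * rho))%:E)%E.
  apply/eqP; rewrite eq_le; apply/andP; split; apply: (@halfcircle_ae_le _ _ p) => //.
  - exact: measurable_dist_cos.
  - by move=> t; rewrite lee_fin nln_ge0// dist_cos_le1// (ltW r0).
  - by move=> t; rewrite lee_fin addr_ge0// coslog_ge0.
  - by move=> t t0 tp; rewrite fE.
  - exact: measurable_dist_cos.
  - by move=> t; rewrite lee_fin addr_ge0// coslog_ge0.
  - by move=> t; rewrite lee_fin nln_ge0// dist_cos_le1// (ltW r0).
  - by move=> t t0 tp; rewrite fE.
have mq : measurable_fun setT (EFin \o coslog (x / rho)).
  by apply/measurable_EFinP; exact: measurable_coslog.
rewrite E; under eq_integral do rewrite EFinD.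
rewrite ge0_integralD//; [|by move=> t _; rewrite lee_fin ?coslog_ge0..].
rewrite integral_coslog// integral_cst// [X in (_ + _ * X)%E](probability_setT U) mule1.
rewrite -EFinD; congr EFin.
have -> : (4 : R) = 2 * 2 by ring.
by rewrite !lnM ?posrE//; ring.
Qed.

(** Outside the support the potential is at most its value at the nearest end point,
    since moving [x] to that end point brings it closer to every point of the support. *)
Lemma arcpot_le (rho x : R) : 0 < rho <= 1 / 2 -> `|x| <= 1 / 2 ->
  (arcpot rho x <= (ln 2 - ln rho)%:E)%E.
Proof.
move=> rh x12; have /andP[r0 r1] := rh.
have [xr|rx] := leP `|x| rho; first by rewrite arcpot_in.
(* [s] is the end point of the support nearest to [x], attained at the angle [p]. *)
have [s [p [s1 sE h]]] : exists s p : R, [/\ `|s| = rho, s = rho * cos p &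
    forall t, 0 <= t <= pi -> t != p ->
      0 < `|s - rho * cos t| <= `|x - rho * cos t| ].
  have [x0|x0] := leP 0 x.
    rewrite ger0_norm// in rx.
    exists rho, 0; split; [exact: gtr0_norm|by rewrite cos0 mulr1|move=> t t0 tp].
    have ct : cos t < 1.
      rewrite lt_neqAle cos_le1 andbT; apply: contra tp => /eqP; rewrite -cos0.
      by move=> /cos_inj -> //; rewrite in_itv/= ?lexx ?pi_ge0.
    have h : rho * cos t < rho by rewrite gtr_pMr.
    by rewrite !gtr0_norm ?subr_gt0 ?h//=; [rewrite lerD2r ltW|lra].
  rewrite ltr0_norm// in rx.
  exists (- rho), pi; split; [by rewrite normrN gtr0_norm|by rewrite cospi mulrN1|move=> t t0 tp].
  have ct : -1 < cos t.
    rewrite lt_neqAle cos_geN1 andbT eq_sym; apply: contra tp => /eqP; rewrite -cospi.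
    by move=> /cos_inj -> //; rewrite in_itv/= ?lexx ?pi_ge0.
  have h : - rho < rho * cos t by nra.
  rewrite (@ltr0_norm _ (- rho - _)) ?subr_lt0// (@ltr0_norm _ (x - _)); last by lra.
  by apply/andP; split; lra.
have <- : arcpot rho s = (ln 2 - ln rho)%:E by apply: arcpot_in => //; rewrite s1.
apply: (@halfcircle_ae_le _ _ p).
- exact: measurable_dist_cos.
- exact: measurable_dist_cos.
- by move=> t; rewrite lee_fin nln_ge0// dist_cos_le1// (ltW r0).
- by move=> t; rewrite lee_fin nln_ge0// dist_cos_le1 ?(ltW r0)// s1.
- move=> t t0 tp; have /andP[h1 h2] := h _ t0 tp.
  by rewrite lee_fin lerN2 ler_ln// posrE (lt_le_trans h1).
Qed.
End uniform_on_half_circle.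

(** * Logarithmic integrals on an interval *)

Section singular_ftc.
Context {R : realType}.
Local Notation mu := (@lebesgue_measure R).

(** Exhausting the open interval by compact ones removes the assumption that the
    integrand extends continuously to the end points. *)
Lemma ge0_FTC2_singular (f F : R -> R) (a b : R) : a < b ->
  F x @[x --> a^'+] --> F a -> F x @[x --> b^'-] --> F b ->
  (forall x : R, a < x < b -> [/\ {for x, continuous f}, is_derive x 1 F (f x) & 0 <= f x]) ->
  (\int[mu]_(x in `[a, b]) (f x)%:E = (F b - F a)%:E)%E.
Proof.
move=> ab Fa Fb fF; have ba : 0 < b - a by rewrite subr_gt0.
have mf : measurable_fun `]a, b[ f.
  apply: open_continuous_measurable_fun; first exact: interval_open.
  by move=> x /[!inE]/= /[!in_itv]/= /fF[].
pose e n : R := (b - a) / n.+3%:R.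
have e0 n : 0 < e n by rewrite divr_gt0.
have e2 n : 2 * e n < b - a.
  rewrite /e mulrA ltr_pdivrMr// mulrC ltr_pM2l//.
  by rewrite ltr_nat.
have ecv : e n @[n --> \oo] --> (0 : R).
  rewrite -[X in _ --> X](mulr0 (b - a)); apply: cvgM; first exact: cvg_cst.
  have h : harmonic n.+2 @[n --> \oo] --> (0 : R).
    rewrite (cvg_shiftS (fun n => @harmonic R n.+1)) (cvg_shiftS (@harmonic R)).
    exact: cvg_harmonic.
  exact: h.
pose I n := `[a + e n, b - e n]%classic.
have IE : \bigcup_n I n = `]a, b[%classic.
  apply/seteqP; split => [x [n _]|x] /=; rewrite !in_itv/=.
    by rewrite /I/= in_itv/= => /andP[h1 h2]; have := e0 n; move=> h; apply/andP; split; lra.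
  move=> /andP[ax xb].
  have : \forall n \near \oo, e n < Num.min (x - a) (b - x).
    by apply: (cvgr_lt _ ecv); rewrite lt_min !subr_gt0 ax.
  move=> [N _ /(_ N (leqnn N))]/=; rewrite lt_min => /andP[h1 h2].
  by exists N => //; rewrite /I/= in_itv/=; apply/andP; split; lra.
have ndI : nondecreasing_seq I.
  move=> m n mn; apply/subsetPset => x; rewrite /I/= !in_itv/= => /andP[h1 h2].
  have emn : e n <= e m.
    by rewrite /e ler_pM2l// lef_pV2 ?posrE// ler_nat.
  by apply/andP; split; lra.
have cF x : a < x < b -> {for x, continuous F}.
  move=> /fF[_ [dx _] _]; exact/differentiable_continuous/derivable1_diffP.
have IS' n : I n `<=` `]a, b[%classic.
  by move=> x xI; rewrite -IE; exists n.
have intI n : (\int[mu]_(x in I n) (f x)%:E = (F (b - e n) - F (a + e n))%:E)%E.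
  have IS x : a + e n <= x <= b - e n -> a < x < b.
    by move=> /andP[h1 h2]; have h := e0 n; apply/andP; split; lra.
  rewrite (@continuous_FTC2 _ f F) ?EFinB//.
  - by have := e2 n; lra.
  - apply: continuous_in_subspaceT => x /[!inE]/= /[!in_itv]/= /IS xab.
    by have [] := fF _ xab.
  - split.
    + move=> x; rewrite in_itv/= => /andP[h1 h2].
      have xab : a < x < b by apply: IS; rewrite !ltW.
      by have [_ [dx _] _] := fF _ xab.
    + apply: cvg_at_right_filter; apply: cF; apply: IS; rewrite lexx/=.
      by have := e2 n; lra.
    + apply: cvg_at_left_filter; apply: cF; apply: IS; rewrite lexx andbT.
      by have := e2 n; lra.
  - move=> x; rewrite in_itv/= => /andP[h1 h2]; rewrite derive1E.
    have xab : a < x < b by apply: IS; rewrite !ltW.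
    by have [_ [_ ->] _] := fF _ xab.
rewrite integral_itv_bndoo; last exact/measurable_EFinP.
rewrite -IE.
have := @ge0_nondecreasing_set_cvg_integral _ (measurableTypeR R) R I (EFin \o f) mu ndI.
have -> : (fun i => \int[mu]_(x in I i) (EFin \o f) x)%E = (fun n => (F (b - e n) - F (a + e n))%:E).
  by apply/funext => n; rewrite -intI.
move=> H; apply: (cvg_unique _ (H _ _ _)) => //.
- by move=> i; exact: measurable_itv.
- move=> i; apply/measurable_EFinP; apply: measurable_funS mf => //; exact: IS'.
- move=> i x xI; rewrite lee_fin.
  have : (\bigcup_n I n) x by exists i.
  by rewrite IE/= in_itv/= => /fF[].
apply: cvg_EFin; first exact: nearW.
have cb : b - e n @[n --> \oo] --> b.
  by rewrite -[X in _ --> X]subr0; apply: cvgB => //; exact: cvg_cst.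
have ca : a + e n @[n --> \oo] --> a.
  by rewrite -[X in _ --> X]addr0; apply: cvgD => //; exact: cvg_cst.
apply: cvgB.
  move/cvg_at_leftP : Fb; apply; split => // n.
  by rewrite ltrBlDr ltrDl.
by move/cvg_at_rightP : Fa; apply; split => // n; rewrite ltrDl.
Qed.
End singular_ftc.

Section log_integrals.
Context {R : realType}.
Local Notation mu := (@lebesgue_measure R).

(** Continuous at [0], unlike [ln]: the primitives of logarithms are written with it. *)
Definition xln (x : R) : R := x * ln `|x|.

Lemma xln_bound (x : R) : `|x| <= 1 -> `|xln x| <= 2 * Num.sqrt `|x|.
Proof.
move=> x1; have [->|x0] := eqVneq x 0.
  by rewrite /xln mul0r normr0 mulr_ge0// sqrtr_ge0.
have nx : 0 < `|x| by rewrite normr_gt0.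
set q := Num.sqrt `|x|; have q0 : 0 < q by rewrite sqrtr_gt0.
have qE : `|x| = q ^+ 2 by rewrite sqr_sqrtr.
rewrite /xln normrM (ler0_norm (ln_le0 x1)) qE lnXn//.
have := @ln_sublinear R q^-1; rewrite invr_gt0 lnV ?posrE// => /(_ q0) h.
have : q ^+ 2 * (- ln q) <= q ^+ 2 * q^-1 by rewrite ler_pM2l ?exprn_gt0// ltW.
rewrite expr2 -[X in _ <= X]mulrA mulfV ?gt_eqF// mulr1 -mulr_natl; lra.
Qed.

Lemma continuous_xln : continuous xln.
Proof.
move=> x; have [->|x0] := eqVneq x 0; last first.
  apply: cvgM; first exact: cvg_id.
  apply: (continuous_comp (f := @Num.norm R R)); first exact: norm_continuous.
  by apply: continuous_ln; rewrite normr_gt0.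
have x00 : xln 0 = 0 by rewrite /xln mul0r.
apply/cvgrPdist_le => e e0; rewrite x00.
have cq : 2 * Num.sqrt `|y| @[y --> (0:R)] --> 2 * Num.sqrt `|0 : R|.
  apply: cvgM; first exact: cvg_cst.
  by apply: (continuous_comp (f := @Num.norm R R)); [exact: norm_continuous|exact: sqrt_continuous].
rewrite normr0 sqrtr0 mulr0 in cq.
have h1 : \forall y \near (0:R), 2 * Num.sqrt `|y| <= e by exact: (cvgr_le _ cq).
have h2 : \forall y \near (0:R), `|y| <= 1.
  have h : `|y| @[y --> (0:R)] --> (0 : R) by rewrite -[X in _ --> X](@normr0 _ R); exact: norm_continuous.
  exact: (cvgr_le _ h).
near=> y; rewrite sub0r normrN; apply: (@le_trans _ _ (2 * Num.sqrt `|y|)).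
  by apply: xln_bound; near: y.
by near: y.
Unshelve. all: by end_near. Qed.

Lemma is_derive_xln (x : R) : x != 0 -> is_derive x 1 xln (ln `|x| + 1).
Proof.
move=> x0.
have dn : is_derive x 1 (fun y : R => ln `|y|) x^-1.
  have [xn|xp|x0'] := ltgtP x 0; last by rewrite x0' eqxx in x0.
    have xn' : 0 < - x by rewrite oppr_gt0.
    have dl : is_derive x (1:R) (@ln R \o -%R) ((- x)^-1 * (- 1)).
      by apply: is_derive1_comp; exact: is_derive1_ln.
    apply: (@near_eq_is_derive _ _ _ (@ln R \o -%R)).
      by near=> y; rewrite /= ltr0_norm//; near: y; exact: lt_nbhsl.
    by apply: is_derive_eq; rewrite invrN mulrNN mulr1.
  apply: (@near_eq_is_derive _ _ _ (@ln R)).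
    by near=> y; rewrite gtr0_norm//; near: y; exact: lt_nbhsr.
  exact: is_derive1_ln.
have -> : xln = id * (fun y : R => ln `|y|) by [].
apply: is_derive_eq.
by rewrite /GRing.scale/= mulr1 mulfV// addrC.
Unshelve. all: by end_near. Qed.

Lemma measurable_lnabs : measurable_fun setT (fun x : R => ln `|x|).
Proof. by apply: measurable_lncomp; exact: normr_measurable. Qed.

Lemma continuous_lnabs (x : R) : x != 0 -> {for x, continuous (fun y : R => ln `|y|)}.
Proof.
move=> x0; apply: (continuous_comp (f := @Num.norm R R)); first exact: norm_continuous.
by apply: continuous_ln; rewrite normr_gt0.
Qed.

Lemma continuous_subr_cst (t : R) : continuous (fun s : R => s - t).
Proof. by move=> s; apply: cvgB; [exact: cvg_id|exact: cvg_cst]. Qed.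

Lemma integral_ln_itv (t a b : R) : a <= b -> (b <= t \/ t <= a) ->
  (forall s, a <= s <= b -> `|s - t| <= 1) ->
  (\int[mu]_(s in `[a, b]) (- ln `|s - t|)%:E =
   ((b - t - xln (b - t)) - (a - t - xln (a - t)))%:E)%E.
Proof.
rewrite le_eqVlt => /predU1P[->|ab] tab st1.
  by rewrite set_itv1 integral_set1 subrr.
have cF : continuous (fun s => s - t - xln (s - t)).
  move=> s; apply: cvgB; first by apply: cvgB => //; exact: cvg_cst.
  by apply: (continuous_comp (@continuous_subr_cst t s)); exact: continuous_xln.
rewrite (ge0_FTC2_singular (f := fun s => - ln `|s - t|) (F := fun s => s - t - xln (s - t)) ab).
- by [].
- exact/cvg_at_right_filter/cF.
- exact/cvg_at_left_filter/cF.
- move=> s /andP[as_ sb]; have st0 : s - t != 0.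
    by rewrite subr_eq0; apply/eqP => st; case: tab; lra.
  split.
  + apply: continuousN.
    apply: (@continuous_comp _ _ _ (fun s => s - t) (fun y : R => ln `|y|)).
      exact: continuous_subr_cst.
    exact: continuous_lnabs.
  + have d1 : is_derive s (1:R) (fun s => s - t) 1.
      by apply: is_derive_eq; rewrite subr0.
    have d2 : is_derive s (1:R) (xln \o (fun s => s - t)) ((ln `|s - t| + 1) * 1).
      by apply: is_derive1_comp; exact: is_derive_xln.
    have -> : (fun s => s - t - xln (s - t)) = (fun s => s - t) - (xln \o (fun s => s - t)) by [].
    by apply: is_derive_eq; lra.
  + by rewrite nln_ge0// st1// !ltW.
Qed.

Lemma integral_log01 (t : R) : 0 <= t <= 1 ->
  (\int[mu]_(s in `[0%R, 1%R]) (- ln `|s - t|)%:E = (1 - xln t - xln (1 - t))%:E)%E.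
Proof.
move=> /andP[t0 t1].
have m : measurable_fun setT (fun s : R => - ln `|s - t|).
  apply: measurableT_comp => //.
  by apply: (measurableT_comp measurable_lnabs); exact: measurable_funB.
have xln0 : xln 0 = 0 by rewrite /xln mul0r.
have xlnN u : xln (- u) = - xln u by rewrite /xln normrN mulNr.
have -> : `[0%R, 1%R]%classic = `[0%R, t]%classic `|` `]t, 1%R]%classic :> set R.
  by apply: itv_bndbnd_setU; rewrite bnd_simp.
rewrite ge0_integral_setU//=.
- rewrite integral_ln_itv//; last 2 first.
  + by left.
  + by move=> s /andP[h1 h2]; rewrite ler_norml; apply/andP; split; lra.
  rewrite integral_itv_obnd_cbnd; last by apply/measurable_funTS/measurable_EFinP.
  rewrite integral_ln_itv//; last 2 first.
  + by right.
  + by move=> s /andP[h1 h2]; rewrite ler_norml; apply/andP; split; lra.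
  by rewrite -EFinD subrr xln0 [0 - t]sub0r xlnN; congr EFin; lra.
- by apply/measurable_funTS/measurable_EFinP.
- move=> s /=; rewrite !in_itv/= => h; rewrite lee_fin nln_ge0// ler_norml.
  by apply/andP; split; case: h => /andP[]; lra.
- apply/disj_setPS => s [] /=; rewrite !in_itv/= => /andP[_ h1] /andP[h2 _].
  by move: (lt_le_trans h2 h1); rewrite ltxx.
Qed.

Lemma xln_le0 (x : R) : 0 <= x <= 1 -> xln x <= 0.
Proof.
move=> /andP[x0 x1]; rewrite /xln -oppr_ge0 -mulrN mulr_ge0// nln_ge0//.
by rewrite ger0_norm.
Qed.

Lemma continuous_compR (u g : R -> R) :
  continuous u -> continuous g -> continuous (fun t => g (u t)).
Proof. by move=> cu cg t; exact: (cvg_comp _ _ (cu t) (cg (u t))). Qed.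

(** The mean of the logarithmic kernel over the unit square, inner integral done. *)
Lemma integral_log01_twice :
  (\int[mu]_(t in `[0%R, 1%R]) (1 - xln t - xln (1 - t))%:E = (3 / 2 : R)%:E)%E.
Proof.
have cr : continuous (fun t : R => 1 - t).
  by move=> t; apply: cvgB; [exact: cvg_cst|exact: cvg_id].
have cx : continuous (fun t : R => xln (1 - t)).
  exact: (continuous_compR cr continuous_xln).
pose F t : R := t - (t * xln t / 2 - t ^+ 2 / 4)
  + ((1 - t) * xln (1 - t) / 2 - (1 - t) ^+ 2 / 4).
have cf : continuous (fun t : R => 1 - xln t - xln (1 - t)).
  move=> t; apply: cvgB; last exact: cx.
  by apply: cvgB; [exact: cvg_cst|exact: continuous_xln].
have cF : continuous F.
  have csq (u : R -> R) : continuous u -> continuous (fun t => u t * xln (u t) / 2 - (u t) ^+ 2 / 4).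
    move=> cu t; apply: cvgB; apply: cvgM; try exact: cvg_cst.
      apply: cvgM; first exact: cu.
      exact: (continuous_compR cu continuous_xln).
    by apply: cvgM; exact: cu.
  move=> t; apply: cvgD; last exact: (csq _ cr).
  by apply: cvgB => //; apply: (csq id) => ?; exact: cvg_id.
rewrite (ge0_FTC2_singular (F := F) ltr01).
- by rewrite /F /xln !subr0 subrr; congr EFin; rewrite !(mul0r,mulr0,expr0n,normr1,ln1)/=; lra.
- exact/cvg_at_right_filter/cF.
- exact/cvg_at_left_filter/cF.
- move=> t /andP[t0 t1]; split; first exact: cf.
  + have t0' : t != 0 by rewrite gt_eqF.
    have t1' : 1 - t != 0 by rewrite gt_eqF// subr_gt0.
    pose G (u : R) := u * xln u / 2 - u ^+ 2 / 4.
    have dG (u : R) : u != 0 -> is_derive u 1 G (xln u).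
      move=> u0; have du := is_derive_xln u0.
      have -> : G = 2^-1 *: (id * xln) - 4^-1 *: (id * id).
        by apply/funext => z; rewrite /G !fctE /GRing.scale/=; lra.
      by apply: is_derive_eq; rewrite /GRing.scale/= /xln; lra.
    have dr : is_derive t (1:R) (fun t => 1 - t) (-1).
      by apply: is_derive_eq; lra.
    have d1 := dG _ t0'.
    have d2 : is_derive t (1:R) (G \o (fun t => 1 - t)) (xln (1 - t) * -1).
      by apply: is_derive1_comp; exact: dG.
    have -> : F = id - G + (G \o (fun t => 1 - t)) by [].
    by apply: is_derive_eq; lra.
  + have h1 : xln t <= 0 by apply: xln_le0; rewrite !ltW.
    have h2 : xln (1 - t) <= 0 by apply: xln_le0; apply/andP; split; lra.
    lra.
Qed.
End log_integrals.

(** * The logarithmic energy form *)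

Definition unit01 (R : realType) : probability (measurableTypeR R) R :=
  uniform_prob (@ltr01 R).

Section unit01.
Context {R : realType}.
Local Notation mu := (@lebesgue_measure R).
Local Notation P := (unit01 R).

Lemma integral_unit01 (f : R -> \bar R) : measurable_fun setT f ->
  (\int[P]_x f x = \int[mu]_(x in `[0%R, 1%R]) f x)%E.
Proof.
move=> mf.
have ge0 (g : R -> \bar R) : measurable_fun setT g -> (forall x, 0 <= g x)%E ->
    (\int[P]_x g x = \int[mu]_(x in `[0%R, 1%R]) g x)%E.
  by move=> mg g0; rewrite integral_uniform// subr0 invr1 mul1e.
rewrite integralE [RHS]integralE; congr (_ - _)%E; apply: ge0 => //.
- exact: measurable_funepos.
- exact: measurable_funeneg.
Qed.

Lemma unit01E (A : set R) : measurable A -> P A = mu (A `&` `[0%R, 1%R]).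
Proof.
move=> mA; have := @integral_unit01 (EFin \o \1_A).
rewrite (integral_indic P)// setIT => ->; first by rewrite integral_indic.
exact/measurable_EFinP.
Qed.

Lemma ae_unit01 (p : R -> Prop) :
  {ae mu, forall x, 0 <= (x : R) <= 1 -> p x} -> {ae P, forall x, p x}.
Proof.
move=> [N [mN N0 pN]].
have mN' : measurable (N `|` ~` `[0%R, 1%R]%classic).
  by apply: measurableU => //; apply: measurableC.
exists (N `|` ~` `[0%R, 1%R]%classic); split => //.
- rewrite unit01E//; apply/eqP; rewrite eq_le measure_ge0 andbT -N0.
  apply: le_measure; rewrite ?inE//; first exact: measurableI.
  by move=> x [[//|]].
- move=> x npx; have [xI|xI] := pselect ((`[0%R, 1%R]%classic : set R) x).
    by left; apply: pN => /= h; apply: npx; apply: h; rewrite /= in_itv/= in xI.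
  by right.
Qed.

(** Clamping makes the kernel and the candidate functions total while keeping the
    logarithmic kernel nonnegative; nothing changes on the unit interval. *)
Definition clamp01 (x : R) : R := Num.max 0 (Num.min 1 x).

Lemma clamp01_itv x : 0 <= clamp01 x <= 1.
Proof. by rewrite /clamp01 le_max lexx/= ge_max ler01/= ge_min lexx. Qed.

Lemma clamp01_id x : 0 <= x <= 1 -> clamp01 x = x.
Proof. by move=> /andP[x0 x1]; rewrite /clamp01 (min_r x1) (max_r x0). Qed.

Lemma measurable_clamp01 : measurable_fun setT clamp01.
Proof. by apply: measurable_maxr => //; exact: measurable_minr. Qed.

Definition logker (s t : R) : R := - ln `|clamp01 s - clamp01 t|.

Lemma logker_ge0 s t : 0 <= logker s t.
Proof.
have /andP[h1 h2] := clamp01_itv s; have /andP[h3 h4] := clamp01_itv t.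
by apply: nln_ge0; rewrite ler_norml; apply/andP; split; lra.
Qed.

Lemma logkerC s t : logker s t = logker t s.
Proof. by rewrite /logker distrC. Qed.

Lemma measurable_logker d (T : measurableType d) (f g : T -> R) :
  measurable_fun setT f -> measurable_fun setT g ->
  measurable_fun setT (fun x => logker (f x) (g x)).
Proof.
move=> mf mg; apply: measurableT_comp => //; apply: (measurableT_comp measurable_lnabs).
by apply: measurable_funB; apply: (measurableT_comp measurable_clamp01).
Qed.

Lemma integral_logker t :
  (\int[P]_s (logker s t)%:E = (1 - xln (clamp01 t) - xln (1 - clamp01 t))%:E)%E.
Proof.
rewrite integral_unit01; last first.
  by apply/measurable_EFinP; apply: measurable_logker => //; exact: measurable_cst.
rewrite -integral_log01 ?clamp01_itv//; apply: eq_integral => s.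
by rewrite inE/= in_itv/= => s01; rewrite /logker (clamp01_id s01).
Qed.

Lemma integral_logker_le t : (\int[P]_s (logker s t)%:E <= 5%:E)%E.
Proof.
rewrite integral_logker lee_fin.
have b (x : R) : 0 <= x <= 1 -> - xln x <= 2.
  move=> /andP[x0 x1]; have h : `|x| <= 1 by rewrite ger0_norm.
  have h1 := xln_bound h; have h2 : Num.sqrt `|x| <= 1 by rewrite -sqrtr1 ler_wsqrtr.
  by have := ler_norm (- xln x); rewrite normrN; lra.
have h := clamp01_itv t; have h1 := b _ h.
have h2 : 0 <= 1 - clamp01 t <= 1 by move/andP: h => [u v]; apply/andP; split; lra.
by have := b _ h2; lra.
Qed.

Lemma integral2_logker : (\int[P]_t \int[P]_s (logker s t)%:E = (3 / 2 : R)%:E)%E.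
Proof.
under eq_integral do rewrite integral_logker.
rewrite integral_unit01.
  rewrite -integral_log01_twice; apply: eq_integral => s.
  by rewrite inE/= in_itv/= => s01; rewrite (clamp01_id s01).
apply/measurable_EFinP.
have mx : measurable_fun setT (@xln R) by apply: continuous_measurable_fun; exact: continuous_xln.
apply: measurable_funB.
  by apply: measurable_funB => //; apply: (measurableT_comp mx); exact: measurable_clamp01.
by apply: (measurableT_comp mx); apply: measurable_funB => //; exact: measurable_clamp01.
Qed.
End unit01.

Section log_energy.
Context {R : realType}.
Local Notation T := (measurableTypeR R).
Local Notation mu := (@lebesgue_measure R).
Local Notation P := (unit01 R).
Local Notation PP := (unit01 R \x unit01 R)%E.
Implicit Types (u v w : T -> R).

Lemma measurable_logker2 : measurable_fun setT (fun z : T * T => logker z.1 z.2).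
Proof. by apply: measurable_logker; [exact: measurable_fst|exact: measurable_snd]. Qed.

Lemma integrable_logker : PP.-integrable setT (fun z : T * T => (logker z.1 z.2)%:E).
Proof.
apply/integrableP; split; first by apply/measurable_EFinP; exact: measurable_logker2.
under eq_integral do rewrite gee0_abs ?lee_fin ?logker_ge0//.
rewrite fubini_tonelli1; last 2 first.
- by apply/measurable_EFinP; exact: measurable_logker2.
- by move=> z; rewrite lee_fin logker_ge0.
apply: (@le_lt_trans _ _ (\int[P]_x 5%:E)%E); last first.
  by rewrite integral_cst// [X in (_ * X)%E](probability_setT P) mule1 ltry.
apply: ge0_le_integral => //.
- by move=> x _; apply: integral_ge0 => y _; rewrite lee_fin logker_ge0.
- apply: (@measurable_fun_fubini_tonelli_F _ _ _ _ _ P (fun z : T * T => (logker z.1 z.2)%:E)) => //.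
    by apply/measurable_EFinP; exact: measurable_logker2.
  by move=> z; rewrite lee_fin logker_ge0.
move=> x _; rewrite /fubini_F/=; under eq_integral do rewrite logkerC.
exact: integral_logker_le.
Qed.

Lemma bmeas_fst u : bmeas u -> bmeas (fun z : T * T => u z.1).
Proof.
move=> [mu' [M uM]]; split; last by exists M => z.
by apply: (measurableT_comp mu'); exact: measurable_fst.
Qed.

Lemma bmeas_snd u : bmeas u -> bmeas (fun z : T * T => u z.2).
Proof.
move=> [mu' [M uM]]; split; last by exists M => z.
by apply: (measurableT_comp mu'); exact: measurable_snd.
Qed.

Lemma bmeas_tensor u v : bmeas u -> bmeas v -> bmeas (fun z : T * T => u z.1 * v z.2).
Proof. by move=> bu bv; apply: bmeasM; [exact: bmeas_fst|exact: bmeas_snd]. Qed.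

Lemma integrable_logkerM (g : T * T -> R) : bmeas g ->
  PP.-integrable setT (fun z => (logker z.1 z.2 * g z)%:E).
Proof.
move=> [mg [M gM]].
have MI : PP.-integrable setT (fun z : T * T => (M%:E * (logker z.1 z.2)%:E)%E).
  by apply: integrableZl => //; exact: integrable_logker.
apply: (le_integrable _ _ _ MI) => //.
  by apply/measurable_EFinP/measurable_funM => //; exact: measurable_logker2.
move=> z _; rewrite -EFinM !abse_EFin lee_fin !normrM mulrC ler_wpM2r//.
by apply: (le_trans (gM z)); exact: ler_norm.
Qed.

(** The polarised logarithmic energy. *)
Definition logform u v : R := \int[PP]_z (logker z.1 z.2 * (u z.1 * v z.2)).

(** Fubini's theorem connects the integral over the square, convenient for the algebra
    of the form, with the iterated integral of the problem. *)
Lemma logform_integral u v : bmeas u -> bmeas v ->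
  (\int[P]_x \int[P]_y (logker x y * (u x * v y))%:E = (logform u v)%:E)%E.
Proof.
move=> bu bv; have h := integrable_logkerM (bmeas_tensor bu bv).
rewrite [LHS](integral12_prod_meas1 h) /logform /Rintegral fineK//.
exact: integrable_fin_num.
Qed.

Lemma logformC u v : bmeas u -> bmeas v -> logform u v = logform v u.
Proof.
move=> bu bv; apply: EFin_inj.
rewrite -(logform_integral bu bv) -(logform_integral bv bu).
rewrite (@Fubini _ _ _ _ _ P P (fun z => (logker z.1 z.2 * (u z.1 * v z.2))%:E)).
  apply: eq_integral => x _; apply: eq_integral => y _ /=.
  by rewrite logkerC [u y * _]mulrC.
exact: integrable_logkerM (bmeas_tensor bu bv).
Qed.

Lemma logformDl u v w : bmeas u -> bmeas v -> bmeas w ->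
  logform (fun x => u x + v x) w = logform u w + logform v w.
Proof.
move=> bu bv bw; rewrite /logform -RintegralD//; last 2 first.
- exact: integrable_logkerM (bmeas_tensor bu bw).
- exact: integrable_logkerM (bmeas_tensor bv bw).
by apply: eq_Rintegral => z _; ring.
Qed.

Lemma logformZl (c : R) u w : bmeas u -> bmeas w ->
  logform (fun x => c * u x) w = c * logform u w.
Proof.
move=> bu bw; rewrite /logform -RintegralZl//; last first.
  exact: integrable_logkerM (bmeas_tensor bu bw).
by apply: eq_Rintegral => z _; ring.
Qed.

Lemma Rintegral_tensor u v : bmeas u -> bmeas v ->
  \int[PP]_z (u z.1 * v z.2) = (\int[P]_x u x) * \int[P]_x v x.
Proof.
move=> bu bv; apply: EFin_inj.
rewrite -Rintegral_EFin; last exact: bmeas_tensor.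
rewrite -(integral12_prod_meas1 (bmeas_integrable PP (bmeas_tensor bu bv)))/=.
rewrite /fubini_F/=.
under eq_integral => x _.
  under eq_integral do rewrite EFinM.
  rewrite integralZl//; last exact: bmeas_integrable.
  rewrite Rintegral_EFin// muleC.
  over.
rewrite integralZl//; last exact: bmeas_integrable.
by rewrite Rintegral_EFin// -EFinM mulrC.
Qed.

(** The affine change of variable onto the interval of the Chebyshev polynomials. *)
Definition aff01 (s : R) : R := 2 * clamp01 s - 1.

Lemma aff01_itv s : -1 <= aff01 s <= 1.
Proof. by have /andP[h1 h2] := clamp01_itv s; rewrite /aff01; apply/andP; split; lra. Qed.

Lemma measurable_aff01 : measurable_fun setT aff01.
Proof.
apply: measurable_funB => //; apply: measurable_funM => //; exact: measurable_clamp01.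
Qed.

Definition chebmoment k u : R := \int[P]_s (chebT k (aff01 s) * u s).

Lemma bmeas_chebaff k : bmeas (fun s : T => chebT k (aff01 s)).
Proof. by apply: bmeas_chebT; [exact: measurable_aff01|move=> s; exact: aff01_itv]. Qed.

(** The factor [1/2] of the change of variable and the [2] of the arcsine normalisation
    contribute [ln 2] each; this constant makes the form definite on constants too. *)
Lemma logker_cheb s t : aff01 s != aff01 t ->
  logker s t = 2 * ln 2 - ln (2 * `|aff01 s - aff01 t|).
Proof.
move=> ne; have p0 : 0 < `|aff01 s - aff01 t| by rewrite normr_gt0 subr_eq0.
have E : `|clamp01 s - clamp01 t| = `|aff01 s - aff01 t| / 2.
  have -> : aff01 s - aff01 t = 2 * (clamp01 s - clamp01 t) by rewrite /aff01; ring.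
  by rewrite normrM (ger0_norm (ler0n R 2)); field.
rewrite /logker E lnM ?posrE// lnV ?posrE// lnM ?posrE//; ring.
Qed.

(** The Abel regularisation of [logform u u]. *)
Definition chebform r u : R :=
  \int[PP]_z ((2 * ln 2 + cheblog r (aff01 z.1) (aff01 z.2)) * (u z.1 * u z.2)).

Lemma bmeas_cheblog2 r : 0 <= r < 1 ->
  bmeas (fun z : T * T => cheblog r (aff01 z.1) (aff01 z.2)).
Proof.
move=> r01; apply: bmeas_cheblog => //; try by move=> z; exact: aff01_itv.
- by apply: (measurableT_comp measurable_aff01); exact: measurable_fst.
- by apply: (measurableT_comp measurable_aff01); exact: measurable_snd.
Qed.

Lemma Rintegral_chebsum2 n r u : bmeas u ->
  \int[PP]_z (chebsum n r (aff01 z.1) (aff01 z.2) * (u z.1 * u z.2)) =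
  \sum_(k < n) (2 * r ^+ k.+1 / k.+1%:R) * (chebmoment k.+1 u) ^+ 2.
Proof.
move=> bu.
have bk k : bmeas (fun s => chebT k (aff01 s) * u s) by apply: bmeasM => //; exact: bmeas_chebaff.
transitivity (\int[PP]_z (\sum_(k < n) (2 * r ^+ k.+1 / k.+1%:R) *
    ((chebT k.+1 (aff01 z.1) * u z.1) * (chebT k.+1 (aff01 z.2) * u z.2)))).
  apply: eq_Rintegral => z _; rewrite /chebsum mulr_suml; apply: eq_bigr => k _; ring.
rewrite (@Rintegral_sumord _ _ _ PP n (fun k z => (2 * r ^+ k.+1 / k.+1%:R) *
    ((chebT k.+1 (aff01 z.1) * u z.1) * (chebT k.+1 (aff01 z.2) * u z.2)))); last first.
  move=> k; apply: bmeasZ; exact: (bmeas_tensor (bk k.+1) (bk k.+1)).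
apply: eq_bigr => k _; rewrite RintegralZl//; last first.
  apply: bmeas_integrable; exact: (bmeas_tensor (bk k.+1) (bk k.+1)).
by rewrite (Rintegral_tensor (bk k.+1) (bk k.+1)) expr2.
Qed.

(** Up to a geometrically small error the regularised energy is a sum of nonnegative
    multiples of squared moments, of which the mean and one more are kept. *)
Lemma chebform_ge r u k : 0 <= r < 1 -> bmeas u ->
  2 * ln 2 * (\int[P]_s u s) ^+ 2
    + (2 * r ^+ k.+1 / k.+1%:R) * (chebmoment k.+1 u) ^+ 2 <= chebform r u.
Proof.
move=> r01 bu; have /andP[r0 r1] := r01; have bt := bmeas_tensor bu bu.
have bc := bmeas_cheblog2 r01; have bcu := bmeasM bc bt.
have [_ [M uM]] := bu.
have M0 : 0 <= M by apply: le_trans (uM 0).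
have -> : chebform r u = 2 * ln 2 * (\int[P]_s u s) ^+ 2 +
    \int[PP]_z (cheblog r (aff01 z.1) (aff01 z.2) * (u z.1 * u z.2)).
  rewrite expr2 -Rintegral_tensor// -RintegralZl//; last exact: bmeas_integrable.
  rewrite -RintegralD//; last 2 first.
  - by apply: bmeas_integrable; exact: bmeasZ.
  - exact: bmeas_integrable.
  by apply: eq_Rintegral => z _; ring.
rewrite lerD2l -subr_le0.
apply: (@le_geom0 _ _ (4 * r ^+ k.+2 / (1 - r) ^+ 2 * M ^+ 2) r) => // n.
pose N := (k.+1 + n)%N.
have bs : bmeas (fun z : T * T => chebsum N r (aff01 z.1) (aff01 z.2) * (u z.1 * u z.2)).
  apply: bmeasM => //.
  apply: (@bmeas_sum _ _ _ N (fun k z => (2 * r ^+ k.+1 / k.+1%:R) *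
    (chebT k.+1 (aff01 z.1) * chebT k.+1 (aff01 z.2)))) => j.
  by apply: bmeasZ; exact: (bmeas_tensor (bmeas_chebaff _) (bmeas_chebaff _)).
have := @Rintegral_dist _ _ _ PP _ _ (4 * r ^+ N.+1 / (1 - r) ^+ 2 * M ^+ 2) bcu bs.
rewrite Rintegral_chebsum2// => H.
have {}H : `|\int[PP]_z (cheblog r (aff01 z.1) (aff01 z.2) * (u z.1 * u z.2)) -
    \sum_(j < N) (2 * r ^+ j.+1 / j.+1%:R) * (chebmoment j.+1 u) ^+ 2| <=
    4 * r ^+ N.+1 / (1 - r) ^+ 2 * M ^+ 2.
  apply: H => z; rewrite -mulrBl normrM; apply: ler_pM => //.
    by apply: cheblog_chebsum => //; exact: aff01_itv.
  by rewrite normrM expr2 ler_pM.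
have S : (2 * r ^+ k.+1 / k.+1%:R) * (chebmoment k.+1 u) ^+ 2 <=
    \sum_(j < N) (2 * r ^+ j.+1 / j.+1%:R) * (chebmoment j.+1 u) ^+ 2.
  have kN : (k < N)%N by rewrite /N addSn ltnS leq_addr.
  rewrite (bigD1 (Ordinal kN))//= lerDl sumr_ge0// => j _.
  by rewrite mulr_ge0 ?sqr_ge0// mulr_ge0 ?invr_ge0// mulr_ge0// exprn_ge0.
have -> : 4 * r ^+ k.+2 / (1 - r) ^+ 2 * M ^+ 2 * r ^+ n = 4 * r ^+ N.+1 / (1 - r) ^+ 2 * M ^+ 2.
  have -> : N.+1 = (k.+2 + n)%N by rewrite /N !addSn.
  by rewrite exprD; ring.
rewrite lerBlDl; apply: (le_trans S).
by move: H; rewrite ler_norml => /andP[+ _]; rewrite lerBrDr addrC lerBlDr.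
Qed.

Lemma affP_null (x : R) : P [set y | aff01 x = aff01 y] = 0%E.
Proof.
have mA : measurable ([set y : T | aff01 x = aff01 y]).
  have -> : [set y : T | aff01 x = aff01 y] = aff01 @^-1` [set aff01 x].
    by apply/seteqP; split => y /=.
  by rewrite -[X in measurable X]setTI; apply: measurable_aff01.
rewrite unit01E//; apply/eqP; rewrite eq_le measure_ge0 andbT.
rewrite -(lebesgue_measure_set1 (clamp01 x)).
apply: le_measure; rewrite ?inE//; first exact: measurableI.
move=> y /= [h]; rewrite in_itv/= => y01.
have inj (a b : R) : 2 * a - 1 = 2 * b - 1 -> b = a by lra.
by move: h; rewrite /aff01 (clamp01_id y01) => /inj.
Qed.

Lemma diag_negligible : PP.-negligible [set z : T * T | aff01 z.1 = aff01 z.2].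
Proof.
have mA : measurable [set z : T * T | aff01 z.1 = aff01 z.2].
  have -> : [set z : T * T | aff01 z.1 = aff01 z.2] = (fun z : T * T => aff01 z.1 - aff01 z.2) @^-1` [set 0].
    by apply/seteqP; split => z /= => [->|/eqP]; rewrite ?subrr// subr_eq0 => /eqP.
  rewrite -[X in measurable X]setTI.
  have h : measurable_fun setT (fun z : T * T => aff01 z.1 - aff01 z.2).
    apply: measurable_funB; apply: (measurableT_comp measurable_aff01).
      exact: measurable_fst.
    exact: measurable_snd.
  exact: h.
exists [set z : T * T | aff01 z.1 = aff01 z.2]; split => //.
rewrite /product_measure1; apply: integral0_eq => x _ /=.
rewrite -(affP_null x); congr (P _).
by apply/seteqP; split => y; rewrite /xsection/= inE.
Qed.

(** Dominated convergence: [cheblog_ge] and [cheblog_le] bound the regularised kernels by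
    [logker] plus a constant, away from the negligible diagonal. *)
Lemma chebform_cvg u : bmeas u -> chebform (abelr n) u @[n --> \oo] --> logform u u.
Proof.
move=> bu; have [mu' [M uM]] := bu; have bt := bmeas_tensor bu bu.
have M0 : 0 <= M by apply: le_trans (uM 0).
pose f n (z : T * T) := ((2 * ln 2 + cheblog (abelr n) (aff01 z.1) (aff01 z.2)) * (u z.1 * u z.2)).
pose g (z : T * T) := (logker z.1 z.2 * (u z.1 * u z.2)).
have bf n : bmeas (f n).
  apply: bmeasM => //; apply: bmeasD; first exact: bmeas_cst.
  by apply: bmeas_cheblog2; exact: abelr01W.
have gI := integrable_logkerM bt.
pose h (z : T * T) := (M ^+ 2 * logker z.1 z.2 + M ^+ 2 * ln 2).
have hI : PP.-integrable setT (EFin \o h).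
  apply: (@integrableD _ _ _ PP setT measurableT (fun z => (M ^+ 2 * logker z.1 z.2)%:E) (fun=> (M ^+ 2 * ln 2)%:E)).
    by apply: (@integrableZl _ _ _ PP _ _ (M ^+ 2) (fun z => (logker z.1 z.2)%:E)) => //; exact: integrable_logker.
  exact: (bmeas_integrable PP (@bmeas_cst _ (T * T)%type R (M ^+ 2 * ln 2))).
have ln4 : ln (4 : R) = 2 * ln 2.
  have -> : (4 : R) = 2 * 2 by ring.
  by rewrite lnM ?posrE//; ring.
have aeN (p : T * T -> Prop) : (forall z, aff01 z.1 != aff01 z.2 -> p z) -> {ae PP, forall z, p z}.
  move=> hp; apply: negligibleS diag_negligible => z /= np.
  by apply: contrapT => /eqP ne; apply: np; exact: hp.
have cvae : {ae PP, forall z, setT z -> (f n z)%:E @[n --> \oo] --> (g z)%:E}.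
  apply: aeN => z ne _; apply: cvg_EFin; first exact: nearW.
  apply: cvgM; last exact: cvg_cst.
  rewrite logker_cheb//; apply: cvgD; first exact: cvg_cst.
  by apply: cheblog_cvg => //; exact: aff01_itv.
have domae : {ae PP, forall z n, setT z -> (`|(f n z)%:E| <= (h z)%:E)%E}.
  apply: aeN => z ne n _; rewrite abse_EFin lee_fin /f /h -mulrDr normrM mulrC.
  apply: ler_pM => //; first by rewrite normrM expr2 ler_pM.
  have h1 := cheblog_ge (abelr01W n) (aff01_itv z.1) (aff01_itv z.2).
  have h2 := cheblog_le (@abelr01 R n) (aff01_itv z.1) (aff01_itv z.2) ne.
  have h3 : - ln (abelr n) <= ln 2 :> R.
    rewrite lerNl -lnV ?posrE// ler_ln ?posrE//; last by have /andP[] := @abelr01 R n.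
    by rewrite /abelr ler_pdivlMr// mulrC ler_pdivrMr// -natrM ler_nat mulnC -addn1 -addn1; lia.
  rewrite logker_cheb// ger0_norm; last by lra.
  by lra.
have [_ _ cv] := dominated_convergence measurableT
  (fun n => measurable_int _ (bmeas_integrable PP (bf n))) (measurable_int _ gI) cvae hI domae.
have {}cv : (chebform (abelr n) u)%:E @[n --> \oo] --> (logform u u)%:E.
  have <- : (\int[PP]_z (g z)%:E)%E = (logform u u)%:E.
    by rewrite /logform /Rintegral fineK//; exact: integrable_fin_num.
  have -> : (fun n => (chebform (abelr n) u)%:E) = (fun n => \int[PP]_z (f n z)%:E)%E.
    by apply/funext => n; rewrite Rintegral_EFin.
  exact: cv.
exact: (fine_cvg cv).
Qed.

(** Each Chebyshev moment is controlled by the energy, so that the energy is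
    nonnegative and vanishes only when all moments do. *)
Lemma logform_ge u k : bmeas u ->
  2 * ln 2 * (\int[P]_s u s) ^+ 2 + 2 / k.+1%:R * (chebmoment k.+1 u) ^+ 2 <= logform u u.
Proof.
move=> bu; have cv := chebform_cvg bu.
have cr : 2 * ln 2 * (\int[P]_s u s) ^+ 2
    + (2 * (abelr n) ^+ k.+1 / k.+1%:R) * (chebmoment k.+1 u) ^+ 2 @[n --> \oo] -->
  2 * ln 2 * (\int[P]_s u s) ^+ 2 + (2 * 1 ^+ k.+1 / k.+1%:R) * (chebmoment k.+1 u) ^+ 2.
  apply: cvgD; first exact: cvg_cst.
  apply: cvgM; last exact: cvg_cst.
  apply: cvgM; last exact: cvg_cst.
  apply: cvgM; first exact: cvg_cst.
  by apply: (cvg_comp _ _ (@abelr_cvg R) (@exprn_continuous R k.+1 1)).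
rewrite expr1n mulr1 in cr.
apply: (ler_cvg_to cr cv); apply: nearW => n.
by apply: chebform_ge => //; exact: abelr01W.
Qed.

Lemma logform_ge0 u : bmeas u -> 0 <= logform u u.
Proof.
move=> bu; apply: le_trans (logform_ge 0 bu).
by rewrite addr_ge0// mulr_ge0 ?sqr_ge0// mulr_ge0// ln_ge0// ler1n.
Qed.

Lemma logform0_chebmoment u k : bmeas u -> logform u u <= 0 -> chebmoment k u = 0.
Proof.
move=> bu u0.
have ln2 : 0 < ln (2 : R) by rewrite ln_gt0// ltr1n.
have h0 := sqr_ge0 (\int[P]_s u s).
case: k => [|k].
  have h := logform_ge 0 bu; have h1 := sqr_ge0 (chebmoment 1 u).
  have : (\int[P]_s u s) ^+ 2 <= 0.
    rewrite -(pmulr_rle0 _ (_ : 0 < 2 * ln 2)) ?mulr_gt0//.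
    by rewrite divr1 in h; lra.
  have -> : chebmoment 0 u = \int[P]_s u s by apply: eq_Rintegral => s _; rewrite /= mul1r.
  by move=> h2; apply/eqP; rewrite -sqrf_eq0 eq_le h2 h0.
have h := logform_ge k bu; have h1 := sqr_ge0 (chebmoment k.+1 u).
have c0 : 0 < 2 / k.+1%:R :> R by rewrite divr_gt0.
have : (chebmoment k.+1 u) ^+ 2 <= 0.
  rewrite -(pmulr_rle0 _ c0); apply: le_trans u0; apply: le_trans h.
  by rewrite lerDr mulr_ge0// mulr_ge0// ltW.
by move=> h2; apply/eqP; rewrite -sqrf_eq0 eq_le h2 h1.
Qed.

Lemma chebmoment0_power u : bmeas u -> (forall k, chebmoment k u = 0) ->
  forall j, \int[P]_s ((aff01 s) ^+ j * u s) = 0.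
Proof.
move=> bu m0.
have ba : bmeas (aff01 : T -> R).
  by split; [exact: measurable_aff01|exists 1 => s; rewrite ler_norml; exact: aff01_itv].
have baj j : bmeas (fun s : T => aff01 s ^+ j).
  elim: j => [|j IH]; first exact: bmeas_cst.
  have -> : (fun s : T => aff01 s ^+ j.+1) = (fun s => aff01 s * aff01 s ^+ j).
    by apply/funext => s; rewrite exprS.
  exact: bmeasM.
have gen j k : \int[P]_s ((aff01 s) ^+ j * chebT k (aff01 s) * u s) = 0.
  elim: j k => [|j IH] k.
    by rewrite -[RHS](m0 k); apply: eq_Rintegral => s _; rewrite expr0 mul1r.
  case: k => [|k].
    by rewrite -[RHS](IH 1%N); apply: eq_Rintegral => s _; rewrite exprS/=; ring.
  have b k' : bmeas (fun s => (aff01 s) ^+ j * chebT k' (aff01 s) * u s).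
    by apply: bmeasM => //; apply: bmeasM; [exact: baj|exact: bmeas_chebaff].
  transitivity (\int[P]_s (1 / 2 * ((aff01 s) ^+ j * chebT k.+2 (aff01 s) * u s) +
     1 / 2 * ((aff01 s) ^+ j * chebT k (aff01 s) * u s))).
    by apply: eq_Rintegral => s _; rewrite exprS chebTSS; field.
  rewrite RintegralD//; last 2 first.
  - by apply: bmeas_integrable; exact: (bmeasZ _ (b _)).
  - by apply: bmeas_integrable; exact: (bmeasZ _ (b _)).
  rewrite !RintegralZl//; [|by apply: bmeas_integrable; exact: b..].
  by rewrite !IH !mulr0 addr0.
move=> j; rewrite -[RHS](gen j 0%N); apply: eq_Rintegral => s _.
by rewrite mulr1.
Qed.
End log_energy.

(** * Definiteness of the energy form *)

Section moments.
Context {R : realType}.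
Local Notation T := (measurableTypeR R).
Local Notation mu := (@lebesgue_measure R).
Local Notation P := (unit01 R).

Lemma bernoulli_ge (z : R) m : 0 <= z <= 1 -> 1 - m%:R * z <= (1 - z) ^+ m.
Proof.
move=> /andP[z0 z1]; elim: m => [|m IH]; first by rewrite mul0r subr0 expr0.
rewrite exprS -natr1 mulrDl mul1r.
have h : (1 - z) * (1 - m%:R * z) <= (1 - z) * (1 - z) ^+ m by rewrite ler_wpM2l// subr_ge0.
have : 0 <= m%:R * z * z by rewrite !mulr_ge0.
lra.
Qed.

Lemma bernoulli_le (z : R) m : 0 <= z <= 1 -> (1 - z) ^+ m * (m%:R * z) <= 1.
Proof.
move=> /andP[z0 z1].
have h1 : 1 + m%:R * z <= (1 + z) ^+ m.
  elim: m => [|m IH]; first by rewrite mul0r addr0 expr0.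
  rewrite exprS -natr1 mulrDl mul1r.
  have h : (1 + z) * (1 + m%:R * z) <= (1 + z) * (1 + z) ^+ m by rewrite ler_wpM2l// addr_ge0.
  have : 0 <= m%:R * z * z by rewrite !mulr_ge0.
  lra.
have p0 : 0 <= (1 - z) ^+ m by rewrite exprn_ge0// subr_ge0.
apply: (@le_trans _ _ ((1 - z) ^+ m * (1 + z) ^+ m)).
  by rewrite ler_wpM2l//; lra.
rewrite -exprMn; have -> : (1 - z) * (1 + z) = 1 - z ^+ 2 by ring.
have z2 : 0 <= z ^+ 2 by exact: sqr_ge0.
by rewrite exprn_ile1// ?subr_ge0 ?gerBl// expr_le1.
Qed.

(** With [n] growing, Bernoulli's inequalities make this a polynomial step: it tends to
    [1] for [w < 1/2] and to [0] for [w > 1/2]. *)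
Definition stepq n (w : R) : R := (1 - w ^+ n) ^+ (2 ^ n).

Lemma stepq_itv n w : 0 <= w <= 1 -> 0 <= stepq n w <= 1.
Proof.
move=> /andP[w0 w1]; have h1 : w ^+ n <= 1 by rewrite exprn_ile1.
have h0 : 0 <= w ^+ n by rewrite exprn_ge0.
by rewrite /stepq exprn_ge0 ?subr_ge0//= exprn_ile1 ?subr_ge0 ?gerBl.
Qed.

Lemma stepq_lt w : 0 <= w < 1 / 2 -> stepq n w @[n --> \oo] --> (1 : R).
Proof.
move=> /andP[w0 w1].
have cv : 1 - (2 * w) ^+ n @[n --> \oo] --> (1 : R).
  rewrite -[X in _ --> X]subr0; apply: cvgB; first exact: cvg_cst.
  by apply: cvg_expr; rewrite ger0_norm ?mulr_ge0//; lra.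
apply: (squeeze_cvgr _ cv (cvg_cst (1 : R))); apply: nearW => n.
have w01 : 0 <= w <= 1 by rewrite w0/=; lra.
have /andP[_ ->] := stepq_itv n w01; rewrite andbT /stepq.
have := @bernoulli_ge (w ^+ n) (2 ^ n).
by rewrite exprn_ge0// exprn_ile1 ?(andP w01).2// natrX -exprMn; exact.
Qed.

Lemma stepq_gt w : 1 / 2 < w <= 1 -> stepq n w @[n --> \oo] --> (0 : R).
Proof.
move=> /andP[w0 w1].
have w2 : 0 < 2 * w by lra.
have cv : ((2 * w)^-1) ^+ n @[n --> \oo] --> (0 : R).
  apply: cvg_expr; rewrite ger0_norm ?invr_ge0 ?ltW// invf_lt1//; lra.
apply: (squeeze_cvgr _ (cvg_cst (0 : R)) cv); apply: nearW => n.
have w01 : 0 <= w <= 1 by apply/andP; split; lra.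
have /andP[-> _] := stepq_itv n w01 => /=.
have := @bernoulli_le (w ^+ n) (2 ^ n); rewrite -/(stepq n w).
have -> : 0 <= w ^+ n <= 1 by rewrite exprn_ge0 ?exprn_ile1 ?(andP w01).1 ?(andP w01).2.
rewrite natrX -exprMn => /(_ erefl).
by move=> h; rewrite exprVn -[leRHS]div1r ler_pdivlMr// exprn_gt0.
Qed.

Lemma power0_poly (u : T -> R) (p : {poly R}) : bmeas u ->
  (forall j, \int[P]_s ((aff01 s) ^+ j * u s) = 0) ->
  \int[P]_s (p.[aff01 s] * u s) = 0.
Proof.
move=> bu m0.
have ba : bmeas (aff01 : T -> R).
  by split; [exact: measurable_aff01|exists 1 => s; rewrite ler_norml; exact: aff01_itv].
have baj j : bmeas (fun s : T => aff01 s ^+ j * u s).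
  apply: bmeasM => //; elim: j => [|j IH]; first exact: bmeas_cst.
  have -> : (fun s : T => aff01 s ^+ j.+1) = (fun s => aff01 s * aff01 s ^+ j).
    by apply/funext => s; rewrite exprS.
  exact: bmeasM.
transitivity (\int[P]_s (\sum_(j < size p) p`_j * ((aff01 s) ^+ j * u s))).
  apply: eq_Rintegral => s _; rewrite horner_coef mulr_suml.
  by apply: eq_bigr => j _; rewrite mulrA.
rewrite (@Rintegral_sumord _ _ _ P _ (fun j s => p`_j * ((aff01 s) ^+ j * u s))).
  apply: big1 => j _; rewrite RintegralZl// ?m0 ?mulr0//.
  by apply: bmeas_integrable; exact: baj.
by move=> j; apply: bmeasZ.
Qed.

(** The polynomials [stepq n], shifted to have their jump at [x], converge boundedly to
    the indicator function. *)
Lemma power0_step (u : T -> R) (x : R) : bmeas u ->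
  (forall j, \int[P]_s ((aff01 s) ^+ j * u s) = 0) -> 0 <= x <= 1 ->
  \int[P]_s (\1_[set s | clamp01 s < x] s * u s) = 0.
Proof.
move=> bu m0 x01; have /andP[x0 x1] := x01.
pose w (s : T) : R := 1 / 2 + (clamp01 s - x) / 2.
have w01 s : 0 <= w s <= 1.
  have /andP[h1 h2] := clamp01_itv s; rewrite /w; apply/andP; split; lra.
pose f n s := stepq n (w s) * u s.
pose A : set T := [set s | clamp01 s < x].
have mA : measurable A.
  have -> : A = clamp01 @^-1` `]-oo, x[ by apply/seteqP; split => s /=; rewrite in_itv.
  by rewrite -[X in measurable X]setTI; apply: measurable_clamp01.
have [mu' [M uM]] := bu.
have mw : measurable_fun setT w.
  apply: measurable_funD => //; apply: measurable_funM => //.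
  by apply: measurable_funB => //; exact: measurable_clamp01.
have bf n : bmeas (f n).
  apply: bmeasM => //; split.
    by apply: measurable_funX; apply: measurable_funB => //; exact: measurable_funX.
  by exists 1 => s; have /andP[h1 h2] := stepq_itv n (w01 s); rewrite ger0_norm.
have fE n : \int[P]_s f n s = 0.
  pose q : {poly R} := (1 - ((1 / 4) *: 'X + (3 / 4 - x / 2)%:P) ^+ n) ^+ (2 ^ n).
  rewrite -[RHS](@power0_poly u q)//; apply: eq_Rintegral => s _.
  rewrite /f /q /stepq !(hornerE, horner_exp); congr ((_ - _ ^+ _) ^+ _ * _).
  by rewrite /w /aff01/=; lra.
have bg : bmeas (fun s => \1_A s * u s).
  apply: bmeasM => //; split; first exact: measurable_indic.
  by exists 1 => s; rewrite indicE; case: (_ \in _); rewrite ?normr1 ?normr0.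
have cvae : {ae P, forall s, setT s -> (f n s)%:E @[n --> \oo] --> (\1_A s * u s)%:E}.
  apply: ae_unit01; exists [set x]; split => //; first exact: lebesgue_measure_set1.
  move=> s /= /not_implyP[s01]; apply: contra_notP => /eqP sx _.
  apply: cvg_EFin; first exact: nearW.
  apply: cvgM; last exact: cvg_cst.
  have [sx'|xs|/esym/eqP] := ltgtP s x; last by rewrite eq_sym (negbTE sx).
    rewrite indicE mem_set/=; last by rewrite /A/= clamp01_id.
    by apply: stepq_lt; have /andP[-> _] := w01 s; rewrite /w clamp01_id//=; lra.
  rewrite indicE memNset/=; last by rewrite /A/= clamp01_id//; apply/negP; rewrite -leNgt ltW.
  by apply: stepq_gt; have /andP[_ ->] := w01 s; rewrite /w clamp01_id// andbT; lra.
have domae : {ae P, forall s n, setT s -> (`|(f n s)%:E| <= M%:E)%E}.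
  apply: aeW => s n _; rewrite abse_EFin lee_fin normrM -[leRHS]mul1r.
  by apply: ler_pM => //; have /andP[h1 h2] := stepq_itv n (w01 s); rewrite ger0_norm.
have [_ _ cv] := dominated_convergence measurableT
  (fun n => measurable_int _ (bmeas_integrable P (bf n)))
  (measurable_int _ (bmeas_integrable P bg)) cvae
  (bmeas_integrable P (@bmeas_cst _ T R M)) domae.
have c0 : (\int[P]_s (f n s)%:E)%E @[n --> \oo] --> (0%:E : \bar R).
  have -> : (fun n => \int[P]_s (f n s)%:E)%E = (fun=> 0%:E).
    by apply/funext => n; rewrite Rintegral_EFin// fE.
  exact: cvg_cst.
have := cvg_unique _ cv c0; rewrite Rintegral_EFin// => h; apply: EFin_inj.
by rewrite -[RHS]h.
Qed.

(** The form in which definiteness is used: a density of zero energy has a vanishing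
    distribution function. *)
Lemma logform0_step (u : T -> R) (x : R) : bmeas u -> logform u u <= 0 -> 0 <= x <= 1 ->
  \int[P]_s (\1_[set s | clamp01 s < x] s * u s) = 0.
Proof.
move=> bu u0; apply: power0_step => //; apply: chebmoment0_power => // k.
exact: logform0_chebmoment.
Qed.
End moments.

(** * Integrated arcsine distribution functions *)

Section arcsine_cdf.
Context {R : realType}.
Local Notation mu := (@lebesgue_measure R).
Local Notation U := (halfcircle R).
Implicit Types (c k x y : R).

(** Half the width of the band on which the minimizer with [1/2 - y = k] is not
    constant. *)
Definition radius k : R := Num.sqrt (1 / 4 - k ^+ 2).

Lemma radius_gt0 k : 0 <= k < 1 / 2 -> 0 < radius k.
Proof. by move=> /andP[k0 k1]; rewrite sqrtr_gt0; nra. Qed.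

Lemma radius_le k : radius k <= 1 / 2.
Proof.
have -> : (1 / 2 : R) = Num.sqrt ((1 / 2) ^+ 2) by rewrite sqrtr_sqr ger0_norm//; lra.
by rewrite ler_wsqrtr//; have := sqr_ge0 k; lra.
Qed.

Lemma radius_sq k : 0 <= k < 1 / 2 -> radius k ^+ 2 = 1 / 4 - k ^+ 2.
Proof. by move=> /andP[k0 k1]; rewrite sqr_sqrtr//; nra. Qed.

Lemma radius_dec k k' : 0 <= k <= k' -> radius k' <= radius k.
Proof. by move=> /andP[k0 kk']; rewrite ler_wsqrtr//; nra. Qed.

(** Distribution function at [x] of [radius k * cos t], for [t] uniform on [[0, pi]]. *)
Definition arccdf k x : R :=
  if `|x| < radius k then 1 / 2 + atan (x / Num.sqrt (1 / 4 - k ^+ 2 - x ^+ 2)) / pi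
  else if x < 0 then 0 else 1.

Lemma halfcircleE (A : set R) : measurable A -> U A = (pi^-1%:E * mu (A `&` `[0%R, pi]))%E.
Proof.
move=> mA; have := @integral_halfcircle R (EFin \o \1_A).
rewrite (integral_indic U)// setIT => ->; first by rewrite integral_indic.
  exact/measurable_EFinP.
by move=> x; rewrite lee_fin.
Qed.

Lemma measurable_coslevel k x : measurable [set t : R | radius k * cos t <= x].
Proof.
have -> : [set t : R | radius k * cos t <= x] = (fun t => radius k * cos t) @^-1` `]-oo, x].
  by apply/seteqP; split => t /=; rewrite in_itv.
rewrite -[X in measurable X]setTI.
have h : measurable_fun setT (fun t : R => radius k * cos t).
  by apply: measurable_funM => //; exact: measurable_cos.
exact: h.
Qed.

(** The event is the angle interval from [pi / 2 - atan (x / r)] to [pi], where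
    [r ^ 2 + x ^ 2 = radius k ^ 2]. *)
Lemma halfcircle_cos_le k x : 0 <= k < 1 / 2 ->
  U [set t | radius k * cos t <= x] = (arccdf k x)%:E.
Proof.
move=> k01; have R0 := radius_gt0 k01.
have mA := measurable_coslevel k x.
rewrite /arccdf; case: ifPn => [xR|].
  have x2 : x ^+ 2 < radius k ^+ 2.
    by rewrite -[x ^+ 2]real_normK ?num_real// ltrXn2r.
  set r := Num.sqrt _; have r0 : 0 < r by rewrite sqrtr_gt0; rewrite radius_sq// in x2; lra.
  have rE : r ^+ 2 + x ^+ 2 = radius k ^+ 2.
    by rewrite sqr_sqrtr ?radius_sq//; [ring|rewrite radius_sq// in x2; lra].
  pose t0 := pi / 2 - atan (x / r).
  have ct0 : radius k * cos t0 = x.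
    rewrite /t0 cosB cos_pihalf sin_pihalf mul0r add0r mul1r.
    have := atanK (x / r); rewrite /tan cos_atan => tanE.
    have s0 : 0 < Num.sqrt (1 + (x / r) ^+ 2).
      by rewrite sqrtr_gt0 ltr_pwDl// sqr_ge0.
    have sE : Num.sqrt (1 + (x / r) ^+ 2) = radius k / r.
      have -> : 1 + (x / r) ^+ 2 = (radius k / r) ^+ 2.
        by rewrite !expr_div_n -rE; field; rewrite gt_eqF.
      by rewrite sqrtr_sqr ger0_norm// divr_ge0// ltW.
    move: tanE; rewrite sE invrK => /(canRL (mulfK _)) ->; last first.
      by rewrite gt_eqF// divr_gt0.
    by field; rewrite !gt_eqF.
  have t00 : 0 < t0 by rewrite subr_gt0 atan_ltpi2.
  have t0p : t0 < pi.
    have := atan_gtNpi2 (x / r); rewrite /t0; have := @pi_gt0 R; lra.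
  have AE : [set t : R | radius k * cos t <= x] `&` `[0, pi] = `[t0, pi]%classic.
    apply/seteqP; split => t /=; rewrite !in_itv/=.
      move=> [h /andP[h0 h1]]; rewrite h1 andbT leNgt; apply/negP => tt0.
      have : cos t0 < cos t by rewrite ltr_cos ?in_itv/= ?h0 ?h1// !ltW.
      by rewrite -(ltr_pM2l R0) ct0 ltNge h.
    move=> /andP[h0 h1]; have h2 : 0 <= t by rewrite (le_trans _ h0)// ltW.
    split; last by rewrite h2.
    rewrite -ct0 ler_pM2l// leNgt; apply/negP.
    by rewrite ltr_cos ?in_itv/= ?h1 ?h2 ?(ltW t00) ?(ltW t0p)// ltNge h0.
  rewrite halfcircleE// AE lebesgue_measure_itv/= lte_fin t0p -EFinB -EFinM.
  congr EFin; rewrite /t0; have := @pi_gt0 R.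
  by move: (@pi R) => p p0; field; rewrite gt_eqF.
rewrite -leNgt => Rx; case: ifPn => [x0|].
  rewrite ltr0_norm// in Rx.
  rewrite halfcircleE//.
  have AE : [set t : R | radius k * cos t <= x] `&` `[0, pi] `<=` [set pi].
    move=> t /= [h]; rewrite in_itv/= => /andP[h0 h1].
    have : radius k * cos t <= radius k * (- 1) by lra.
    rewrite ler_pM2l// => h2; apply: cos_inj; rewrite ?in_itv/= ?h0 ?h1 ?pi_ge0 ?lexx//.
    by rewrite cospi; apply/le_anti; rewrite h2 cos_geN1.
  rewrite [X in (_ * X)%E](_ : _ = 0%E) ?mule0//.
  apply/eqP; rewrite eq_le measure_ge0 andbT -(lebesgue_measure_set1 (@pi R)).
  by apply: le_measure; rewrite ?inE//; exact: measurableI.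
rewrite -leNgt => x0; rewrite ger0_norm// in Rx.
have -> : [set t : R | radius k * cos t <= x] = setT.
  apply/seteqP; split => // t _ /=; apply: le_trans Rx.
  by rewrite -[leRHS]mulr1 ler_pM2l// cos_le1.
exact: (probability_setT U).
Qed.

Lemma arccdf_itv k x : 0 <= k < 1 / 2 -> 0 <= arccdf k x <= 1.
Proof.
move=> k01; rewrite -!lee_fin -halfcircle_cos_le// measure_ge0/=.
by apply: probability_le1; exact: measurable_coslevel.
Qed.

Lemma arccdf_mono k x y : 0 <= k < 1 / 2 -> x <= y -> arccdf k x <= arccdf k y.
Proof.
move=> k01 xy; rewrite -lee_fin -!halfcircle_cos_le//; apply: le_measure; rewrite ?inE;
  try exact: measurable_coslevel.
by move=> t /= /le_trans; exact.
Qed.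

Lemma arccdf_low k x : x <= - radius k -> x < 0 -> arccdf k x = 0.
Proof. by move=> xR x0; rewrite /arccdf ltr0_norm// ltrNl ltNge xR/= x0. Qed.

Lemma arccdf_high k x : radius k <= x -> arccdf k x = 1.
Proof.
move=> xR; have x0 : 0 <= x by apply: le_trans xR; exact: sqrtr_ge0.
by rewrite /arccdf ger0_norm// ltNge xR/= ltNge x0.
Qed.

Section closed_form.
Variable x : R.
Hypothesis x12 : `|x| <= 1 / 2.

(** The value of [k] at which [radius k] drops to [`|x|]. *)
Let b := radius x.

Lemma radius_norm_ge0 : 0 <= 1 / 4 - x ^+ 2.
Proof. by have := x12; rewrite ler_norml => /andP[h1 h2]; nra. Qed.

Lemma lt_radius_radius k : 0 <= k < 1 / 2 -> (`|x| < radius k) = (k < b).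
Proof.
move=> k01; have /andP[k0 k1] := k01.
rewrite -(@ltr_pXn2r _ 2)// ?nnegrE ?sqrtr_ge0// real_normK ?num_real// radius_sq//.
rewrite -[RHS](@ltr_pXn2r _ 2)// ?nnegrE ?sqrtr_ge0// sqr_sqrtr ?radius_norm_ge0//.
by apply/idP/idP => h; lra.
Qed.

Let r k : R := Num.sqrt (1 / 4 - k ^+ 2 - x ^+ 2).

Let b2 : b ^+ 2 = 1 / 4 - x ^+ 2.
Proof. by rewrite sqr_sqrtr// radius_norm_ge0. Qed.

Let rad_gt0 k : 0 <= k < b -> 0 < 1 / 4 - k ^+ 2 - x ^+ 2.
Proof.
move=> /andP[k0 kb]; have : k ^+ 2 < b ^+ 2 by rewrite ltrXn2r ?nnegrE// sqrtr_ge0.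
by rewrite b2; lra.
Qed.

Let r_gt0 k : 0 <= k < b -> 0 < r k.
Proof. by move=> kb; rewrite sqrtr_gt0 rad_gt0. Qed.

Let r2 k : 0 <= k < b -> r k ^+ 2 = 1 / 4 - k ^+ 2 - x ^+ 2.
Proof. by move=> kb; rewrite sqr_sqrtr// ltW// rad_gt0. Qed.

(** A primitive in [k] of the arcsine distribution function at [x], for [k] below
    [radius x]. *)
Definition arcprim k : R :=
  k / 2 + (x * atan (k / r k) - 1 / 2 * atan (2 * x * k / r k) + k * atan (x / r k)) / pi.

Lemma is_derive_r k : 0 <= k < b -> is_derive k 1 r (- k / r k).
Proof.
move=> kb; have h0 := rad_gt0 kb.
have d1 : is_derive k (1:R) (fun k => 1 / 4 - k ^+ 2 - x ^+ 2) (- (2 * k)).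
  have -> : (fun k => 1 / 4 - k ^+ 2 - x ^+ 2) = cst (1 / 4 - x ^+ 2) - (id * id) :> (R -> R).
    by apply/funext => z; rewrite /= !fctE; ring.
  by apply: is_derive_eq; rewrite /GRing.scale/=; ring.
have d2 := is_derive1_sqrt h0.
have d3 : is_derive k (1:R) (Num.sqrt \o (fun k => 1 / 4 - k ^+ 2 - x ^+ 2))
    ((2 * r k)^-1 * (- (2 * k))).
  exact: (@is_derive1_comp _ Num.sqrt (fun k => 1 / 4 - k ^+ 2 - x ^+ 2)).
apply: is_derive_eq.
by have := r_gt0 kb; move=> ?; field; rewrite gt_eqF.
Qed.

(** The derivatives of the three arctangents cancel, which leaves the derivatives of
    the factors [k]. *)
Lemma is_derive_arcprim k : 0 <= k < b ->
  is_derive k 1 arcprim (1 / 2 + atan (x / r k) / pi).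
Proof.
move=> kb; have h0 := r_gt0 kb; have hne : r k != 0 by rewrite gt_eqF.
have dr := is_derive_r kb.
have dV : is_derive k (1:R) (fun z => (r z)^-1) (k / r k ^+ 3).
  have h := @is_deriveV _ r k _ 1 hne dr.
  apply: (@is_derive_eq _ _ _ _ _ _ _ _ h); rewrite /GRing.scale/=; field.
  by rewrite hne.
have datan (g : R -> R) dg : is_derive k (1:R) g dg ->
    is_derive k (1:R) (fun z => atan (g z)) ((1 + g k ^+ 2)^-1 * dg).
  by move=> hg; exact: (@is_derive1_comp _ (@atan R) g).
have d1 : is_derive k (1:R) (fun z => z / r z) ((1 / 4 - x ^+ 2) / r k ^+ 3).
  have -> : (fun z => z / r z) = id * (fun z => (r z)^-1) by [].
  apply: is_derive_eq; rewrite /GRing.scale/=.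
  have -> : 1 / 4 - x ^+ 2 = r k ^+ 2 + k ^+ 2 by rewrite r2//; ring.
  by field; rewrite hne.
have d2 : is_derive k (1:R) (fun z => 2 * x * z / r z) (2 * x * ((1 / 4 - x ^+ 2) / r k ^+ 3)).
  have -> : (fun z => 2 * x * z / r z) = (2 * x) *: (fun z => z / r z).
    by apply/funext => z; rewrite scalrfctE/= /GRing.scale/= mulrA.
  by apply: is_derive_eq.
have d3 : is_derive k (1:R) (fun z => x / r z) (x * (k / r k ^+ 3)).
  exact: (is_deriveZ x dV).
have e1 := datan _ _ d1; have e2 := datan _ _ d2; have e3 := datan _ _ d3.
have -> : arcprim = (2^-1 *: id + pi^-1 *: (x *: (fun z => atan (z / r z))
   - 2^-1 *: (fun z => atan (2 * x * z / r z)) + id * (fun z => atan (x / r z)))) :> (R -> R).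
  by apply/funext => z; rewrite /arcprim !(addrfctE,opprfctE,mulrfctE,scalrfctE)/= /GRing.scale/=; ring.
have e0 := is_derive_id k (1:R).
have hd := is_deriveD (is_deriveZ 2^-1 e0) (is_deriveZ pi^-1
  (is_deriveD (is_deriveB (is_deriveZ x e1) (is_deriveZ 2^-1 e2)) (is_deriveM e0 e3))).
apply: is_derive_eq hd _.
rewrite /GRing.scale/=.
have E : r k ^+ 2 + k ^+ 2 + x ^+ 2 = 1 / 4 by rewrite r2//; ring.
move: (atan (x / r k)) => A.
have pi0 : (pi : R) != 0 by rewrite gt_eqF// pi_gt0.
set rk := r k in hne h0 E *.
have n1 : 1 / 4 - x ^+ 2 != 0 by rewrite gt_eqF//; nra.
have n2 : rk ^+ 2 + x ^+ 2 != 0 by rewrite gt_eqF//; nra.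
have q1 : (1 + (k / rk) ^+ 2)^-1 = rk ^+ 2 / (1 / 4 - x ^+ 2).
  have -> : 1 + (k / rk) ^+ 2 = (1 / 4 - x ^+ 2) / rk ^+ 2.
    have -> : 1 / 4 - x ^+ 2 = rk ^+ 2 + k ^+ 2 by rewrite -E; ring.
    by field; rewrite hne.
  by rewrite invf_div.
have q3 : (1 + (x / rk) ^+ 2)^-1 = rk ^+ 2 / (rk ^+ 2 + x ^+ 2).
  have -> : 1 + (x / rk) ^+ 2 = (rk ^+ 2 + x ^+ 2) / rk ^+ 2.
    by field; rewrite hne.
  by rewrite invf_div.
have q2 : (1 + (2 * x * k / rk) ^+ 2)^-1 =
    rk ^+ 2 / (4 * (rk ^+ 2 + x ^+ 2) * (1 / 4 - x ^+ 2)).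
  have -> : 1 + (2 * x * k / rk) ^+ 2 =
      4 * (rk ^+ 2 + x ^+ 2) * (1 / 4 - x ^+ 2) / rk ^+ 2.
    have -> : 4 * (rk ^+ 2 + x ^+ 2) * (1 / 4 - x ^+ 2) = rk ^+ 2 + (2 * x * k) ^+ 2.
      have -> : rk ^+ 2 = 1 / 4 - k ^+ 2 - x ^+ 2 by rewrite -E; ring.
      by field.
    by field; rewrite hne.
  by rewrite invf_div.
rewrite q1 q2 q3.
have -> : 1 / 4 - x ^+ 2 = rk ^+ 2 + k ^+ 2 by rewrite -E; ring.
have n3 : rk ^+ 2 + k ^+ 2 != 0.
  by have -> : rk ^+ 2 + k ^+ 2 = 1 / 4 - x ^+ 2 by rewrite -E; ring.
transitivity (1 / 2 + (A + x * (rk ^+ 2 + k ^+ 2 + x ^+ 2 - 1 / 4) /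
    (rk * (rk ^+ 2 + x ^+ 2))) / pi).
  move: (@pi R) pi0 => p p0; field.
  by rewrite p0 n2 n3 hne.
by rewrite E subrr mulr0 mul0r addr0.
Qed.

Hypothesis x0 : x != 0.

(** The limit of [arcprim] as [k] tends to [b], where the first arctangent
    tends to [pi / 2] and the two others to [pi / 2] or [- pi / 2] with the sign of [x]. *)
Definition arcend : R := if x < 0 then x / 2 + 1 / 4 else b + x / 2 - 1 / 4.

Lemma b_lt12 : b < 1 / 2.
Proof.
rewrite -(@ltr_pXn2r _ 2)// ?nnegrE ?sqrtr_ge0// b2.
have : 0 < x ^+ 2 by rewrite exprn_even_gt0.
lra.
Qed.

Lemma atan_div_cvg (g : R -> R) (l : R) : 0 < b -> 0 < l ->
  g k @[k --> b^'-] --> l -> atan (g k / r k) @[k --> b^'-] --> pi / 2.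
Proof.
move=> b0 l0 gl.
suff h : g k / r k @[k --> b^'-] --> +oo by exact: (cvg_comp _ _ h (@cvgy_atan R)).
have rc : r k @[k --> b^'-] --> (0 : R).
  have -> : (0 : R) = Num.sqrt (1 / 4 - b ^+ 2 - x ^+ 2).
    by rewrite b2 -[LHS]sqrtr0; congr Num.sqrt; ring.
  apply: cvg_at_left_filter.
  have h : (1 / 4 - k ^+ 2 - x ^+ 2) @[k --> b] --> 1 / 4 - b ^+ 2 - x ^+ 2.
    apply: cvgB; last exact: cvg_cst.
    by apply: cvgB; [exact: cvg_cst|exact: exprn_continuous].
  exact: (cvg_comp _ _ h (@sqrt_continuous R _)).
apply/cvgryPgt => A.
have A0 : 0 < `|A| + 1 by rewrite ltr_wpDl.
have h1 : \forall k \near b^'-, r k < l / 2 / (`|A| + 1).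
  by apply: (cvgr_lt _ rc); rewrite !divr_gt0.
have h2 : \forall k \near b^'-, l / 2 < g k.
  by apply: (cvgr_gt _ gl); lra.
near=> k.
have k0 : 0 < k by near: k; exact: nbhs_left_gt.
have kb : k < b by near: k; exact: nbhs_left_lt.
have r0 : 0 < r k by apply: r_gt0; rewrite kb ltW.
rewrite ltr_pdivlMr//.
have u1 : r k < l / 2 / (`|A| + 1) by near: k.
have u2 : l / 2 < g k by near: k.
rewrite ltr_pdivlMr// in u1.
have u3 : A * r k <= `|A| * r k := ler_wpM2r (ltW r0) (ler_norm A).
have : r k * (`|A| + 1) = `|A| * r k + r k by ring.
lra.
Unshelve. all: by end_near. Qed.

Lemma atan_div_cvgN (g : R -> R) (l : R) : 0 < b -> l < 0 ->
  g k @[k --> b^'-] --> l -> atan (g k / r k) @[k --> b^'-] --> - (pi / 2).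
Proof.
move=> b0 l0 gl.
have h : atan (- g k / r k) @[k --> b^'-] --> pi / 2.
  by apply: (@atan_div_cvg _ (- l)); rewrite ?oppr_gt0//; exact: cvgN.
have -> : (fun k => atan (g k / r k)) = (fun k => - atan (- g k / r k)).
  by apply/funext => k; rewrite mulNr atanN opprK.
exact: cvgN.
Qed.

Lemma arcprim_cvg : 0 < b -> arcprim k @[k --> b^'-] --> arcend.
Proof.
move=> b0.
have pi0 : (pi : R) != 0 by rewrite gt_eqF// pi_gt0.
have ck : k @[k --> b^'-] --> b by apply: cvg_at_left_filter; exact: cvg_id.
have c1 := atan_div_cvg b0 b0 ck.
have c2xk : 2 * x * k @[k --> b^'-] --> 2 * x * b by apply: cvgM; [exact: cvg_cst|exact: ck].
have cx : x @[k --> b^'-] --> x by exact: cvg_cst.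
have fin (s : R) :
  atan (2 * x * k / r k) @[k --> b^'-] --> s * (pi / 2) ->
  atan (x / r k) @[k --> b^'-] --> s * (pi / 2) ->
  arcprim k @[k --> b^'-] --> b / 2 + (x * (pi / 2) - 1 / 2 * (s * (pi / 2)) + b * (s * (pi / 2))) / pi.
  move=> h1 h2; apply: cvgD; first by apply: cvgM; [exact: ck|exact: cvg_cst].
  apply: cvgM; last exact: cvg_cst.
  apply: cvgD; last by apply: cvgM.
  by apply: cvgB; apply: cvgM => //; exact: cvg_cst.
rewrite /arcend; case: ltP => xs.
  have -> : x / 2 + 1 / 4 = b / 2 + (x * (pi / 2) - 1 / 2 * (-1 * (pi / 2)) + b * (-1 * (pi / 2))) / pi.
    by move: (@pi R) pi0 => p p0; field.
  apply: fin; rewrite mulN1r.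
    by apply: (atan_div_cvgN b0 _ c2xk); nra.
  exact: (atan_div_cvgN b0 xs cx).
have {}xs : 0 < x by rewrite lt_neqAle eq_sym x0.
have -> : b + x / 2 - 1 / 4 = b / 2 + (x * (pi / 2) - 1 / 2 * (1 * (pi / 2)) + b * (1 * (pi / 2))) / pi.
  by move: (@pi R) pi0 => p p0; field.
apply: fin; rewrite mul1r.
  by apply: (atan_div_cvg b0 _ c2xk); rewrite !mulr_gt0.
exact: (atan_div_cvg b0 xs cx).
Qed.

Lemma arccdf_in k : 0 <= k < b -> arccdf k x = 1 / 2 + atan (x / r k) / pi.
Proof.
move=> /andP[k0 kb]; rewrite /arccdf lt_radius_radius ?kb// k0/=.
by apply: lt_le_trans kb _; exact: radius_le.
Qed.

Let r_cont k : 0 <= k < b -> {for k, continuous (fun k => 1 / 2 + atan (x / r k) / pi)}.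
Proof.
move=> kb; have [dr _] := is_derive_r kb.
have rc : {for k, continuous r} by exact/differentiable_continuous/derivable1_diffP.
apply: cvgD; first exact: cvg_cst.
apply: cvgM; last exact: cvg_cst.
have h : x / r z @[z --> k] --> x / r k.
  apply: cvgM; first exact: cvg_cst.
  by apply: cvgV => //; rewrite gt_eqF// r_gt0.
exact: (cvg_comp _ _ h (@continuous_atan R _)).
Qed.

Let r_ge0 k : 0 <= k < b -> 0 <= 1 / 2 + atan (x / r k) / pi.
Proof.
move=> _; have h := atan_gtNpi2 (x / r k); have p0 := @pi_gt0 R.
have : - (1 / 2) <= atan (x / r k) / pi by rewrite (ler_pdivlMr _ _ p0); lra.
lra.
Qed.

Let arcprim0 : arcprim 0 = 0.
Proof. by rewrite /arcprim mulr0 !mul0r atan0; ring. Qed.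

Let arcprim_cont k : 0 <= k < b -> {for k, continuous arcprim}.
Proof.
move=> kb; have [dr _] := is_derive_arcprim kb.
exact/differentiable_continuous/derivable1_diffP.
Qed.

Lemma integral_arccdf_in c : 0 <= c < b ->
  (\int[mu]_(k in `[0%R, c]) (arccdf k x)%:E = (arcprim c)%:E)%E.
Proof.
move=> /andP[]; rewrite le_eqVlt => /predU1P[<- _|c0 cb].
  by rewrite set_itv1 integral_set1 arcprim0.
have b0 : 0 < b by exact: lt_trans cb.
transitivity (\int[mu]_(k in `[0%R, c]) (1 / 2 + atan (x / r k) / pi)%:E)%E.
  apply: eq_integral => k; rewrite inE/= in_itv/= => /andP[k0 kc].
  by rewrite arccdf_in// k0 (le_lt_trans kc).
rewrite (ge0_FTC2_singular (f := fun k => 1 / 2 + atan (x / r k) / pi) (F := arcprim) c0).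
- by rewrite arcprim0 subr0.
- by apply: cvg_at_right_filter; apply: arcprim_cont; rewrite lexx.
- by apply: cvg_at_left_filter; apply: arcprim_cont; rewrite ltW.
- move=> k /andP[k0 kc]; have kb : 0 <= k < b by rewrite (lt_trans kc)// ltW.
  by split; [exact: r_cont|exact: is_derive_arcprim|exact: r_ge0].
Qed.

Lemma integral_arccdf_end :
  (\int[mu]_(k in `[0%R, b]) (arccdf k x)%:E = arcend%:E)%E.
Proof.
have := sqrtr_ge0 (1 / 4 - x ^+ 2); rewrite -/(radius x) -/b le_eqVlt => /predU1P[bE|b0].
  rewrite -bE set_itv1 integral_set1 /arcend -bE.
  have := b2; rewrite -bE expr0n/= => x2.
  have E : (x - 1 / 2) * (x + 1 / 2) = x ^+ 2 - 1 / 4 by field.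
  have : (x - 1 / 2) * (x + 1 / 2) = 0 by rewrite E; lra.
  move=> /eqP; rewrite mulf_eq0 => /orP[] /eqP h; case: ltP => xs; congr EFin; lra.
pose F k := if k < b then arcprim k else arcend.
have Fb : F b = arcend by rewrite /F ltxx.
have F0 : F 0 = 0 by rewrite /F b0 arcprim0.
transitivity (\int[mu]_(k in `[0%R, b]) (1 / 2 + atan (x / r k) / pi)%:E)%E.
  apply: (@integral_null_congr _ (measurableTypeR R) R mu _ [set b]) => //; first exact: lebesgue_measure_set1.
  move=> k /=; rewrite in_itv/= => /andP[k0 kb] /eqP kb'.
  by rewrite arccdf_in// k0 lt_neqAle kb kb'.
rewrite (ge0_FTC2_singular (f := fun k => 1 / 2 + atan (x / r k) / pi) (F := F) b0).
- by rewrite Fb F0 subr0.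
- have h : arcprim k @[k --> 0^'+] --> arcprim 0.
    by apply: cvg_at_right_filter; apply: arcprim_cont; rewrite lexx.
  rewrite arcprim0 in h; rewrite F0.
  apply: cvg_trans h; apply: near_eq_cvg; near=> z; have zb : z < b by near: z; exact: nbhs_right_lt.
  by rewrite /F zb.
- rewrite Fb; apply: cvg_trans (arcprim_cvg b0); apply: near_eq_cvg; near=> z.
  have zb : z < b by near: z; exact: nbhs_left_lt.
  by rewrite /F zb.
- move=> k /andP[k0 kb]; have kb' : 0 <= k < b by rewrite kb ltW.
  split; [exact: r_cont| |exact: r_ge0].
  apply: near_eq_is_derive (is_derive_arcprim kb').
  near=> z; have zb : z < b by near: z; exact: lt_nbhsl.
  by rewrite /F zb.
Unshelve. all: by end_near. Qed.
End closed_form.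
End arcsine_cdf.

(** * The candidate as a superposition of arcsine laws *)

Section profile.
Context {R : realType}.
Local Notation mu := (@lebesgue_measure R).
Local Notation U := (halfcircle R).
Implicit Types (c k x y : R).

(** The candidate minimizer in centred coordinates: [cprof c x] is its value at
    [1 / 2 + x], where [c = 1 / 2 - y]. *)
Definition cprof c x : R :=
  if `|x| < radius c then (x + 1 / 2) / 2 - arcprim x c
  else if x < 0 then 0 else 1 / 2 - c.

Lemma continuous_radius : continuous (@radius R).
Proof.
have cu : continuous (fun k : R => 1 / 4 - k ^+ 2).
  by move=> k; apply: cvgB; [exact: cvg_cst|exact: exprn_continuous].
exact: (continuous_compR cu (@sqrt_continuous R)).
Qed.

Lemma measurable_radius : measurable_fun setT (@radius R).
Proof. by apply: continuous_measurable_fun; exact: continuous_radius. Qed.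

Lemma measurable_arccdf x : measurable_fun setT (fun k => arccdf k x).
Proof.
have mr := measurable_radius.
pose r k : R := Num.sqrt (1 / 4 - k ^+ 2 - x ^+ 2).
have mr' : measurable_fun setT r.
  apply: continuous_measurable_fun => k; apply: continuous_compR (@sqrt_continuous R) _ => z.
  by apply: cvgB; [apply: cvgB; [exact: cvg_cst|exact: exprn_continuous]|exact: cvg_cst].
(* The inverse of a positive number is written with exp and ln, so that measurability
   follows from theirs. *)
have -> : (fun k => arccdf k x) = (fun k => if `|x| < radius k
    then 1 / 2 + atan (x * expR (- ln (r k))) / pi else if x < 0 then 0 else 1).
  apply/funext => k; rewrite /arccdf; case: ifPn => // xk.
  suff r0 : 0 < r k by rewrite -lnV ?posrE// lnK ?posrE ?invr_gt0.
  have rk : 0 < radius k by apply: le_lt_trans xk.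
  have : `|x| ^+ 2 < radius k ^+ 2 by rewrite ltr_pXn2r// nnegrE ltW.
  rewrite sqrtr_gt0 sqr_sqrtr; last by move: rk; rewrite sqrtr_gt0 => /ltW.
  by rewrite real_normK ?num_real//; lra.
apply: measurable_fun_ifT; [exact: measurable_fun_ltr| |exact: measurable_cst].
apply: measurable_funD => //; apply: measurable_funM => //.
apply: measurableT_comp.
  by apply: continuous_measurable_fun; exact: continuous_atan.
apply: measurable_funM => //; apply: measurableT_comp => //.
by apply: measurableT_comp => //; exact: measurable_lncomp.
Qed.

(** For [c] beyond [radius x] the point [x] lies outside the supports of the remaining
    arcsine laws, whose distribution functions are [0] or [1] there. *)
Lemma integral_arccdf c x : 0 <= c < 1 / 2 -> `|x| <= 1 / 2 ->
  (\int[mu]_(k in `[0%R, c]) (arccdf k x)%:E = ((x + 1 / 2) / 2 - cprof c x)%:E)%E.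
Proof.
move=> c01 x12; have /andP[c0 c1] := c01.
rewrite /cprof; case: ifPn => [xc|].
  rewrite integral_arccdf_in//; first by congr EFin; ring.
  by rewrite c0 -lt_radius_radius.
rewrite lt_radius_radius// -leNgt => bc.
have x0 : x != 0.
  apply/eqP => x0; move: bc; rewrite x0 /radius expr0n/= subr0.
  have -> : (1 / 4 : R) = (1 / 2) ^+ 2 by field.
  by rewrite sqrtr_sqr ger0_norm ?divr_ge0//; lra.
have bb := b_lt12 x12 x0.
have b0 : 0 <= radius x by exact: sqrtr_ge0.
have -> : `[0%R, c]%classic = `[0%R, radius x]%classic `|` `]radius x, c]%classic :> set R.
  by apply: itv_bndbnd_setU; rewrite bnd_simp.
have mf : measurable_fun setT (fun k => (arccdf k x)%:E).
  by apply/measurable_EFinP; exact: measurable_arccdf.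
rewrite ge0_integral_setU//=; last 3 first.
- exact: measurable_funTS.
- move=> k /=; rewrite !in_itv/= => h; rewrite lee_fin.
  have : 0 <= k < 1 / 2 by apply/andP; split; case: h => /andP[]; lra.
  by move=> /(arccdf_itv x)/andP[].
- apply/disj_setPS => s [] /=; rewrite !in_itv/= => /andP[_ h1] /andP[h2 _].
  by move: (lt_le_trans h2 h1); rewrite ltxx.
rewrite integral_arccdf_end//.
pose s : R := if x < 0 then 0 else 1.
transitivity ((arcend x)%:E + \int[mu]_(k in `]radius x, c]) (cst s%:E) k)%E.
  congr (_ + _)%E; apply: eq_integral => k; rewrite inE/= in_itv/= => /andP[h1 h2].
  have k01 : 0 <= k < 1 / 2 by rewrite ?(le_trans b0 (ltW h1))//; lra.
  by rewrite /arccdf lt_radius_radius// ltNge (ltW h1).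
rewrite integral_cst// [X in (_ + _ * X)%E](lebesgue_measure_itv `]radius x, c])/= lte_fin.
have -> : (if radius x < c then (c%:E - (radius x)%:E)%E else 0%E) = (c - radius x)%:E.
  by move: bc; rewrite le_eqVlt => /predU1P[->|->]; rewrite ?ltxx ?subrr// EFinB.
rewrite -EFinM -EFinD /arcend /s; case: ifP => xs; congr EFin; lra.
Qed.

Lemma cprof0 x : `|x| <= 1 / 2 -> cprof 0 x = (x + 1 / 2) / 2.
Proof.
move=> x12; have h : 0 <= (0 : R) < 1 / 2 by rewrite lexx/=.
have := integral_arccdf h x12; rewrite set_itv1 integral_set1 => -[]; lra.
Qed.

(** For [k] close to [1/2] the profile is constant near [x], so that it takes one of
    the values [0] and [1/2 - k]; at the centre it is the mean of the two. *)
Lemma cprof_near x : `|x| <= 1 / 2 -> exists2 c, c < 1 / 2 &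
  forall k, c <= k -> 0 <= k < 1 / 2 -> 0 <= cprof k x <= 1 / 2 - k.
Proof.
move=> x12; have [->|x0] := eqVneq x 0.
  exists 0 => // k _ k01; have /andP[k0 k1] := k01.
  rewrite /cprof normr0 radius_gt0//.
  by rewrite /arcprim !(mulr0, mul0r, atan0, subrr, addr0); apply/andP; split; lra.
exists (radius x); first exact: b_lt12.
move=> k ck k01; have /andP[k0 k1] := k01.
rewrite /cprof lt_radius_radius// ltNge ck/=.
by case: ifP => _; apply/andP; split; lra.
Qed.

Lemma integral_arccdf_mono c x x' : 0 <= c < 1 / 2 -> `|x| <= 1 / 2 -> `|x'| <= 1 / 2 ->
  x <= x' -> (x + 1 / 2) / 2 - cprof c x <= (x' + 1 / 2) / 2 - cprof c x'.
Proof.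
move=> c01 x12 x12' xx'; rewrite -lee_fin -!integral_arccdf//.
have Ik k : `[0%R, c]%classic k -> 0 <= k < 1 / 2.
  by rewrite /= in_itv/= => /andP[-> h]; rewrite (le_lt_trans h)//; case/andP: c01.
apply: ge0_le_integral => //.
- by move=> k /Ik /(arccdf_itv x)/andP[h _]; rewrite lee_fin.
- by apply/measurable_EFinP; apply: measurable_funTS; exact: measurable_arccdf.
- by apply/measurable_EFinP; apply: measurable_funTS; exact: measurable_arccdf.
- by move=> k /Ik k01; rewrite lee_fin arccdf_mono.
Qed.

(** Increasing [c] adds nondecreasing distribution functions to [x / 2 - cprof c x]. *)
Lemma cprof_increment_dec c c' x x' : 0 <= c <= c' -> c' < 1 / 2 ->
  `|x| <= 1 / 2 -> `|x'| <= 1 / 2 -> x <= x' ->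
  cprof c' x' - cprof c' x <= cprof c x' - cprof c x.
Proof.
move=> /andP[c0 cc'] c1 x12 x12' xx'.
have mf z : measurable_fun setT (fun k => (arccdf k z)%:E).
  by apply/measurable_EFinP; exact: measurable_arccdf.
have k01 k : 0 <= k <= c' -> 0 <= k < 1 / 2.
  by move=> /andP[-> h]; rewrite (le_lt_trans h).
have split z : `|z| <= 1 / 2 -> exists2 w : R,
    (\int[mu]_(k in `]c, c']) (arccdf k z)%:E = w%:E)%E &
    cprof c z - cprof c' z = w.
  move=> z12.
  have h : (\int[mu]_(k in `[0%R, c']) (arccdf k z)%:E =
    \int[mu]_(k in `[0%R, c]) (arccdf k z)%:E + \int[mu]_(k in `]c, c']) (arccdf k z)%:E)%E.
    have -> : `[0%R, c']%classic = `[0%R, c]%classic `|` `]c, c']%classic :> set R.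
      by apply: itv_bndbnd_setU; rewrite bnd_simp.
    rewrite ge0_integral_setU//=.
    - by apply: measurable_funTS; exact: mf.
    - move=> k /=; rewrite !in_itv/= => hk; rewrite lee_fin.
      have /k01 /(arccdf_itv z)/andP[] // : 0 <= k <= c'.
      by apply/andP; split; case: hk => /andP[]; lra.
    - apply/disj_setPS => s [] /=; rewrite !in_itv/= => /andP[_ h1] /andP[h2 _].
      by move: (lt_le_trans h2 h1); rewrite ltxx.
  rewrite !integral_arccdf// in h; last 2 first.
  - by rewrite c0 (le_lt_trans cc').
  - by rewrite (le_trans c0 cc').
  exists (cprof c z - cprof c' z) => //.
  move: h; case: (\int[mu]_(_ in `]c, c']) _)%E => [w| |]// [h].
  by congr EFin; lra.
have [w wE wd] := split _ x12; have [w' wE' wd'] := split _ x12'.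
suff : w <= w' by lra.
rewrite -lee_fin -wE -wE'.
have Ik k : `]c, c']%classic k -> 0 <= k < 1 / 2.
  by rewrite /= in_itv/= => /andP[h1 h2]; apply: k01; rewrite h2 andbT ltW// (le_lt_trans c0).
apply: ge0_le_integral => //.
- by move=> k /Ik /(arccdf_itv x)/andP[h _]; rewrite lee_fin.
- by apply: measurable_funTS; exact: mf.
- by apply: measurable_funTS; exact: mf.
- by move=> k /Ik k01'; rewrite lee_fin arccdf_mono.
Qed.

(** The increments of [cprof] decrease with [c] and are bounded below by [- (1 / 2 - c')]
    for [c'] close to [1 / 2], by [cprof_near]; hence they are nonnegative. *)
Lemma cprof_mono c x x' : 0 <= c < 1 / 2 -> `|x| <= 1 / 2 -> `|x'| <= 1 / 2 ->
  x <= x' -> cprof c x <= cprof c x'.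
Proof.
move=> /andP[c0 c1] x12 x12' xx'; rewrite -subr_ge0.
have [d d1 dE] := cprof_near x12; have [d' d1' dE'] := cprof_near x12'.
apply/ler_addgt0Pr => e e0.
pose k := Num.max (Num.max c (1 / 2 - e)) (Num.max d d').
have k1 : k < 1 / 2 by rewrite /k !gt_max c1 d1 d1' !andbT/=; lra.
have [kc ke kd kd'] : [/\ c <= k, 1 / 2 - e <= k, d <= k & d' <= k].
  by rewrite /k !le_max !lexx !orbT.
have k01 : 0 <= k < 1 / 2 by rewrite k1 (le_trans c0 kc).
have /andP[h1 h2] := dE k kd k01; have /andP[h1' h2'] := dE' k kd' k01.
have := @cprof_increment_dec c k x x'; rewrite c0 kc => /(_ erefl k1 x12 x12' xx').
lra.
Qed.

(** The primitive of [1 / 2 - f'] for the candidate [f], extended to the real line. *)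
Definition defect c (s : R) : R := clamp01 s / 2 - cprof c (clamp01 s - 1 / 2).

Let cl12 (s : R) : `|clamp01 s - 1 / 2| <= 1 / 2.
Proof. by have /andP[h1 h2] := clamp01_itv s; rewrite ler_norml; apply/andP; split; lra. Qed.

Lemma clamp01_lt0 (s : R) : s < 0 -> clamp01 s = 0.
Proof.
by move=> s0; rewrite /clamp01 min_r ?max_l ?(ltW s0)//; apply: ltW; apply: lt_trans s0 _.
Qed.

Lemma clamp01_gt1 (s : R) : 1 < s -> clamp01 s = 1.
Proof. by move=> s1; rewrite /clamp01 min_l ?max_r ?(ltW s1). Qed.

Lemma clamp01_sub1lip : sub1lip (@clamp01 R).
Proof.
move=> s t st.
have [s0|s0] := ltP s 0; last have [s1|s1] := leP s 1.
- rewrite (clamp01_lt0 s0); have [t0|t0] := ltP t 0; last have [t1|t1] := leP t 1.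
  + by rewrite clamp01_lt0// subrr lexx subr_ge0.
  + by rewrite clamp01_id ?t0//; apply/andP; split; lra.
  + by rewrite clamp01_gt1//; apply/andP; split; lra.
- rewrite (@clamp01_id _ s) ?s0//; have [t1|t1] := leP t 1.
  + by rewrite clamp01_id ?t1 ?(le_trans s0 st)//; apply/andP; split; lra.
  + by rewrite clamp01_gt1//; apply/andP; split; lra.
- rewrite !clamp01_gt1// ?subrr ?lexx ?subr_ge0//.
  exact: lt_le_trans st.
Qed.

Lemma defect_sub1lip c : 0 <= c < 1 / 2 -> sub1lip (defect c).
Proof.
move=> c01 s t st; have /andP[h h'] := clamp01_sub1lip st.
have hh : clamp01 s - 1 / 2 <= clamp01 t - 1 / 2 by lra.
have h1 := integral_arccdf_mono c01 (cl12 s) (cl12 t) hh.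
have h2 := cprof_mono c01 (cl12 s) (cl12 t) hh.
by rewrite /defect; apply/andP; split; lra.
Qed.

Lemma arccdf_clamp k (s : R) : 0 <= k < 1 / 2 -> arccdf k (s - 1 / 2) = arccdf k (clamp01 s - 1 / 2).
Proof.
move=> k01; have rk := radius_le k; have r0 := radius_gt0 k01.
have [s0|s0] := ltP s 0; first by rewrite clamp01_lt0// !arccdf_low//; lra.
have [s1|s1] := leP s 1; first by rewrite clamp01_id// s0.
by rewrite clamp01_gt1// !arccdf_high//; lra.
Qed.

Lemma integral_arccdf_defect c (s : R) : 0 <= c < 1 / 2 ->
  (\int[mu]_(k in `[0%R, c]) (arccdf k (s - 1 / 2))%:E = (defect c s)%:E)%E.
Proof.
move=> c01; transitivity (\int[mu]_(k in `[0%R, c]) (arccdf k (clamp01 s - 1 / 2))%:E)%E.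
  apply: eq_integral => k; rewrite inE/= in_itv/= => /andP[k0 kc].
  by rewrite arccdf_clamp// k0 (le_lt_trans kc)//; case/andP: c01.
by rewrite integral_arccdf// /defect; congr EFin; lra.
Qed.

(** The measure with distribution function [defect c] is the mixture of the arcsine laws
    of radius [radius k] around [1 / 2], with [k] uniform on the interval from [0] to
    [c], of total mass [c]. *)
Section superposition.
Variable c : R.
Hypothesis c0 : 0 < c.
Hypothesis c12 : c < 1 / 2.
Local Notation T := (measurableTypeR R).

Let Uc : probability T R := uniform_prob c0.
Let base : probability (T * T)%type R := (Uc \x U)%E.
Let psi (z : T * T) : T := 1 / 2 + radius z.1 * cos z.2.

Let mpsi : measurable_fun setT psi.
Proof.
apply: measurable_funD => //; apply: measurable_funM.
  by apply: (measurableT_comp measurable_radius); exact: measurable_fst.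
by apply: (measurableT_comp measurable_cos); exact: measurable_snd.
Qed.

Let X : {mfun (T * T)%type >-> T} := HB.pack psi (isMeasurableFun.Build _ _ _ _ psi mpsi).
Let nu1 : {measure set T -> \bar R} := distribution base X.
Let nu : {measure set T -> \bar R} := mscale (NngNum (ltW c0)) nu1.

Let integral_nu (f : R -> \bar R) : measurable_fun setT f -> (forall s, 0 <= f s)%E ->
  (\int[nu]_s f s =
   \int[mu]_(k in `[0%R, c]) \int[U]_t f (1 / 2 + radius k * cos t)%R)%E.
Proof.
move=> mf f0; rewrite ge0_integral_mscale//= ge0_integral_distribution//.
have mfp : measurable_fun setT (f \o psi) by exact: measurableT_comp.
rewrite fubini_tonelli1//=.
rewrite integral_uniform; last 2 first.
- by apply: measurable_fun_fubini_tonelli_F => // z; exact: f0.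
- by move=> k; apply: integral_ge0 => t _; exact: f0.
by rewrite subr0 muleA -EFinM mulfV ?gt_eqF// mul1e.
Qed.

Let nu_cdf (s : R) : nu `]-oo, s]%classic = (defect c s)%:E.
Proof.
have mI : measurable (`]-oo, s]%classic : set T) by exact: measurable_itv.
rewrite -[X in nu X]setIT -[LHS](@integral_indic _ _ _ nu)//.
rewrite (integral_nu (f := EFin \o \1_(`]-oo, s]%classic : set R))); last 2 first.
- exact/measurable_EFinP.
- by move=> x; rewrite lee_fin.
rewrite -integral_arccdf_defect; last by rewrite c12 ltW.
apply: eq_integral => k; rewrite inE/= in_itv/= => /andP[k0 kc].
rewrite -halfcircle_cos_le; last by rewrite k0 (le_lt_trans kc).
rewrite -[X in U X]setIT -[RHS](@integral_indic _ _ _ U)//; last exact: measurable_coslevel.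
apply: eq_integral => t _; rewrite /= !indicE; congr ((nat_of_bool _)%:R%:E).
apply/idP/idP; rewrite !inE/= in_itv/=; lra.
Qed.

(** The density of the mixture integrates functions like the mixture does. *)
Lemma arc_superposition : exists g : R -> R, [/\ measurable_fun setT g,
  forall s, 0 <= g s <= 1,
  forall a b : R, a <= b -> (\int[mu]_(s in `]a, b]) (g s)%:E = (defect c b - defect c a)%:E)%E,
  {ae mu, forall s, is_derive (s : R) (1 : R) (defect c) (g s)} &
  forall f : R -> \bar R, measurable_fun setT f -> (forall s, 0 <= f s)%E ->
    (\int[mu]_(s in `[0%R, 1%R]) (f s * (g s)%:E) =
     \int[mu]_(k in `[0%R, c]) \int[U]_t f (1 / 2 + radius k * cos t)%R)%E].
Proof.
have c01 : 0 <= c < 1 / 2 by rewrite c12 ltW.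
have nuoo : (nu setT < +oo)%E.
  by rewrite /= /mscale/= probability_setT mule1 ltry.
have nuab (a b : R) : a <= b -> nu `]a, b]%classic = (defect c b - defect c a)%:E.
  move=> ab.
  have h : (nu `]-oo, b]%classic = nu `]-oo, a]%classic + nu `]a, b]%classic)%E.
    rewrite -(measureU nu (measurable_itv `]-oo, a]) (measurable_itv `]a, b])).
    - by congr (nu _); apply: itv_bndbnd_setU; rewrite bnd_simp.
    - apply/seteqP; split => // s [] /=; rewrite !in_itv/= => h1 /andP[h2 _].
      by move: (lt_le_trans h2 h1); rewrite ltxx.
  move: h; rewrite !nu_cdf; case: (nu `]a, b]%classic) => [w| |]// [h].
  by congr EFin; lra.
have [g [mg g01 gab gd gI]] := sub1lip_density (defect_sub1lip c01) nuoo nuab.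
exists g; split => // f mf f0.
pose f1 s := (f s * (\1_(`[0%R, 1%R]%classic : set R) s)%:E)%E.
have mf1 : measurable_fun setT f1.
  by apply: emeasurable_funM => //; apply/measurable_EFinP; exact: measurable_indic.
have f10 s : (0 <= f1 s)%E by rewrite mule_ge0// lee_fin.
transitivity (\int[mu]_s (f1 s * (g s)%:E))%E.
  rewrite integral_mkcond; apply: eq_integral => s _; rewrite /patch /f1 indicE.
  by case: ifPn => _; rewrite ?mule1 ?mule0 ?mul0e.
rewrite -(gI _ mf1 f10) (integral_nu mf1 f10); apply: eq_integral => k.
rewrite inE/= in_itv/= => /andP[k0 kc].
apply: eq_integral => t _; rewrite /f1 indicE mem_set ?mule1//=.
have k01 : 0 <= k < 1 / 2 by rewrite k0 (le_lt_trans kc).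
have r0 := radius_gt0 k01; have r1 := radius_le k; have /andP[h1 h2] := cos_itv t.
rewrite in_itv/=; apply/andP; split; nra.
Qed.
End superposition.

(** The potential of the mixture on the band: the integral from [0] to [c] of the
    potentials [ln 2 - ln (radius k)] of the single arcsine laws. *)
Definition bandpot c : R := (xln (1 / 2 - c) - xln (1 / 2 + c)) / 2 + (1 + ln 2) * c.

Lemma bandpot0 : bandpot 0 = 0.
Proof. by rewrite /bandpot subr0 addr0 subrr mul0r mulr0 addr0. Qed.

Lemma continuous_bandpot : continuous bandpot.
Proof.
have c1 : continuous (fun k : R => 1 / 2 - k).
  by move=> k; apply: cvgB; [exact: cvg_cst|exact: cvg_id].
have c2 : continuous (fun k : R => 1 / 2 + k).
  by move=> k; apply: cvgD; [exact: cvg_cst|exact: cvg_id].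
move=> c; apply: cvgD; last by apply: cvgM; [exact: cvg_cst|exact: cvg_id].
apply: cvgM; last exact: cvg_cst.
by apply: cvgB; [exact: (continuous_compR c1 (@continuous_xln R))|exact: (continuous_compR c2 (@continuous_xln R))].
Qed.

Lemma ln_radius k : 0 <= k < 1 / 2 -> ln (radius k) = (ln (1 / 2 - k) + ln (1 / 2 + k)) / 2.
Proof.
move=> k01; have /andP[k0 k1] := k01; have r0 := radius_gt0 k01.
have : ln (radius k ^+ 2) = ln (1 / 2 - k) + ln (1 / 2 + k).
  rewrite radius_sq// -lnM ?posrE; [by congr ln; field|lra|lra].
by rewrite lnXn// -mulr_natr => <-; field.
Qed.

Lemma is_derive_bandpot k : 0 <= k < 1 / 2 -> is_derive k 1 bandpot (ln 2 - ln (radius k)).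
Proof.
move=> k01; have /andP[k0 k1] := k01.
have h1 : 0 < 1 / 2 - k by lra.
have h2 : 0 < 1 / 2 + k by lra.
have n1 : 1 / 2 - k != 0 by rewrite gt_eqF.
have n2 : 1 / 2 + k != 0 by rewrite gt_eqF.
have d1 : is_derive k (1:R) (fun k => 1 / 2 - k) (-1).
  by apply: is_derive_eq; lra.
have d2 : is_derive k (1:R) (fun k => 1 / 2 + k) 1.
  by apply: is_derive_eq; lra.
have e1 : is_derive k (1:R) (@xln R \o (fun k => 1 / 2 - k)) ((ln `|1 / 2 - k| + 1) * -1).
  by apply: is_derive1_comp; exact: is_derive_xln.
have e2 : is_derive k (1:R) (@xln R \o (fun k => 1 / 2 + k)) ((ln `|1 / 2 + k| + 1) * 1).
  by apply: is_derive1_comp; exact: is_derive_xln.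
have -> : bandpot = 2^-1 *: ((@xln R \o (fun k => 1 / 2 - k)) - (@xln R \o (fun k => 1 / 2 + k)))
    + (1 + ln 2) *: id :> (R -> R).
  by apply/funext => z; rewrite /bandpot !(addrfctE,opprfctE,scalrfctE)/= /GRing.scale/=; ring.
have hd := is_deriveD (is_deriveZ 2^-1 (is_deriveB e1 e2)) (is_deriveZ (1 + ln 2) (is_derive_id k (1:R))).
apply: is_derive_eq hd _; rewrite ln_radius// (gtr0_norm h1) (gtr0_norm h2) /GRing.scale/=.
by field.
Qed.

Lemma ln2_radius_ge0 k : 0 <= k < 1 / 2 -> 0 <= ln 2 - ln (radius k).
Proof.
move=> k01; have r0 := radius_gt0 k01; have r1 := radius_le k.
rewrite subr_ge0 ler_ln ?posrE//; lra.
Qed.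

Lemma integral_bandpot c : 0 <= c < 1 / 2 ->
  (\int[mu]_(k in `[0%R, c]) (ln 2 - ln (radius k))%:E = (bandpot c)%:E)%E.
Proof.
move=> /andP[]; rewrite le_eqVlt => /predU1P[<- _|c0 c1].
  by rewrite set_itv1 integral_set1 bandpot0.
rewrite (ge0_FTC2_singular (F := bandpot) c0).
- by rewrite bandpot0 subr0.
- exact/cvg_at_right_filter/continuous_bandpot.
- exact/cvg_at_left_filter/continuous_bandpot.
move=> k /andP[k0 kc]; have k01 : 0 <= k < 1 / 2 by rewrite ltW// (lt_trans kc).
split; [|exact: is_derive_bandpot|exact: ln2_radius_ge0].
have r0 := radius_gt0 k01.
apply: cvgB; first exact: cvg_cst.
exact: (cvg_comp _ _ (@continuous_radius k) (continuous_ln r0)).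
Qed.

(** The band of radius [radius c] lies in the supports of all the arcsine laws that are
    mixed, and there each of them has a constant potential; at other points the single
    potentials are at most these constants. *)
Lemma optimal_density c : 0 <= c < 1 / 2 -> exists g : R -> R,
  [/\ measurable_fun setT g, forall s, 0 <= g s <= 1,
  forall a b : R, a <= b -> (\int[mu]_(s in `]a, b]) (g s)%:E = (defect c b - defect c a)%:E)%E,
  {ae mu, forall s, is_derive (s : R) (1 : R) (defect c) (g s)} &
  forall x : R,
    (\int[unit01 R]_s (logker s x * g s)%:E <= (bandpot c)%:E)%E /\
    (`|clamp01 x - 1 / 2| <= radius c ->
      (\int[unit01 R]_s (logker s x * g s)%:E = (bandpot c)%:E)%E)].
Proof.
move=> c01; have /andP[] := c01; rewrite le_eqVlt => /predU1P[c0 _|c0 c12].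
  have defect0 s : defect c s = 0.
    by rewrite -c0 /defect cprof0//; field.
  exists (cst 0); split => //.
  - by move=> s; rewrite lexx ler01.
  - by move=> a b ab; rewrite !defect0 subrr integral0.
  - have -> : defect c = cst 0 by apply/funext => s; rewrite defect0.
    by apply: aeW => s; exact: is_derive_cst.
  - move=> x; have -> : (\int[unit01 R]_s (logker s x * cst 0 s)%:E = 0)%E.
      by apply: integral0_eq => s _; rewrite mulr0.
    by rewrite -c0 bandpot0 lexx.
have [g [mg g01 gab gd gI]] := arc_superposition c0 c12.
exists g; split => // x.
have mlk : measurable_fun setT (fun s : R => logker s x).
  by apply: measurable_logker => //; exact: measurable_cst.
have potE : (\int[unit01 R]_s (logker s x * g s)%:E =
    \int[mu]_(k in `[0%R, c]) arcpot (radius k) (clamp01 x - 1 / 2))%E.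
  rewrite integral_unit01; last by apply/measurable_EFinP; exact: measurable_funM.
  have := gI (fun s => (logker s x)%:E).
  have -> : (fun s : R => ((logker s x)%:E * (g s)%:E)%E) = (fun s => (logker s x * g s)%:E) by [].
  move=> ->; last 2 first.
  - exact/measurable_EFinP.
  - by move=> s; rewrite lee_fin logker_ge0.
  apply: eq_integral => k; rewrite inE/= in_itv/= => /andP[k0 kc].
  have k01 : 0 <= k < 1 / 2 by rewrite k0 (le_lt_trans kc).
  have r0 := radius_gt0 k01; have r1 := radius_le k.
  apply: eq_integral => t _; rewrite /logker; have /andP[h1 h2] := cos_itv t.
  rewrite (@clamp01_id _ (1 / 2 + _)); last by apply/andP; split; nra.
  by rewrite distrC; congr (- ln `| _ |)%:E; ring.
set x' := clamp01 x - 1 / 2 in potE *.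
have x12 : `|x'| <= 1 / 2 by exact: cl12.
have mr := measurable_radius.
have mpot : measurable_fun setT (fun k : R => arcpot (radius k) x').
  pose f (z : measurableTypeR R * measurableTypeR R) := (- ln `|x' - radius z.1 * cos z.2|)%:E.
  apply: (@measurable_fun_fubini_tonelli_F _ _ _ _ _ U f).
    apply/measurable_EFinP; apply: measurableT_comp => //.
    apply: (measurableT_comp measurable_lnabs); apply: measurable_funB => //.
    apply: measurable_funM; first by apply: (measurableT_comp mr); exact: measurable_fst.
    by apply: (measurableT_comp measurable_cos); exact: measurable_snd.
  move=> z; rewrite lee_fin; apply: nln_ge0; apply: dist_cos_le1 => //.
  by rewrite sqrtr_ge0 radius_le.
have Ik k : `[0%R, c]%classic k -> 0 <= k < 1 / 2.
  by rewrite /= in_itv/= => /andP[k0 kc]; rewrite k0 (le_lt_trans kc).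
rewrite potE -integral_bandpot//; split.
  apply: ge0_le_integral => //.
  - move=> k /Ik k01; apply: integral_ge0 => t _; rewrite lee_fin.
    by apply: nln_ge0; apply: dist_cos_le1 => //; rewrite sqrtr_ge0 radius_le.
  - exact: measurable_funTS.
  - apply: measurable_funTS; apply/measurable_EFinP; apply: measurable_funB => //.
    exact: measurable_lncomp.
  - by move=> k /Ik k01; apply: arcpot_le => //; rewrite radius_gt0// radius_le.
move=> xc; apply: eq_integral => k; rewrite inE => kI; have k01 := Ik k kI.
rewrite arcpot_in//; first by rewrite radius_gt0// radius_le.
apply: (le_trans xc); apply: radius_dec.
by move: kI; rewrite /= in_itv.
Qed.
End profile.

(** * Densities and energies of the competitors *)

Section competitors.
Context {R : realType}.
Local Notation mu := (@lebesgue_measure R).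
Local Notation P := (unit01 R).
Local Notation T := (measurableTypeR R).

Lemma calFP y (f : R -> R) : calF y f <->
  [/\ forall s t, 0 <= s -> s <= t -> t <= 1 -> 0 <= f t - f s <= t - s, f 0 = 0 & f 1 = y].
Proof.
split=> [[_ fmono flip f0 f1]|[fL f0 f1]].
- split => // s t s0 st t1; have s01 : 0 <= s <= 1 by rewrite s0 (le_trans st).
  have t01 : 0 <= t <= 1 by rewrite t1 (le_trans s0).
  have fst : f s <= f t by apply: fmono; rewrite ?in_itv.
  rewrite subr_ge0 fst/=; have /= := flip (t, s).
  rewrite !in_itv/= s01 t01 mul1r => /(_ (conj isT isT)).
  by rewrite !ger0_norm ?subr_ge0.
- split => //.
  + move=> z [s /=]; rewrite in_itv/= => /andP[s0 s1] <-; rewrite in_itv/=.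
    have := fL 0 s (lexx _) s0 s1; have := fL s 1 s0 s1 (lexx _).
    by rewrite f0 => /andP[h1 h2] /andP[h3 h4]; apply/andP; split; lra.
  + move=> s t; rewrite !in_itv/= => /andP[s0 s1] /andP[t0 t1] st.
    by have /andP[+ _] := fL s t s0 st t1; rewrite subr_ge0.
  + move=> [s t] /= [] /=; rewrite !in_itv/= mul1r => /andP[s0 s1] /andP[t0 t1].
    have [st|/ltW ts] := leP s t.
      have /andP[h1 h2] := fL s t s0 st t1.
      by rewrite distrC [`|s - t|]distrC (ger0_norm h1) ger0_norm ?subr_ge0.
    have /andP[h1 h2] := fL t s t0 ts s1.
    by rewrite (ger0_norm h1) ger0_norm ?subr_ge0.
Qed.

Lemma calF_sub1lip y (f : R -> R) : calF y f -> sub1lip (f \o clamp01).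
Proof.
move=> /calFP[fL _ _] s t st /=; have /andP[h h'] := @clamp01_sub1lip R _ _ st.
have /andP[s0 _] := clamp01_itv s; have /andP[_ t1] := clamp01_itv t.
have := fL (clamp01 s) (clamp01 t) s0; rewrite -[_ <= clamp01 t]subr_ge0.
by move=> /(_ h t1)/andP[-> h1]; apply: le_trans h'.
Qed.

(** Extending [f] by constants outside the unit interval gives a nondecreasing
    1-Lipschitz function on the line, to which [sub1lip_density] applies. *)
Lemma calF_density y (f : R -> R) : calF y f -> exists h : R -> R,
  [/\ measurable_fun setT h, forall s, 0 <= h s <= 1,
  forall a b : R, 0 <= a -> a <= b -> b <= 1 ->
    (\int[mu]_(s in `]a, b]) (h s)%:E = (f b - f a)%:E)%E &
  {ae mu, forall s, 0 < (s : R) < 1 -> is_derive (s : R) (1 : R) f (h s)}].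
Proof.
move=> fF; pose F := f \o clamp01; have FL : sub1lip F := calF_sub1lip fF.
have Fnd : nondecreasing F by move=> s t /FL/andP[]; rewrite subr_ge0.
have Frc : right_continuous F by apply/right_continuousW; exact: sub1lip_continuous.
pose Fc : cumulative R R := HB.pack F (isCumulative.Build R _ R F Fnd Frc).
have mI : measurable (`]0%R, 1%R]%classic : set T) by exact: measurable_itv.
(* The restriction is a finite measure by construction and does not change the mass. *)
pose nu : {measure set T -> \bar R} := mrestr (lebesgue_stieltjes_measure Fc) mI.
have nuE (a b : R) : a <= b -> nu `]a, b]%classic = (F b - F a)%:E.
  move=> ab; rewrite /nu/= /mrestr.
  have -> : `]a, b]%classic `&` `]0, 1]%classic = `]Num.max a 0, Num.min b 1]%classic :> set R.
    by apply/seteqP; split => s /=; rewrite !in_itv/= gt_max le_min;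
      [move=> [/andP[-> ->] /andP[-> ->]]|move=> /andP[/andP[-> ->] /andP[-> ->]]].
  have e1 : F (Num.min b 1) = F b.
    rewrite /F/=; case: leP => b1 //; rewrite clamp01_id ?ler01 ?lexx//.
    by rewrite clamp01_gt1.
  have e2 : F (Num.max a 0) = F a.
    rewrite /F/=; case: leP => a0 //; rewrite [in LHS]clamp01_id ?ler01 ?lexx//.
    move: a0; rewrite le_eqVlt => /predU1P[->|/clamp01_lt0->//].
    by rewrite clamp01_id ?ler01 ?lexx.
  have [le|lt] := leP (Num.max a 0) (Num.min b 1).
    by rewrite -e1 -e2; exact: (LS_itv Fc).
  rewrite set_itv_ge; last by rewrite bnd_simp -leNgt ltW.
  rewrite measure0 -e1 -e2; congr EFin.
  apply/esym/eqP; rewrite subr_eq0 eq_le Fnd ?(ltW lt)// e1 e2.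
  by rewrite Fnd.
have nuoo : (nu setT < +oo)%E.
  have -> : nu setT = nu `]0%R, 1%R]%classic by rewrite /nu/= /mrestr setTI setIid.
  by rewrite nuE// ltry.
have [h [mh h01 hab hd _]] := sub1lip_density FL nuoo nuE.
exists h; split => //.
- move=> a b a0 ab b1; rewrite hab// /F/= !clamp01_id//; apply/andP; split => //.
    exact: le_trans ab b1.
  exact: le_trans a0 ab.
- apply: ae_imp hd => s hs /andP[s0 s1].
  apply: near_eq_is_derive hs; near=> z; rewrite /F/= clamp01_id//.
  apply/andP; split; apply: ltW; near: z; [exact: lt_nbhsr|exact: lt_nbhsl].
Unshelve. all: by end_near. Qed.

Lemma is_derive_derive1 (f : R -> R) (x l : R) : is_derive x 1 f l -> derive1 f x = l.
Proof. by move=> [_ <-]; rewrite derive1E. Qed.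

Lemma logform11 : logform (fun _ : T => 1 : R) (fun=> 1) = 3 / 2.
Proof.
apply: EFin_inj; rewrite -logform_integral; [|exact: bmeas_cst..].
rewrite -integral2_logker; apply: eq_integral => x _; apply: eq_integral => y _.
by rewrite !mulr1 logkerC.
Qed.

Lemma bmeas01 (h : T -> R) : measurable_fun setT h -> (forall s, 0 <= h s <= 1) -> bmeas h.
Proof.
move=> mh h01; split => //; exists 1 => s.
by have /andP[h0 h1] := h01 s; rewrite ger0_norm.
Qed.

(** Centring at [1 / 2] turns the energy into a pure square: the mixed terms cancel and
    [logform 1 1 = 3 / 2]. *)
Lemma logform_half (h : T -> R) : bmeas h ->
  logform (fun s => 1 - h s) h = 3 / 8 - logform (fun s => 1 / 2 - h s) (fun s => 1 / 2 - h s).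
Proof.
move=> bh; pose v (s : T) := 1 / 2 - h s.
have bv : bmeas v by apply: bmeasB => //; exact: bmeas_cst.
have b1 : bmeas (fun _ : T => 1 : R) by exact: bmeas_cst.
have bz : bmeas (fun s : T => (1 / 2) * (1 : R)) by exact: bmeas_cst.
have bm : bmeas (fun s : T => -1 * v s) by exact: bmeasZ.
have hE : h = (fun s => (1 / 2) * 1 + -1 * v s) by apply/funext => s; rewrite /v; ring.
have h'E : (fun s => 1 - h s) = (fun s => (1 / 2) * 1 + v s).
  by apply/funext => s; rewrite /v; field.
have D u : bmeas u -> logform u h = 1 / 2 * logform u (fun=> 1) - logform u v.
  move=> bu; rewrite logformC// [in LHS]hE logformDl// logformZl// logformZl//.
  by rewrite !(logformC _ bu)//; ring.
rewrite D; last by rewrite h'E; exact: bmeasD.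
rewrite h'E (logformDl bz bv b1) (logformDl bz bv bv) (logformZl _ b1 b1) (logformZl _ b1 bv).
by rewrite logform11 (logformC b1 bv) -/v; field.
Qed.

Lemma ae_neq (a : R) : {ae mu, forall s, (s : R) != a}.
Proof.
exists [set a]; split; [exact: measurable_set1|exact: lebesgue_measure_set1|].
by move=> s /= /negP; rewrite negbK => /eqP.
Qed.

Lemma ae_itv01 (p : R -> Prop) : {ae mu, forall s, 0 < (s : R) < 1 -> p s} ->
  {ae mu, forall s, 0 <= (s : R) <= 1 -> p s}.
Proof.
move=> hp; apply: (ae_imp2 _ hp (ae_imp2 (fun _ a b => conj a b) (ae_neq 0) (ae_neq 1))).
move=> s hs [s0 s1] /andP[h0 h1]; apply: hs.
by rewrite lt_neqAle eq_sym s0 h0 lt_neqAle s1 h1.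
Qed.

(** The derivative may be replaced by a density outside a null set of [s] for each [t],
    and then outside a null set of [t]. *)
Lemma energy_logform (f : R -> R) (h : T -> R) : bmeas h ->
  {ae mu, forall s, 0 < (s : R) < 1 -> is_derive (s : R) (1 : R) f (h s)} ->
  energy f = (logform (fun s => 1 / 2 - h s) (fun s => 1 / 2 - h s) - 3 / 8)%:E.
Proof.
move=> bh hd; have [mh _] := bh.
have bh1 : bmeas (fun s => 1 - h s) by apply: bmeasB => //; exact: bmeas_cst.
have : {ae mu, forall s, 0 <= (s : R) <= 1 -> derive1 f s = h s}.
  by apply: ae_itv01; apply: ae_imp hd => s hs /hs /is_derive_derive1.
move=> [M [mM M0 MN]].
have hM (s : R) : `[0, 1]%classic s -> ~ M s -> derive1 f s = h s.
  by rewrite /= in_itv/= => s01 nM; apply: contrapT => nd; apply: nM; apply: MN => /= /(_ s01).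
pose k (t s : T) : R := logker t s * ((1 - h t) * h s).
have bth := bmeas_tensor bh1 bh.
have PPk := integrable_logkerM bth.
have mk t : measurable_fun setT (fun s => (k t s)%:E).
  apply/measurable_EFinP; apply: measurable_funM.
    by apply: measurable_logker => //; exact: measurable_cst.
  by apply: measurable_funM => //; exact: measurable_cst.
have inner (t : R) : `[0, 1]%classic t ->
    (\int[mu]_(s in `[0%R, 1%R]) (ln `|(s : R) - (t : R)| * h s * (h t - 1))%:E
     = \int[P]_s (k t s)%:E)%E.
  rewrite /= in_itv/= => t01; rewrite integral_unit01; last exact: mk.
  apply: eq_integral => s.
  rewrite inE/= in_itv/= => s01; congr EFin.
  by rewrite /k logkerC /logker (clamp01_id s01) (clamp01_id t01); ring.
rewrite /energy.
transitivity (- \int[mu]_(t in `[0%R, 1%R]) \int[P]_s (k t s)%:E)%E.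
  congr (- _)%E.
  apply: (@integral_null_congr _ T R mu _ M) => // t tI tM.
  rewrite -inner//; apply: (@integral_null_congr _ T R mu _ M) => // s sI sM.
  by rewrite !hM.
rewrite -integral_unit01; last first.
  by have := measurable_fubini_F PPk; apply.
rewrite logform_integral// logform_half// -EFinN; congr EFin; ring.
Qed.
End competitors.

(** * The variational inequality *)

(** The last clause is the Karush-Kuhn-Tucker inequality in integrated form. Its
    multiplier [2 * bandpot c] belongs to the constraint on the mean, and its quadratic
    remainder will give uniqueness. *)
Definition optimal (R : realType) (c : R) (g : R -> R) : Prop :=
  [/\ measurable_fun setT g, forall s, 0 <= g s <= 1,
  forall a b : R, a <= b ->
    (\int[@lebesgue_measure R]_(s in `]a, b]) (g s)%:E = (defect c b - defect c a)%:E)%E,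
  {ae @lebesgue_measure R, forall s,
     is_derive (s : R) (1 : R) (defect c) (g s) /\ g s <= 1 / 2} &
  forall w : R -> R, bmeas (w : measurableTypeR R -> R) ->
    {ae @lebesgue_measure R, forall s, 0 <= (s : R) <= 1 -> w s <= 1 / 2} ->
    logform g g + 2 * bandpot c * (\int[unit01 R]_s w s - \int[unit01 R]_s g s)
      + logform (fun s => w s - g s) (fun s => w s - g s) <= logform w w].

Section variational.
Context {R : realType}.
Local Notation mu := (@lebesgue_measure R).
Local Notation P := (unit01 R).
Local Notation T := (measurableTypeR R).
Implicit Types (u v w g : T -> R).

Lemma Rintegral_ae_ge0 u : bmeas u -> {ae P, forall x, 0 <= u x} -> 0 <= \int[P]_x u x.
Proof.
move=> bu u0; have [mu' _] := bu.
have bm : measurable_fun setT (fun x => Num.max 0 (u x)).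
  by apply: measurable_maxr => //; exact: measurable_cst.
rewrite -lee_fin -Rintegral_EFin//.
rewrite (ae_eq_integral (fun x => (Num.max 0 (u x))%:E))//.
- by apply: integral_ge0 => x _; rewrite lee_fin le_max lexx.
- exact/measurable_EFinP.
- exact/measurable_EFinP.
- by apply: filterS u0 => x u0 _; rewrite max_r.
Qed.

Lemma logformBB u g : bmeas u -> bmeas g ->
  logform u u = logform g g + 2 * logform (fun x => u x - g x) g
    + logform (fun x => u x - g x) (fun x => u x - g x).
Proof.
move=> bu bg; set d := (fun x => u x - g x).
have bd : bmeas d by exact: bmeasB.
have -> : u = (fun x => d x + g x) by apply/funext => x; rewrite /d; ring.
have bs : bmeas (fun x => d x + g x) by exact: bmeasD.
rewrite (logformDl bd bg bs) (logformC bd bs) (logformC bg bs).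
by rewrite !(logformDl bd bg) // (logformC bg bd); ring.
Qed.

(** Fubini: pairing with [g] is integration against the potential of [g]. *)
Lemma logform_potential u g (L : R) : bmeas u -> bmeas g -> (forall s, 0 <= g s) ->
  (forall x, (\int[P]_s (logker s x * g s)%:E <= L%:E)%E) ->
  exists2 p : T -> R, bmeas p /\ (forall x, (\int[P]_s (logker s x * g s)%:E)%E = (p x)%:E) &
    logform u g = \int[P]_x (u x * p x).
Proof.
move=> bu bg g0 pL; have [mg _] := bg; have [mu' _] := bu.
pose q x := (\int[P]_s (logker x s * g s)%:E)%E.
have qE x : q x = (\int[P]_s (logker s x * g s)%:E)%E.
  by apply: eq_integral => s _; rewrite logkerC.
have q0 x : (0 <= q x)%E.
  by apply: integral_ge0 => s _; rewrite lee_fin mulr_ge0// logker_ge0.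
have qf x : q x \is a fin_num.
  by rewrite ge0_fin_numE// (le_lt_trans _ (ltry L))// qE.
have mq : measurable_fun setT q.
  apply: (@measurable_fun_fubini_tonelli_F _ _ _ _ _ P
    (fun z : T * T => (logker z.1 z.2 * g z.2)%:E)).
    apply/measurable_EFinP; apply: measurable_funM.
      by apply: measurable_logker; [exact: measurable_fst|exact: measurable_snd].
    by apply: (measurableT_comp mg); exact: measurable_snd.
  by move=> z; rewrite lee_fin mulr_ge0// logker_ge0.
exists (fun x => fine (q x)).
  split; last by move=> x; rewrite fineK// qE.
  split; first by apply: measurableT_comp.
  exists L => x; rewrite ger0_norm ?fine_ge0//.
  by rewrite -lee_fin fineK// qE.
apply: EFin_inj; rewrite -logform_integral// -Rintegral_EFin; last first.
  apply: bmeasM => //; split; first by apply: measurableT_comp.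
  exists L => x; rewrite ger0_norm ?fine_ge0//.
  by rewrite -lee_fin fineK// qE.
apply: eq_integral => x _; rewrite EFinM fineK//.
under eq_integral do rewrite mulrCA EFinM.
rewrite integralZl//.
apply/integrableP; split.
  apply/measurable_EFinP; apply: measurable_funM => //.
  by apply: measurable_logker => //; exact: measurable_cst.
under eq_integral => s _ do rewrite gee0_abs ?lee_fin ?mulr_ge0 ?logker_ge0//.
by rewrite -ge0_fin_numE ?q0//; exact: qf.
Qed.

(** Outside the band the candidate is constant, so that the density is saturated. *)
Lemma is_derive_defect_out c (s : R) : 0 <= c < 1 / 2 -> 0 < s < 1 ->
  radius c < `|s - 1 / 2| -> is_derive s 1 (defect c) (1 / 2).
Proof.
move=> c01 /andP[s0 s1] rs.
pose k : R := if s - 1 / 2 < 0 then 0 else 1 / 2 - c.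
apply: (@near_eq_is_derive R R R (fun z => z / 2 - k)); last first.
  by apply: is_derive_eq; rewrite /GRing.scale/=; lra.
have r0 := radius_gt0 c01.
have z01 : \forall z \near s, 0 <= z <= 1.
  by near=> z; apply/andP; split; apply: ltW; near: z; [exact: lt_nbhsr|exact: lt_nbhsl].
rewrite /k; have [h|h] := ltP (s - 1 / 2) 0.
  have sr : s < 1 / 2 - radius c by move: rs; rewrite ltr0_norm//; lra.
  near=> z; have zz : z < 1 / 2 - radius c by near: z; exact: lt_nbhsl.
  have z0 : z - 1 / 2 < 0 by lra.
  rewrite /defect clamp01_id; last by near: z.
  by rewrite /cprof ltr0_norm// z0 ifF//; apply/negbTE; rewrite -leNgt; lra.
have sr : 1 / 2 + radius c < s by move: rs; rewrite ger0_norm//; lra.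
near=> z; have zz : 1 / 2 + radius c < z by near: z; exact: lt_nbhsr.
have z0 : 0 <= z - 1 / 2 by lra.
rewrite /defect clamp01_id; last by near: z.
by rewrite /cprof ger0_norm// !ifF//; apply/negbTE; rewrite -leNgt; lra.
Unshelve. all: by end_near. Qed.

Lemma defect2_sub1lip c : 0 <= c < 1 / 2 -> sub1lip (fun s : R => 2 * defect c s).
Proof.
move=> c01 s t st; have /andP[h1 h2] := defect_sub1lip c01 st.
have /andP[h3 h4] := @clamp01_sub1lip R _ _ st.
have /andP[a1 a2] := clamp01_itv s; have /andP[b1 b2] := clamp01_itv t.
have := @cprof_mono R c (clamp01 s - 1 / 2) (clamp01 t - 1 / 2) c01.
rewrite !ler_norml => H.
have {}H : cprof c (clamp01 s - 1 / 2) <= cprof c (clamp01 t - 1 / 2).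
  by apply: H; (try apply/andP; try split); lra.
by move: h1 h2; rewrite /defect => h1 h2; apply/andP; split; lra.
Qed.

(** Expand [logform w w] around [g]. The linear term is the integral of [w - g] against
    the potential of [g]: on the band the potential is constant, and elsewhere it is
    smaller while [g = 1 / 2 >= w]. *)
Lemma optimal_exists (c : R) : 0 <= c < 1 / 2 -> exists g : R -> R, optimal c g.
Proof.
move=> c01; have [g [mg g01 gab gd gp]] := optimal_density c01.
have bg := bmeas01 mg g01.
have gh : {ae mu, forall s, g s <= 1 / 2}.
  apply: ae_imp gd => s hs.
  have d2 : is_derive (s : R) (1 : R) (fun z => 2 * defect c z) (2 * g s).
    by apply: is_derive_eq; rewrite /GRing.scale/=; ring.
  by have /andP[_] := sub1lip_derive_bounds (defect2_sub1lip c01) d2; lra.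
exists g; split => //; first exact: (ae_imp2 (fun _ a b => conj a b) gd gh).
move=> w bw w12; rewrite (logformBB bw bg) lerD2r lerD2l -mulrA ler_pM2l//.
have bu : bmeas (fun s => w s - g s) by exact: bmeasB.
have [p [bp pE] ->] := logform_potential bu bg (fun s => proj1 (andP (g01 s))) (fun x => (gp x).1).
rewrite -RintegralB//; try exact: bmeas_integrable.
rewrite -RintegralZl//; last exact: bmeas_integrable.
have bup := bmeasM bu bp; have buL := bmeasZ (bandpot c) bu.
rewrite -subr_ge0 -RintegralB//; try exact: bmeas_integrable.
apply: Rintegral_ae_ge0; first exact: bmeasB.
apply: ae_unit01; apply: ae_itv01.
apply: (ae_imp2 _ w12 gd) => s ws gs s01.
have s01' : 0 <= s <= 1 by have /andP[s0 s1] := s01; rewrite !ltW.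
have {}ws := ws s01'.
have [le eq] := gp s; rewrite pE in le eq.
rewrite [bandpot c * _]mulrC -mulrBr.
have [sr|sr] := leP (`|s - 1 / 2|) (radius c).
  by move: eq; rewrite clamp01_id// => /(_ sr)[->]; rewrite subrr mulr0.
have gs2 : g s = 1 / 2.
  by rewrite -(is_derive_derive1 gs) (is_derive_derive1 (is_derive_defect_out c01 s01 sr)).
rewrite lee_fin in le.
by rewrite mulr_le0// ?subr_le0// gs2.
Qed.
End variational.

(** * The minimal energy *)

Section value.
Context {R : realType}.
Local Notation mu := (@lebesgue_measure R).
Local Notation P := (unit01 R).
Local Notation T := (measurableTypeR R).
Implicit Types (u v w g : T -> R).

Lemma Rintegral_unit01_step u (x : R) : bmeas u -> 0 <= x <= 1 ->
  ((\int[P]_s (\1_[set s | clamp01 s < x] s * u s))%:E =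
   \int[mu]_(s in `]0%R, x]) (u s)%:E)%E.
Proof.
move=> bu /andP[x0 x1]; have [mu' _] := bu.
have mS : measurable ([set s | clamp01 s < x] : set T).
  have -> : [set s | clamp01 s < x] = clamp01 @^-1` `]-oo, x[ by apply/seteqP; split => s /=; rewrite in_itv.
  by rewrite -[X in measurable X]setTI; apply: measurable_clamp01.
have bi : bmeas (\1_[set s | clamp01 s < x] : T -> R).
  split; first exact: measurable_indic.
  by exists 1 => s; rewrite indicE; case: (_ \in _); rewrite ?normr1 ?normr0.
have mE : measurable_fun setT (EFin \o u) by exact/measurable_EFinP.
rewrite -Rintegral_EFin; last exact: bmeasM.
rewrite integral_unit01; last first.
  by apply/measurable_EFinP; apply: measurable_funM; [case: bi|].
transitivity (\int[mu]_(s in `[0%R, x[) (u s)%:E)%E.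
  rewrite integral_mkcond [RHS]integral_mkcond; apply: eq_integral => s _.
  rewrite /patch; case: ifPn => [|/negP h]; rewrite ?inE/= ?in_itv/=.
    move=> s01; rewrite indicE; have [/andP[s0 s1]] := (s01, s01).
    have [sx|sx] := ltP s x.
      by rewrite !mem_set ?mul1r//= ?in_itv/= ?clamp01_id ?s0 ?sx.
    rewrite memNset/= ?mul0r ?ifF//; last by rewrite clamp01_id// => /(le_lt_trans sx); rewrite ltxx.
    by apply/negbTE; apply/negP; rewrite inE/= in_itv/= => /andP[_ /(le_lt_trans sx)]; rewrite ltxx.
  rewrite ifF//; apply/negbTE; apply/negP; rewrite inE/= in_itv/= => /andP[s0 sx]; apply: h.
  by rewrite inE/= in_itv/= s0 (le_trans (ltW sx)).
rewrite integral_itv_bndo_bndc; last exact: measurable_funTS.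
by rewrite [RHS]integral_itv_obnd_cbnd//; exact: measurable_funTS.
Qed.

Lemma Rintegral_unit01 u : bmeas u ->
  ((\int[P]_s u s)%:E = \int[mu]_(s in `]0%R, 1%R]) (u s)%:E)%E.
Proof.
move=> bu; rewrite -Rintegral_EFin// integral_unit01; last first.
  by apply/measurable_EFinP; case: bu.
rewrite -integral_itv_obnd_cbnd//; apply/measurable_funTS/measurable_EFinP.
by case: bu.
Qed.

Lemma defect0 (c : R) : 0 <= c < 1 / 2 -> defect c 0 = 0.
Proof.
move=> c01; rewrite /defect clamp01_id ?lexx ?ler01// /cprof.
have rl := radius_le c.
have -> : `|0 - 1 / 2| = 1 / 2 :> R by rewrite sub0r normrN ger0_norm.
by rewrite ltNge rl/= ifT; lra.
Qed.

Lemma defect1 (c : R) : 0 <= c < 1 / 2 -> defect c 1 = c.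
Proof.
move=> c01; rewrite /defect clamp01_id ?lexx ?ler01// /cprof.
have rl := radius_le c.
have -> : `|1 - 1 / 2| = 1 / 2 :> R by rewrite ger0_norm; lra.
by rewrite ltNge rl/= ifF; [lra|apply/negbTE; rewrite -leNgt; lra].
Qed.

Lemma optimal_bmeas (c : R) g : optimal c g -> bmeas g.
Proof. by move=> [mg g01 _ _ _]; exact: bmeas01. Qed.

Lemma optimal_le12 (c : R) g : optimal c g ->
  {ae mu, forall s, 0 <= (s : R) <= 1 -> g s <= 1 / 2}.
Proof. by move=> [_ _ _ gd _]; apply: ae_imp gd => s [_ h] _. Qed.

Lemma optimal_mean (c : R) g : 0 <= c < 1 / 2 -> optimal c g -> \int[P]_s g s = c.
Proof.
move=> c01 og; have bg := optimal_bmeas og; have [_ _ gab _ _] := og.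
by apply: EFin_inj; rewrite Rintegral_unit01// gab// defect0// defect1// subr0.
Qed.

(** Each optimal density competes in the variational inequality of the other. *)
Lemma optimal_subgradient (c c' : R) g g' : 0 <= c < 1 / 2 -> 0 <= c' < 1 / 2 ->
  optimal c g -> optimal c' g' ->
  2 * bandpot c * (c' - c) <= logform g' g' - logform g g.
Proof.
move=> c01 c01' og og'; have [_ _ _ _ /(_ g' (optimal_bmeas og'))] := og.
move=> /(_ (optimal_le12 og')); rewrite (optimal_mean c01 og) (optimal_mean c01' og').
have := logform_ge0 (bmeasB (optimal_bmeas og') (optimal_bmeas og)); lra.
Qed.

(** Compare with the zero density, the multiplier being [0]. *)
Lemma optimal0 g : optimal 0 g -> logform g g = 0.
Proof.
move=> og; have bg := optimal_bmeas og.
have b0 : bmeas (fun _ : T => 0 : R) by exact: bmeas_cst.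
have l0 : logform (fun _ : T => 0 : R) (fun=> 0) = 0.
  have -> : (fun _ : T => 0 : R) = (fun=> 0 * 0) by apply/funext => s; rewrite mulr0.
  by rewrite {1}(logformZl 0 b0) ?mul0r//; exact: bmeas_cst.
have w0 : {ae mu, forall s, 0 <= (s : R) <= 1 -> (0 : R) <= 1 / 2} by apply: aeW => s _.
have [_ _ _ _ /(_ _ b0 w0)] := og; rewrite bandpot0 l0 mulr0 mul0r addr0 => H.
have h1 := logform_ge0 bg; have h2 := logform_ge0 (bmeasB b0 bg).
apply/eqP; rewrite eq_le; apply/andP; split; lra.
Qed.

(** Both slope inequalities bound the variation of [F - G] over a step by the increment
    of [L] times the length of the step; over [n] equal steps this telescopes to
    a bound of order [1 / n]. *)
Lemma subgradient_unique (L F G : R -> R) b :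
  (forall x y, 0 <= x < b -> 0 <= y < b -> L x * (y - x) <= F y - F x) ->
  (forall x y, 0 <= x < b -> 0 <= y < b -> L x * (y - x) <= G y - G x) ->
  forall x, 0 <= x < b -> F x - F 0 = G x - G 0.
Proof.
move=> hF hG x /andP[x0 xb].
have D y z : 0 <= y -> y <= z -> z < b ->
    `|(F z - G z) - (F y - G y)| <= (L z - L y) * (z - y).
  move=> y0 yz zb.
  have hy : 0 <= y < b by rewrite y0 (le_lt_trans yz).
  have hz : 0 <= z < b by rewrite zb (le_trans y0).
  have h1 := hF _ _ hy hz; have h2 := hF _ _ hz hy.
  have h3 := hG _ _ hy hz; have h4 := hG _ _ hz hy.
  by rewrite ler_norml; apply/andP; split; lra.
have tel (n : nat) : (0 < n)%N -> forall k, (k <= n)%N ->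
    `|(F (x * k%:R / n%:R) - G (x * k%:R / n%:R)) - (F 0 - G 0)|
      <= (L (x * k%:R / n%:R) - L 0) * (x / n%:R).
  move=> n0; have n0' : 0 < n%:R :> R by rewrite ltr0n.
  elim=> [_|k IH kn]; first by rewrite mulr0 mul0r !subrr normr0 mul0r.
  have {}IH := IH (ltnW kn); set y := x * k%:R / n%:R in IH *.
  set z := x * k.+1%:R / n%:R.
  have zy : z - y = x / n%:R by rewrite /z /y -[k.+1%:R]natr1; field; rewrite gt_eqF.
  have y0 : 0 <= y by rewrite /y !mulr_ge0// invr_ge0 ltW.
  have xn : 0 <= x / n%:R by rewrite divr_ge0// ltW.
  have zx : z <= x by rewrite /z ler_pdivrMr// ler_wpM2l// ler_nat.
  have := D y z y0; rewrite zy -subr_ge0 zy => /(_ xn (le_lt_trans zx xb)) h.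
  have -> : F z - G z - (F 0 - G 0) = (F z - G z - (F y - G y)) + (F y - G y - (F 0 - G 0)) by ring.
  by apply: (le_trans (ler_normD _ _)); nra.
suff : `|(F x - G x) - (F 0 - G 0)| <= 0 by rewrite normr_le0 => /eqP; lra.
apply: (@le_geom0 _ _ ((L x - L 0) * x) (1 / 2)) => [|n]; first by apply/andP; split; lra.
(* [2 ^ n] equal steps, so that the bound is geometric in [n]. *)
have n0 : (0 < 2 ^ n)%N by rewrite expn_gt0.
have := tel _ n0 _ (leqnn _); rewrite mulfK ?gt_eqF ?ltr0n//.
by rewrite natrX mul1r exprVn mulrA.
Qed.

Lemma bandpot_mono (c c' : R) : 0 <= c -> c <= c' -> c' < 1 / 2 -> bandpot c <= bandpot c'.
Proof.
move=> c0; rewrite le_eqVlt => /predU1P[->//|cc] c1.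
have [k| |k kI E] := @MVT R (@bandpot R) (fun k => ln 2 - ln (radius k)) c c' cc.
- rewrite in_itv/= => /andP[k1 k2]; apply: is_derive_bandpot.
  by rewrite (le_trans c0 (ltW k1)) (lt_trans k2 c1).
- by apply: continuous_subspaceT; exact: continuous_bandpot.
rewrite -subr_ge0 E mulr_ge0 ?subr_ge0 ?(ltW cc)//.
move: kI; rewrite in_itv/= => /andP[k1 k2]; rewrite -subr_ge0; apply: ln2_radius_ge0.
by rewrite (le_trans c0 (ltW k1)) (lt_trans k2 c1).
Qed.

Lemma theta_xln (y : R) : 0 <= y <= 1 -> theta y =
  1 / 2 * (y * xln y) + 1 / 2 * ((1 - y) * xln (1 - y)) + (2 * ln 2 + 3) / 2 * (y * (1 - y)).
Proof.
move=> /andP[y0 y1]; rewrite /theta /xln ger0_norm// ger0_norm ?subr_ge0//; ring.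
Qed.

Lemma is_derive_theta_half (c : R) : 0 <= c < 1 / 2 ->
  is_derive c 1 (fun c => - theta (1 / 2 - c)) (2 * bandpot c).
Proof.
move=> /andP[c0 c1].
pose f1 (c : R) := 1 / 2 - c; pose f2 (c : R) := 1 / 2 + c.
have h1 : 0 < 1 / 2 - c by lra.
have h2 : 0 < 1 / 2 + c by lra.
have n1 : 1 / 2 - c != 0 by rewrite gt_eqF.
have n2 : 1 / 2 + c != 0 by rewrite gt_eqF.
have d1 : is_derive c (1:R) f1 (-1) by apply: is_derive_eq; lra.
have d2 : is_derive c (1:R) f2 1 by apply: is_derive_eq; lra.
have e1 : is_derive c (1:R) (@xln R \o f1) ((ln `|1 / 2 - c| + 1) * -1).
  by apply: is_derive1_comp; exact: is_derive_xln.
have e2 : is_derive c (1:R) (@xln R \o f2) ((ln `|1 / 2 + c| + 1) * 1).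
  by apply: is_derive1_comp; exact: is_derive_xln.
pose F : R -> R := - ((1 / 2 : R) *: (f1 * (@xln R \o f1)) + (1 / 2 : R) *: (f2 * (@xln R \o f2))
    + ((2 * ln 2 + 3) / 2 : R) *: (f1 * f2)).
apply: (@near_eq_is_derive R R R F).
  near=> k; have k01 : 0 <= 1 / 2 - k <= 1.
    apply/andP; split; last first.
      suff : - (1 / 2) < k by lra.
      by near: k; apply: lt_nbhsr; lra.
    suff : k < 1 / 2 by lra.
    by near: k; exact: lt_nbhsl.
  rewrite (theta_xln k01) /F /f1 /f2 !(addrfctE,opprfctE,scalrfctE,mulrfctE)/= /GRing.scale/=.
  have -> : 1 - (1 / 2 - k) = 1 / 2 + k by field.
  by [].
have hd := is_deriveN (is_deriveD
  (is_deriveD (is_deriveZ (1 / 2 : R) (is_deriveM d1 e1)) (is_deriveZ (1 / 2 : R) (is_deriveM d2 e2)))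
  (is_deriveZ ((2 * ln 2 + 3) / 2 : R) (is_deriveM d1 d2))).
apply: is_derive_eq hd _.
rewrite /GRing.scale/= /bandpot /xln /f1 /f2 (gtr0_norm h1) (gtr0_norm h2).
by field.
Unshelve. all: by end_near. Qed.

Lemma theta_half_subgradient (x y : R) : 0 <= x < 1 / 2 -> 0 <= y < 1 / 2 ->
  2 * bandpot x * (y - x) <= - theta (1 / 2 - y) - - theta (1 / 2 - x).
Proof.
move=> x01 y01.
have cont (a b : R) : 0 <= a -> b < 1 / 2 ->
    {within `[a, b], continuous (fun c => - theta (1 / 2 - c))}.
  move=> a0 b1; apply: derivable_within_continuous => c; rewrite in_itv/= => /andP[ca cb].
  have c01 : 0 <= c < 1 / 2 by rewrite (le_trans a0 ca) (le_lt_trans cb b1).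
  by have [] := is_derive_theta_half c01.
have /andP[x0 x1] := x01; have /andP[y0 y1] := y01.
have [xy|yx|->] := ltgtP x y; last by rewrite !subrr mulr0.
- have [k| |k kI ->] := @MVT R (fun c => - theta (1 / 2 - c)) (fun c => 2 * bandpot c) x y xy.
  + rewrite in_itv/= => /andP[k1 k2]; apply: is_derive_theta_half.
    by rewrite (le_trans x0 (ltW k1)) (lt_trans k2 y1).
  + exact: cont.
  move: kI; rewrite in_itv/= => /andP[k1 k2].
  rewrite ler_wpM2r ?subr_ge0 ?(ltW xy)// ler_pM2l// bandpot_mono ?(ltW k1)//.
  exact: lt_trans k2 y1.
- have [k| |k kI E] := @MVT R (fun c => - theta (1 / 2 - c)) (fun c => 2 * bandpot c) y x yx.
  + rewrite in_itv/= => /andP[k1 k2]; apply: is_derive_theta_half.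
    by rewrite (le_trans y0 (ltW k1)) (lt_trans k2 x1).
  + exact: cont.
  move: kI; rewrite in_itv/= => /andP[k1 k2].
  have : bandpot k <= bandpot x by rewrite bandpot_mono ?(ltW k2)// (le_trans y0 (ltW k1)).
  have yx' : 0 <= x - y by rewrite subr_ge0 ltW.
  move=> kx; suff : 2 * bandpot k * (x - y) <= 2 * bandpot x * (x - y) by move: E => /= E; lra.
  by rewrite ler_wpM2r// ler_pM2l.
Qed.

Lemma theta_half : theta (1 / 2 : R) = 3 / 8.
Proof.
rewrite /theta; have -> : 1 - 1 / 2 = 1 / 2 :> R by lra.
have -> : ln (1 / 2) = - ln 2 :> R by rewrite mul1r lnV ?posrE.
by field.
Qed.

(** Up to a constant, the minimal energy and [- theta (1 / 2 - c)] are both determined by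
    the slope [2 * bandpot c]; at [c = 0] the energy vanishes and [theta] is [3 / 8]. *)
Lemma optimal_value (c : R) g : 0 <= c < 1 / 2 -> optimal c g ->
  logform g g = 3 / 8 - theta (1 / 2 - c).
Proof.
move=> c01 og.
have ex (k : R) : exists h : R -> R, 0 <= k < 1 / 2 -> optimal k h.
  have [k01|nk] := pselect (0 <= k < 1 / 2); last by exists (fun=> 0) => /nk.
  by have [h oh] := optimal_exists k01; exists h.
have [G GO] := choice ex.
have z01 : 0 <= (0 : R) < 1 / 2 by rewrite lexx/=.
have gc : logform g g = logform (G c) (G c).
  have h1 := optimal_subgradient c01 c01 og (GO c c01).
  have h2 := optimal_subgradient c01 c01 (GO c c01) og.
  by rewrite !subrr !mulr0 in h1 h2; lra.
have := @subgradient_unique (fun c => 2 * bandpot c) (fun c => logform (G c) (G c))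
  (fun c => - theta (1 / 2 - c)) (1 / 2).
move=> /(_ (fun x y hx hy => optimal_subgradient hx hy (GO x hx) (GO y hy))).
move=> /(_ theta_half_subgradient c c01) /=.
by rewrite (optimal0 (GO 0 z01)) subr0 [1 / 2 - 0]subr0 theta_half gc => ->; ring.
Qed.
End value.

(** * The minimizers *)

Section minimizers.
Context {R : realType}.
Local Notation mu := (@lebesgue_measure R).
Local Notation P := (unit01 R).
Local Notation T := (measurableTypeR R).

Lemma atan_inv (z : R) : 0 < z -> atan z^-1 = pi / 2 - atan z.
Proof.
move=> z0; have p0 := @pi_gt0 R; have h1 := atan_ltpi2 z.
have h2 : 0 < atan z by rewrite -(@atan0 R); exact: lt_atan.
rewrite -[RHS]tanK; last by rewrite in_itv/=; apply/andP; split; lra.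
congr atan; rewrite /tan sinB cosB sin_pihalf cos_pihalf !mul1r !mul0r subr0 add0r.
have {1}-> : z = sin (atan z) / cos (atan z) by rewrite -[LHS](atanK z).
by rewrite invf_div.
Qed.

(** The closed forms differ by [atan (q / c) = pi / 2 - atan (c / q)]. *)
Lemma limit_profile_cprof (y x : R) : 0 < y < 1 / 2 ->
  limit_profile y x = cprof (1 / 2 - y) (x - 1 / 2).
Proof.
move=> /andP[y0 y1]; have c0 : 0 < 1 / 2 - y by lra.
have c01 : 0 <= 1 / 2 - y < 1 / 2 by apply/andP; split; lra.
have r0 := radius_gt0 c01.
have rE : Num.sqrt (y * (1 - y)) = radius (1 / 2 - y).
  by rewrite /radius; congr Num.sqrt; field.
rewrite /limit_profile rE /cprof ltr_norml.
set c := 1 / 2 - y in c0 c01 r0 *; set r := radius c in r0 *.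
have [xr|xr] := leP x ((1 - 2 * r) / 2).
  rewrite ifF ?ifT//; first by lra.
  by apply/negbTE; rewrite negb_and -leNgt; apply/orP; left; lra.
have -> : (- r < x - 1 / 2 < r) = (x < (1 + 2 * r) / 2).
  by apply/andP/idP => [[_]|h]; [lra|split; lra].
case: ifPn => xr'; last first.
  by move: xr'; rewrite -leNgt => xr'; rewrite ifF; [rewrite /c; lra|apply/negbTE; rewrite -leNgt; lra].
have rc : r ^+ 2 = 1 / 4 - c ^+ 2 by rewrite /r radius_sq.
rewrite /Zfun /arcprim.
have -> : 1 / 4 - (x - 1 / 2) ^+ 2 - (y - 1 / 2) ^+ 2 = 1 / 4 - c ^+ 2 - (x - 1 / 2) ^+ 2.
  by rewrite /c; field.
set q := Num.sqrt _.
have q0 : 0 < q by rewrite sqrtr_gt0 -rc; nra.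
have -> : atan (q / (1 / 2 - y)) = pi / 2 - atan (c / q).
  by rewrite -atan_inv ?divr_gt0// invf_div.
have p0 := @pi_gt0 R; have pn : pi != 0 :> R by rewrite gt_eqF.
have -> : 2 * (x - 1 / 2) * (1 / 2 - y) / q = 2 * (x - 1 / 2) * c / q by [].
have yE : y = 1 / 2 - c by rewrite /c; lra.
rewrite -!/c [in y / 2]yE.
clear p0; move: (atan _) (atan _) (atan _) (@pi R) pn => a1 a2 a3 p pn; by field.
Qed.

Lemma integrable_itv (u : T -> R) (x : R) : bmeas u ->
  mu.-integrable `]0%R, x] (EFin \o u).
Proof.
move=> [mu' [M uM]]; apply: measurable_bounded_integrable => //.
- by rewrite [X in (X < _)%E](lebesgue_measure_itv `]0%R, x])/=; case: ifP => _; rewrite ?ltry// -EFinD ltry.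
- exact: measurable_funTS.
- exists M; split; first exact: num_real.
  by move=> z Mz s _; apply: le_trans (uM s) (ltW Mz).
Qed.

(** For a competitor [h] the density [1 / 2 - h'] has the mean [c] of the optimal one, so
    that the variational inequality bounds its energy below by the optimal energy plus
    the energy of the difference, which is positive unless the functions agree. *)
Lemma cprof_minimal (y : R) (f : R -> R) : 0 < y <= 1 / 2 ->
  (forall x, 0 <= x <= 1 -> f x = cprof (1 / 2 - y) (x - 1 / 2)) ->
  [/\ calF y f, energy f = (- theta y)%:E &
   forall h, calF y h -> (energy f <= energy h)%E /\
     ((energy h <= energy f)%E -> forall x, 0 <= x <= 1 -> h x = f x)].
Proof.
move=> /andP[y0 y1] fE; pose c := 1 / 2 - y.
have c01 : 0 <= c < 1 / 2 by rewrite /c; apply/andP; split; lra.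
have fdefect x : 0 <= x <= 1 -> f x = x / 2 - defect c x.
  by move=> x01; rewrite fE// /defect clamp01_id// /c; ring.
have [g og] := optimal_exists c01.
have bg := optimal_bmeas og; have [mg g01 gab gd kkt] := og.
have bh (h : T -> R) : bmeas h -> bmeas (fun s => 1 / 2 - h s).
  by move=> bh; apply: bmeasB => //; exact: bmeas_cst.
have fen : energy f = (logform g g - 3 / 8)%:E.
  rewrite (energy_logform (bh _ bg)).
    have -> // : (fun s : T => 1 / 2 - (1 / 2 - g s)) = g.
    by apply/funext => s; ring.
  apply: ae_imp gd => s [hs _] /andP[s0 s1].
  apply: (@near_eq_is_derive R R R (fun z => z / 2 - defect c z)).
    near=> z; rewrite fdefect//; apply/andP; split; apply: ltW; near: z.
      exact: lt_nbhsr.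
    exact: lt_nbhsl.
  by apply: is_derive_eq; rewrite /GRing.scale/=; lra.
split.
- apply/calFP; split.
  + move=> s t s0 st t1; have s01 : 0 <= s <= 1 by rewrite s0 (le_trans st).
    have t01 : 0 <= t <= 1 by rewrite t1 (le_trans s0).
    have /andP[h1 _] := defect_sub1lip c01 st.
    have H : cprof c (s - 1 / 2) <= cprof c (t - 1 / 2).
      apply: cprof_mono => //; rewrite ?ler_norml; (try apply/andP; try split); lra.
    move: (H); rewrite -!fE// => {}H.
    rewrite subr_ge0 H/= !fdefect//; lra.
  + by rewrite fdefect ?lexx ?ler01// defect0//; lra.
  + by rewrite fdefect ?lexx ?ler01// defect1// /c; lra.
- rewrite fen (optimal_value c01 og); congr EFin.
  have -> : 1 / 2 - c = y by rewrite /c; ring.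
  ring.
move=> h hF; have [d [md d01 dab dd]] := calF_density hF.
have bd := bmeas01 md d01; have bw := bh _ bd; set w := (fun s : T => 1 / 2 - d s) in bw *.
have [_ h0 h1] := (calFP y h).1 hF.
have w12 : {ae mu, forall s, 0 <= (s : R) <= 1 -> w s <= 1 / 2}.
  by apply: aeW => s _; have /andP[] := d01 s; rewrite /w; lra.
have wmean : \int[P]_s w s = c.
  rewrite RintegralB//; [|apply: bmeas_integrable; exact: bmeas_cst|exact: bmeas_integrable].
  rewrite RintegralT_cst /c; congr (_ - _); apply: EFin_inj.
  by rewrite Rintegral_unit01// dab// h0 h1 subr0.
have := kkt w bw w12; rewrite wmean (optimal_mean c01 og) subrr mulr0 addr0 => K.
have bu : bmeas (fun s : T => w s - g s) by exact: bmeasB.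
have u0 := logform_ge0 bu.
rewrite fen (energy_logform bd dd) -/w !lee_fin; split; first by lra.
move=> le x x01; have /andP[x0 x1] := x01.
have {}le : logform (fun s : T => w s - g s) (fun s => w s - g s) <= 0 by lra.
have := congr1 EFin (logform0_step bu le x01).
rewrite Rintegral_unit01_step//.
have ig := integrable_itv x bg; have id := integrable_itv x bd.
have ic := integrable_itv x (@bmeas_cst _ T R (1 / 2)).
under eq_integral do rewrite /w !EFinB.
rewrite integralB//; last exact: integrableB.
rewrite integralB// integral_cst// (dab 0 x)// gab// h0 defect0//.
rewrite [X in (_ * X)%E](lebesgue_measure_itv `]0, x])/= lte_fin.
have -> : (if 0 < x then (x%:E - 0%:E)%E else 0%E) = x%:E.
  by move: x0; rewrite le_eqVlt => /predU1P[<-|->]; rewrite ?ltxx// sube0.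
by rewrite fdefect// => -[]; lra.
Unshelve. all: by end_near. Qed.

Lemma calF_reflect (y : R) f : calF y f -> calF (1 - y) (fun x => x - f x).
Proof.
move=> /calFP[fL f0 f1]; apply/calFP; split; rewrite ?f0 ?f1 ?subr0//.
by move=> s t s0 st t1; have := fL s t s0 st t1; move=> /andP[h1 h2]; apply/andP; split; lra.
Qed.

(** Reflection changes the sign of [1 / 2 - f'], under which the energy form is even. *)
Lemma energy_reflect (y : R) f : calF y f -> energy (fun x => x - f x) = energy f.
Proof.
move=> fF; have [d [md d01 _ dd]] := calF_density fF; have bd := bmeas01 md d01.
have b1 : bmeas (fun _ : T => 1 : R) by exact: bmeas_cst.
rewrite (energy_logform bd dd) (energy_logform (h := fun s => 1 - d s)); last 2 first.
- exact: bmeasB.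
- apply: ae_imp dd => s hs /hs ds; apply: is_deriveB.
set v := (fun s => 1 / 2 - d s); have bv : bmeas v by apply: bmeasB => //; exact: bmeas_cst.
have -> : (fun s : T => 1 / 2 - (1 - d s)) = (fun s => -1 * v s).
  by apply/funext => s; rewrite /v; field.
have bm : bmeas (fun s : T => -1 * v s) by exact: bmeasZ.
rewrite (logformZl _ bv bm) (logformC bv bm) (logformZl _ bv bv).
by congr EFin; ring.
Qed.

Lemma thetaC (y : R) : theta (1 - y) = theta y.
Proof. rewrite /theta; have -> : 1 - (1 - y) = y by ring. ring. Qed.

Definition fopt (y x : R) : R :=
  if y < 1 / 2 then limit_profile y x
  else if y == 1 / 2 then x / 2
  else x - limit_profile (1 - y) x.

Lemma fopt_cprof (y x : R) : 0 < y <= 1 / 2 -> 0 <= x <= 1 ->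
  fopt y x = cprof (1 / 2 - y) (x - 1 / 2).
Proof.
move=> /andP[y0]; rewrite le_eqVlt => /predU1P[->|y1] /andP[x0 x1]; rewrite /fopt.
  rewrite ltxx eqxx subrr cprof0 ?ler_norml; first by congr (_ / _); ring.
  by apply/andP; split; lra.
by rewrite y1 limit_profile_cprof// y0.
Qed.

Lemma fopt_reflect (y x : R) : 1 / 2 < y -> fopt y x = x - fopt (1 - y) x.
Proof.
move=> y1; rewrite /fopt ltNge (ltW y1)/= gt_eqF// ifT//; lra.
Qed.

Lemma fopt_minimal (y : R) : 0 < y < 1 ->
  [/\ calF y (fopt y), energy (fopt y) = (- theta y)%:E &
   forall h, calF y h -> (energy (fopt y) <= energy h)%E /\
     ((energy h <= energy (fopt y))%E -> forall x, 0 <= x <= 1 -> h x = fopt y x)].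
Proof.
move=> /andP[y0 y1]; have [y2|y2] := leP y (1 / 2).
  by apply: cprof_minimal => [|x x01]; rewrite ?fopt_cprof ?y0.
have y01 : 0 < 1 - y <= 1 / 2 by apply/andP; split; lra.
have [fF fE fM] := cprof_minimal y01 (fun x x01 => fopt_cprof y01 x01).
have -> : fopt y = (fun x => x - fopt (1 - y) x).
  by apply/funext => x; exact: fopt_reflect.
have yE : y = 1 - (1 - y) by ring.
rewrite (energy_reflect fF); split.
- by rewrite [X in calF X]yE; exact: calF_reflect.
- by rewrite fE thetaC.
move=> h hF; have := fM _ (calF_reflect hF); rewrite (energy_reflect hF) => -[le eq].
split => // /eq {}eq x x01; have := eq x x01; lra.
Qed.
End minimizers.

Unset Implicit Arguments.
Set Strict Implicit.
Set Printing Implicit Defensive.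

Theorem theorem7 (R : realType) :
  exists fstar : R -> R -> R,
    [/\ forall y : R, 0 < y < 1 ->
          minimizes_energy y (fstar y) /\
          forall g : R -> R, minimizes_energy y g ->
            forall x : R, 0 <= x <= 1 -> g x = fstar y x,
        forall y : R, 0 < y < 1 / 2 ->
          forall x : R, 0 <= x <= 1 -> fstar y x = limit_profile y x,
        forall x : R, 0 <= x <= 1 -> fstar (1 / 2) x = x / 2,
        forall y : R, 1 / 2 < y < 1 ->
          forall x : R, 0 <= x <= 1 -> fstar y x = x - fstar (1 - y) x
      & forall y : R, 0 < y < 1 -> energy (fstar y) = (- theta y)%:E].
Proof.
exists fopt; split.
- move=> y y01; have [fF _ fM] := fopt_minimal y01; split.
    by split; [exact: fF|move=> h hF; exact: (fM h hF).1].
  move=> g [gF gM]; exact: (fM g gF).2 (gM _ fF).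
- by move=> y /andP[_ y1] x _; rewrite /fopt y1.
- by move=> x _; rewrite /fopt ltxx eqxx.
- by move=> y /andP[y1 _] x _; exact: fopt_reflect.
- by move=> y y01; have [_ fE _] := fopt_minimal y01; exact: fE.
Qed.
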